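(* Let $\nu>0$ and $\eta>0$, and consider on $\mathbb R^2$ the linearized system $$ \begin{cases} \partial_{tt} u -( \eta \partial_{11} + \nu \partial_{22}) \partial_t u + \nu \eta \partial_{11} \partial_{22} u + \partial_{11}\Delta^{-1} u = 0,\\ \partial_{tt} \theta -( \eta \partial_{11} + \nu \partial_{22}) \partial_t \theta + \nu \eta \partial_{11} \partial_{22} \theta + \partial_{11}\Delta^{-1} \theta = 0, \\ u(x,0) =u_0(x), \quad \theta(x,0) = \theta_0(x), \end{cases} $$ with $u=(u_1,u_2)$, $u_0=(u_{10},u_{20})$, and initial time derivatives $$ (\partial_t u_1)(x,0) = \nu \partial_{22} u_{10}-\partial_1\partial_2\Delta^{-1}\theta_0,\quad (\partial_t u_2)(x,0) = \nu \partial_{22} u_{20}+\partial_{11}\Delta^{-1}\theta_0,\quad (\partial_t\theta)(x,0)=\eta\partial_{11}\theta_0-u_{20}. $$ Then the solution can be explicitly represented as $$ u_1(t) =K_1(t)\, u_{10} + K_2(t)\, \theta_0,\qquad u_2(t) = K_1(t)\, u_{20} + K_3(t)\, \theta_0,\qquad \theta(t) = K_4(t)\, u_{20} + K_5(t)\,\theta_0, $$ where $K_1,\dots,K_5$ are Fourier multiplier operators with symbols $$ K_1(\xi, t) = G_2(\xi, t) - \nu \xi_2^2 G_1(\xi,t), \qquad K_2(\xi,t) = -\frac{\xi_1\xi_2}{|\xi|^2}\, G_1(\xi,t),\qquad K_3(\xi,t) = \frac{\xi_1^2}{|\xi|^2} \, G_1(\xi,t), $$ $$ K_4(\xi,t)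 =- G_1(\xi,t), \qquad K_5(\xi,t) = G_2(\xi, t) - \eta \xi_1^2 G_1(\xi,t). $$ Here, with $\lambda_1,\lambda_2$ denoting the roots of $\lambda^2 + (\eta \xi_1^{2}+\nu \xi_2^{2})\lambda+ \nu \eta \xi_1^{2} \xi_2^2+ \frac{\xi_1^2}{|\xi|^2} = 0$, namely $$ \lambda_{1}=-\tfrac{1}{2}(\eta \xi_1^{2}+\nu \xi_2^{2})-\tfrac{1}{2}\sqrt{(\eta \xi_1^{2}+\nu \xi_2^{2})^2-4\left(\nu \eta \xi_1^{2}\xi_2^2+ \tfrac{\xi_1^2}{|\xi|^2}\right)}, $$ $$ \lambda_{2}=-\tfrac{1}{2}(\eta \xi_1^{2}+\nu \xi_2^{2})+\tfrac{1}{2}\sqrt{(\eta \xi_1^{2}+\nu \xi_2^{2})^2-4\left(\nu \eta \xi_1^{2}\xi_2^2+ \tfrac{\xi_1^2}{|\xi|^2}\right)}, $$ one has, when $\lambda_1\ne\lambda_2$, $$ G_1(\xi, t) = \frac{e^{\lambda_1 t}-e^{\lambda_2 t}}{\lambda_1- \lambda_2}, \qquad G_2(\xi, t) = \frac{\lambda_1 e^{\lambda_2 t}- \lambda_2 e^{\lambda_1t}}{\lambda_1 -\lambda_2}, $$ and, when $\lambda_1=\lambda_2$, $$ G_1(\xi, t) = t e^{\lambda_1 t}, \qquad G_2(\xi, t) = e^{\lambda_1 t} - \lambda_1 t\, e^{\lambda_1 t}. $$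
   Context: Here $\partial_i=\partial_{x_i}$, $\partial_{ii}=\partial_i\partial_i$, $\xi=(\xi_1,\xi_2)$. $\partial_i\partial_j\Delta^{-1}$ is the Fourier multiplier with symbol $\xi_i\xi_j/|\xi|^2$. A Fourier multiplier operator $K(t)$ with symbol $K(\xi,t)$ acts by $\widehat{K(t)f}(\xi)=K(\xi,t)\widehat f(\xi)$. When the quantity under the square root is negative, $\lambda_1,\lambda_2$ are complex conjugates. The prescribed initial time derivatives come from the first-order linearized system $\partial_t u_1=\nu\partial_{22}u_1-\partial_1\partial_2\Delta^{-1}\theta$, $\partial_t u_2=\nu\partial_{22}u_2+\partial_{11}\Delta^{-1}\theta$, $\partial_t\theta=\eta\partial_{11}\theta-u_2$, evaluated at $t=0$. *)

(* Defs.v *)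
From mathcomp Require Import all_boot all_order all_algebra.
From mathcomp Require Import complex.
From mathcomp Require Import all_classical all_reals all_analysis.
Import Order.TTheory GRing.Theory Num.Theory.
Import numFieldNormedType.Exports.

Set Implicit Arguments.
Unset Strict Implicit.
Unset Printing Implicit Defensive.

Local Open Scope classical_set_scope.
Local Open Scope ring_scope.
Local Open Scope complex_scope.

(* Points x and frequencies xi of the plane are pairs, with coordinates
   x.1 and x.2.  The unknowns are real valued, their Fourier transforms are
   complex valued. *)

Section Plane.
Context {R : realType}.
Implicit Types (f : R * R -> R) (phi : R * R -> R) (g : R * R -> R[i]).

Definition leb2 := ((@lebesgue_measure R) \x (@lebesgue_measure R))%E.

Definition L2 f : Prop := f \in Lfun leb2 2%:E.

Definition L2C g : Prop := L2 (fun xi => complex.Re (g xi)) /\ L2 (fun xi => complex.Im (g xi)).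

Definition ae_eq2 f1 f2 : Prop := {ae leb2, forall x, f1 x = f2 x}.

Definition dot (x y : R * R) : R := x.1 * y.1 + x.2 * y.2.

(* C([0, +oo[; L^2) *)
Definition L2_continuous (v : R -> R * R -> R) : Prop :=
  forall t : R, 0 <= t ->
    'N[leb2]_2%:E[EFin \o (v s \- v t)%R]%E
      @[s --> within `[0, +oo[ (nbhs t)] --> 0%E.

Definition expC (z : R[i]) : R[i] :=
  (expR (complex.Re z) * cos (complex.Im z)) +i* (expR (complex.Re z) * sin (complex.Im z)).

Definition integralC (D : set (R * R)) g : R[i] :=
  (\int[leb2]_(x in D) complex.Re (g x)) +i* (\int[leb2]_(x in D) complex.Im (g x)).

Definition fourier_ball (n : nat) f (xi : R * R) : R[i] :=
  integralC [set x | dot x x <= n%:R ^+ 2]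
    (fun x => expC (0 -i* dot x xi) * (f x)%:C).

(* The Fourier transform of an L^2 function is the limit in L^2 of the
   transforms of its restrictions to balls. *)
Definition is_fourier f g : Prop :=
  [/\ L2 f, L2C g &
    'N[leb2]_2%:E[EFin \o (fun xi => Normc.normc (g xi - fourier_ball n f xi)%R)]%E
      @[n --> \oo] --> 0%E].

(* The Fourier transform and the multiplier operators act on L^2 up to
   equality almost everywhere; [xget] picks a representative. *)
Definition fourier f : R * R -> R[i] := xget (fun=> 0) [set g | is_fourier f g].

Definition multiplier (K : R * R -> R[i]) f : R * R -> R :=
  xget (fun=> 0) [set h | L2 h /\
    {ae leb2, forall xi, fourier h xi = K xi * fourier f xi}].

(* d_1 d_1 Delta^-1 and d_1 d_2 Delta^-1; here and below the value 0 given by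
   division by 0 at xi = 0 is irrelevant, as {0} is negligible. *)
Definition d11_Lap_inv : (R * R -> R) -> R * R -> R :=
  multiplier (fun xi => (xi.1 ^+ 2 / dot xi xi)%:C).

Definition d12_Lap_inv : (R * R -> R) -> R * R -> R :=
  multiplier (fun xi => (xi.1 * xi.2 / dot xi xi)%:C).

Definition d1 phi : R * R -> R := fun x => 'D_(1, 0) phi x.
Definition d2 phi : R * R -> R := fun x => 'D_(0, 1) phi x.

Definition dseq (s : seq bool) phi : R * R -> R :=
  foldr (fun b => if b then d2 else d1) phi s.

(* smooth functions with compact support *)
Definition test_function phi : Prop :=
  (forall s, [/\ continuous (dseq s phi),
      forall x, derivable (dseq s phi) x (1, 0) &
      forall x, derivable (dseq s phi) x (0, 1)]) /\
  (exists M : R, forall x, M < `|x| -> phi x = 0).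

Definition pairing f phi : R := \int[leb2]_x (f x * phi x).

(* Solution v of the Cauchy problem for
     v_tt - (eta d_11 + nu d_22) v_t + nu eta d_11 d_22 v
       + d_11 Delta^-1 v = 0
   with v(0) = v0 and v_t(0) = v1, in the sense of distributions in x: each
   d_i is moved onto the test function, and v1 is given by its values on test
   functions.  The time derivative at 0 is one-sided. *)
Definition solves (nu eta : R) (v0 : R * R -> R) (v1 : (R * R -> R) -> R)
    (v : R -> R * R -> R) : Prop :=
  [/\ L2_continuous v,
    ae_eq2 (v 0) v0,
    forall phi, test_function phi ->
      h^-1 * (pairing (v h) phi - pairing (v 0) phi) @[h --> 0^'+] --> v1 phi &
    forall phi, test_function phi ->
      let F psi := fun t => pairing (v t) psi in
      let A := fun x => eta * d1 (d1 phi) x + nu * d2 (d2 phi) x in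
      let B := d1 (d1 (d2 (d2 phi))) in
      forall t : R, 0 < t ->
      [/\ derivable (F phi) t 1,
        derivable (derive1 (F phi)) t 1 &
        derive1 (derive1 (F phi)) t - derive1 (F A) t + nu * eta * F B t
          + pairing (d11_Lap_inv (v t)) phi = 0]].

Definition solves_system (nu eta : R) (u10 u20 theta0 : R * R -> R)
    (u1 u2 theta : R -> R * R -> R) : Prop :=
  [/\ solves nu eta u10
        (fun phi => nu * pairing u10 (d2 (d2 phi))
                    - pairing (d12_Lap_inv theta0) phi) u1,
      solves nu eta u20
        (fun phi => nu * pairing u20 (d2 (d2 phi))
                    + pairing (d11_Lap_inv theta0) phi) u2 &
      solves nu eta theta0
        (fun phi => eta * pairing theta0 (d1 (d1 phi)) - pairing u20 phi)
        theta].

Section Symbols.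
Variables nu eta : R.
Implicit Types (xi : R * R) (t : R).

Definition trace_coef xi : R := eta * xi.1 ^+ 2 + nu * xi.2 ^+ 2.

Definition det_coef xi : R :=
  nu * eta * xi.1 ^+ 2 * xi.2 ^+ 2 + xi.1 ^+ 2 / dot xi xi.

Definition discr xi : R := trace_coef xi ^+ 2 - 4 * det_coef xi.

(* sqrtC is the principal square root: it is 'i times a nonnegative real when
   the discriminant is negative. *)
Definition lambda1 xi : R[i] :=
  - (2^-1 * (trace_coef xi)%:C) - 2^-1 * sqrtC (discr xi)%:C.

Definition lambda2 xi : R[i] :=
  - (2^-1 * (trace_coef xi)%:C) + 2^-1 * sqrtC (discr xi)%:C.

Definition G1 xi t : R[i] :=
  let l1 := lambda1 xi in let l2 := lambda2 xi in
  if l1 == l2 then t%:C * expC (l1 * t%:C)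
  else (expC (l1 * t%:C) - expC (l2 * t%:C)) / (l1 - l2).

Definition G2 xi t : R[i] :=
  let l1 := lambda1 xi in let l2 := lambda2 xi in
  if l1 == l2 then expC (l1 * t%:C) - l1 * t%:C * expC (l1 * t%:C)
  else (l1 * expC (l2 * t%:C) - l2 * expC (l1 * t%:C)) / (l1 - l2).

Definition K1 t xi : R[i] := G2 xi t - (nu * xi.2 ^+ 2)%:C * G1 xi t.
Definition K2 t xi : R[i] := - (xi.1 * xi.2 / dot xi xi)%:C * G1 xi t.
Definition K3 t xi : R[i] := (xi.1 ^+ 2 / dot xi xi)%:C * G1 xi t.
Definition K4 t xi : R[i] := - G1 xi t.
Definition K5 t xi : R[i] := G2 xi t - (eta * xi.1 ^+ 2)%:C * G1 xi t.

End Symbols.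

End Plane.

(* Main.v *)
(* The proof works with the real Hartley transform, whose kernel is
   cas t = cos t + sin t: it is symmetric and its square is multiplication by
   (2 pi)^2, and a multiplier with a bounded real even symbol acts on it by
   multiplication.  All K_i are such symbols: with a, b the trace and
   determinant coefficients and g the solution of g'' + a g' + b g = 0,
   g(0) = 0, g'(0) = 1, one has G1 = g and G2 = g' + a g, whatever the sign of
   the discriminant.  An energy estimate for the first-order system gives
   |K_i| <= e^t.

   Existence: the transform of a test function decays faster than any
   polynomial, so Taylor's formula in t can be integrated against it, which
   gives the weak equation and the initial derivative.

   Uniqueness: let V be the transform of the difference of two solutions and
   N(t) the L^2 norm of V(t) on a disk, where a, b <= k / 4 and k >= 1.  If
   N(t) <= S e^(k t) on [0, T], integrating the weak equation twice against
   test functions whose transforms approximate V(t) on the disk gives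
   N(t) <= (S / 2) e^(k t).  Iterating, N = 0. *)
Require Import Defs.
From HB Require Import structures.
From mathcomp Require Import all_boot all_order all_algebra.
From mathcomp Require Import complex.
From mathcomp Require Import all_classical all_reals all_analysis.
From mathcomp Require Import measurable_realfun ring lra.
Import Order.TTheory GRing.Theory Num.Theory.
Import numFieldNormedType.Exports.
Local Open Scope classical_set_scope.
Local Open Scope ring_scope.

Set Implicit Arguments.
Unset Strict Implicit.
Unset Printing Implicit Defensive.

(** * Square integrable functions *)

(** The Hartley transform keeps real unknowns real. Its price is that a first derivative reflects
    the frequency, since the derivative of [cas t] is [cas (- t)]; the price is bearable because the
    operators moved onto test functions have even order. Inversion rests on Abel summation: the
    weight exp(-e|x|) has as transform the Poisson kernel, whose primitive is an arctangent, so
    everything is explicit on indicators of boxes, and boxes separate functions.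

    In the uniqueness half the equation holds only against fixed test functions, [a] and [b] are
    unbounded, and no time derivative of the solution is known to lie in L^2. So no differential
    inequality for N is available. Instead the test function approximates V(t) for one fixed t, the
    scalar equation is integrated in s up to t, and the bound is read at s = t. Against the weight
    e^(k s) each time integration gains 1/k, and (k/4)(1/k + 1/k^2) <= 1/2 yields the halving. The
    disk makes k finite and costs nothing, since the equation does not mix frequencies. *)

Section SquareIntegrable.
Context d (T : measurableType d) (R : realType) (mu : {measure set T -> \bar R}).
Implicit Types (f g h : T -> R) (c : R).

Local Notation intg f := (mu.-integrable setT (fun x => (f x)%:E)).
Local Notation Ltwo := (Lfun mu 2%:E).

Definition ip f g : R := \int[mu]_x (f x * g x).
(** A real-valued form of the extended-real norm ['N[mu]_2], with which it agrees on square
    integrable functions by [Lnorm_l2]; estimates then stay in ordered field arithmetic. *)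
Definition l2 f : R := Num.sqrt (ip f f).

Lemma Ltwo_measurable f : f \in Ltwo -> measurable_fun setT f.
Proof. by rewrite inE => /andP[/[!inE]]. Qed.

Lemma LtwoP f : measurable_fun setT f -> intg (fun x => f x ^+ 2) -> f \in Ltwo.
Proof.
move=> mf /integrableP[_ fi]; rewrite inE; apply/andP; split; rewrite inE//=.
rewrite /finite_norm unlock; apply: poweR_lty.
apply: le_lt_trans fi; apply: ge0_le_integral => //=.
- apply/measurable_EFinP/(@measurableT_comp _ _ _ _ _ _ (fun x : R => x `^ 2)) => //.
  exact: measurableT_comp.
- by do 2 apply: measurableT_comp => //; exact: measurable_funX.
- by move=> x _; rewrite lee_fin powR_mulrn// normrX.
Qed.

Lemma Ltwo_mul f g : f \in Ltwo -> g \in Ltwo -> intg (fun x => f x * g x).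
Proof. by move=> lf lg; apply/Lfun1_integrable/Lfun2_mul_Lfun1. Qed.

Lemma Ltwo_sqr f : f \in Ltwo -> intg (fun x => f x ^+ 2).
Proof. exact: Lfun2_integrable_sqr. Qed.

Lemma Ltwo_le f g : measurable_fun setT f -> g \in Ltwo ->
  (forall x, `|f x| <= `|g x|) -> f \in Ltwo.
Proof.
move=> mf lg fg; apply: LtwoP => //.
apply: (le_integrable _ _ _ (Ltwo_sqr lg)) => //.
- by apply/measurable_EFinP; exact: measurable_funX.
- by move=> x _; rewrite lee_fin !normrX lerXn2r ?nnegrE.
Qed.

Lemma Ltwo_add f g : f \in Ltwo -> g \in Ltwo -> (fun x => f x + g x) \in Ltwo.
Proof.
move=> lf lg; apply: LtwoP.
  by apply: measurable_funD; exact: Ltwo_measurable.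
have -> : (fun x => ((f x + g x) ^+ 2)%:E) =
    ((fun x => (f x ^+ 2)%:E) \+ ((fun x => (2 * (f x * g x))%:E) \+ (fun x => (g x ^+ 2)%:E)))%E.
  by apply/funext => x /=; rewrite -!EFinD sqrrD -mulr_natl addrA.
apply: integrableD => //; first exact: Ltwo_sqr.
apply: integrableD => //; last exact: Ltwo_sqr.
by under eq_fun do rewrite EFinM; apply: integrableZl => //; exact: Ltwo_mul.
Qed.

Lemma Ltwo_scale c f : f \in Ltwo -> (fun x => c * f x) \in Ltwo.
Proof.
move=> lf; have := @Lfun_scale _ _ _ mu f c 2 (ler1n _ 2) lf.
by rewrite (_ : (fun x => c * f x) = c \o* f)//; apply/funext => x /=; rewrite mulrC.
Qed.

Lemma Ltwo_opp f : f \in Ltwo -> (fun x => - f x) \in Ltwo.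
Proof.
by move=> /(Ltwo_scale (-1)); under eq_fun do rewrite mulN1r.
Qed.

Lemma Ltwo_sub f g : f \in Ltwo -> g \in Ltwo -> (fun x => f x - g x) \in Ltwo.
Proof. by move=> lf lg; apply: Ltwo_add => //; exact: Ltwo_opp. Qed.

Lemma Ltwo0 : (fun=> 0 : R) \in Ltwo.
Proof. by apply: LtwoP => //; under eq_fun do rewrite expr0n; exact: integrable0. Qed.

Lemma Ltwo_bounded_mul (k : T -> R) c f : measurable_fun setT k ->
  (forall x, `|k x| <= c) -> f \in Ltwo -> (fun x => k x * f x) \in Ltwo.
Proof.
move=> mk kc lf; apply: (@Ltwo_le _ (fun x => c * f x)).
- by apply: measurable_funM => //; exact: Ltwo_measurable.
- exact: Ltwo_scale.
- move=> x; rewrite !normrM ler_wpM2r//; apply: (le_trans (kc x)).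
  exact: ler_norm.
Qed.

Lemma ipC f g : ip f g = ip g f.
Proof. by apply: eq_Rintegral => x _; rewrite mulrC. Qed.

Lemma ipDl f g h : f \in Ltwo -> g \in Ltwo -> h \in Ltwo ->
  ip (fun x => f x + g x) h = ip f h + ip g h.
Proof.
move=> lf lg lh; rewrite /ip -RintegralD//; try exact: Ltwo_mul.
by apply: eq_Rintegral => x _; rewrite mulrDl.
Qed.

Lemma ipZl c f g : f \in Ltwo -> g \in Ltwo -> ip (fun x => c * f x) g = c * ip f g.
Proof.
move=> lf lg; rewrite /ip -RintegralZl//; last exact: Ltwo_mul.
by apply: eq_Rintegral => x _; rewrite mulrA.
Qed.

Lemma ipNl f g : f \in Ltwo -> g \in Ltwo -> ip (fun x => - f x) g = - ip f g.
Proof.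
move=> lf lg; rewrite -mulN1r -ipZl//; apply: eq_Rintegral => x _.
by rewrite mulN1r.
Qed.

Lemma ipBl f g h : f \in Ltwo -> g \in Ltwo -> h \in Ltwo ->
  ip (fun x => f x - g x) h = ip f h - ip g h.
Proof.
by move=> lf lg lh; rewrite ipDl ?ipNl//; exact: Ltwo_opp.
Qed.

Lemma ipDr f g h : f \in Ltwo -> g \in Ltwo -> h \in Ltwo ->
  ip h (fun x => f x + g x) = ip h f + ip h g.
Proof. by move=> lf lg lh; rewrite ipC ipDl// !(ipC h). Qed.

Lemma ipBr f g h : f \in Ltwo -> g \in Ltwo -> h \in Ltwo ->
  ip h (fun x => f x - g x) = ip h f - ip h g.
Proof. by move=> lf lg lh; rewrite ipC ipBl// !(ipC h). Qed.

Lemma ipZr c f g : f \in Ltwo -> g \in Ltwo -> ip f (fun x => c * g x) = c * ip f g.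
Proof. by move=> lf lg; rewrite ipC ipZl// ipC. Qed.

Lemma ip_ge0 f : 0 <= ip f f.
Proof. by apply: Rintegral_ge0 => x _; rewrite -expr2 sqr_ge0. Qed.

Lemma l2_ge0 f : 0 <= l2 f. Proof. exact: sqrtr_ge0. Qed.

Lemma l2_sqr f : l2 f ^+ 2 = ip f f.
Proof. by rewrite sqr_sqrtr// ip_ge0. Qed.

Lemma ip_quad f g c : f \in Ltwo -> g \in Ltwo ->
  ip (fun x => f x + c * g x) (fun x => f x + c * g x) =
  ip f f + 2 * c * ip f g + c ^+ 2 * ip g g.
Proof.
move=> lf lg; have lcg := Ltwo_scale c lg.
rewrite ipDl ?ipDr//; try exact: Ltwo_add.
rewrite !ipZl ?ipZr ?(ipC g f)//; by ring.
Qed.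

Lemma ip_CS f g : f \in Ltwo -> g \in Ltwo -> `|ip f g| <= l2 f * l2 g.
Proof.
move=> lf lg.
suff : ip f g ^+ 2 <= (l2 f * l2 g) ^+ 2.
  rewrite -real_normK ?num_real// ler_pXn2r// ?nnegrE// mulr_ge0 ?l2_ge0//.
rewrite exprMn !l2_sqr.
have [g0|g0] := eqVneq (ip g g) 0.
  have [->|fg0] := eqVneq (ip f g) 0; first by rewrite expr0n g0 mulr0.
  (* When [ip g g = 0] the quadratic form is affine in the coefficient of [g]; this coefficient
     gives it the value -1, contradicting positivity. *)
  have := ip_ge0 (fun x => f x + (- (ip f f + 1) / (2 * ip f g)) * g x).
  rewrite ip_quad// g0 mulr0 addr0.
  have -> : 2 * (- (ip f f + 1) / (2 * ip f g)) * ip f g = - (ip f f + 1).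
    by field.
  by move=> ?; exfalso; lra.
have gg : 0 < ip g g by rewrite lt_neqAle eq_sym g0 ip_ge0.
(* The coefficient minimising the quadratic. *)
have := ip_ge0 (fun x => f x + (- ip f g / ip g g) * g x).
rewrite ip_quad//.
have -> : ip f f + 2 * (- ip f g / ip g g) * ip f g + (- ip f g / ip g g) ^+ 2 * ip g g
   = ip f f - ip f g ^+ 2 / ip g g by field.
by rewrite subr_ge0 ler_pdivrMr.
Qed.

Lemma l2_triangle f g : f \in Ltwo -> g \in Ltwo ->
  l2 (fun x => f x + g x) <= l2 f + l2 g.
Proof.
move=> lf lg.
rewrite -ler_sqr ?nnegrE ?addr_ge0 ?l2_ge0// l2_sqr.
have -> : ip (fun x => f x + g x) (fun x => f x + g x) =
    ip f f + 2 * ip f g + ip g g.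
  rewrite ipDl ?ipDr//; try exact: Ltwo_add.
  by rewrite (ipC g f); ring.
rewrite sqrrD !l2_sqr -(mulr_natl (l2 f * l2 g)) lerD2r lerD2l ler_pM2l//.
exact: le_trans (ler_norm _) (ip_CS lf lg).
Qed.

Lemma l2Z c f : f \in Ltwo -> l2 (fun x => c * f x) = `|c| * l2 f.
Proof.
move=> lf; rewrite /l2 ipZl// ?ipZr//; last exact: Ltwo_scale.
by rewrite mulrA -expr2 sqrtrM ?sqr_ge0// sqrtr_sqr.
Qed.

Lemma l2N f : l2 (fun x => - f x) = l2 f.
Proof. by rewrite /l2 /ip; congr Num.sqrt; apply: eq_Rintegral => x _; rewrite mulrNN. Qed.

Lemma l2_distC f g : l2 (fun x => f x - g x) = l2 (fun x => g x - f x).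
Proof. by rewrite -l2N; congr l2; apply/funext => x; rewrite opprB. Qed.

Lemma ip_le f g : measurable_fun setT f -> g \in Ltwo ->
  (forall x, `|f x| <= `|g x|) -> ip f f <= ip g g.
Proof.
move=> mf lg fg; have lf := Ltwo_le mf lg fg.
apply: le_Rintegral => //; try exact: Ltwo_mul.
move=> x _; rewrite -!expr2 -(real_normK (num_real (f x))).
by rewrite -(real_normK (num_real (g x))) lerXn2r ?nnegrE.
Qed.

Lemma l2_le f g : measurable_fun setT f -> g \in Ltwo ->
  (forall x, `|f x| <= `|g x|) -> l2 f <= l2 g.
Proof. by move=> mf lg fg; rewrite ler_wsqrtr// ip_le. Qed.

Lemma integral_sqr f : f \in Ltwo -> (\int[mu]_x (f x ^+ 2)%:E = (l2 f ^+ 2)%:E)%E.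
Proof.
move=> lf; rewrite l2_sqr /ip /Rintegral fineK.
  by apply: eq_integral => x _; rewrite expr2.
exact: integrable_fin_num (Ltwo_mul lf lf).
Qed.

Lemma Lnorm_l2 f : f \in Ltwo -> ('N[mu]_2%:E[EFin \o f] = (l2 f)%:E)%E.
Proof.
move=> lf; rewrite unlock.
have -> : (\int[mu]_x (`|(EFin \o f) x| `^ 2) = (l2 f ^+ 2)%:E)%E.
  rewrite -integral_sqr//; apply: eq_integral => x _ /=.
  by rewrite powR_mulrn// -normrX ger0_norm ?sqr_ge0.
by rewrite poweR_EFin -powR_mulrn ?l2_ge0// -powRrM mulfV// powRr1 ?l2_ge0.
Qed.

Lemma l2_le_of_integral f c : measurable_fun setT f -> 0 <= c ->
  (\int[mu]_x (f x ^+ 2)%:E <= (c ^+ 2)%:E)%E -> f \in Ltwo /\ l2 f <= c.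
Proof.
move=> mf c0 fc.
have lf : f \in Ltwo.
  apply: LtwoP => //; apply/integrableP; split.
    by apply/measurable_EFinP; exact: measurable_funX.
  under eq_integral do rewrite gee0_abs ?lee_fin ?sqr_ge0//.
  exact: le_lt_trans fc (ltry _).
split=> //; move: fc; rewrite integral_sqr// lee_fin ler_sqr ?nnegrE//.
exact: l2_ge0.
Qed.

Lemma eq_ae_ip f f' g : measurable_fun setT f -> measurable_fun setT f' ->
  measurable_fun setT g ->
  {ae mu, forall x, f x = f' x} -> ip f g = ip f' g.
Proof.
move=> mf mf' mg ff'; congr fine; apply: ae_eq_integral => //.
- by apply/measurable_EFinP; exact: measurable_funM.
- by apply/measurable_EFinP; exact: measurable_funM.
- by apply: filterS ff' => x -> _.
Qed.

Lemma eq_ae_l2 f f' : measurable_fun setT f -> measurable_fun setT f' ->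
  {ae mu, forall x, f x = f' x} -> l2 f = l2 f'.
Proof.
move=> mf mf' ff'; rewrite /l2; congr Num.sqrt.
by rewrite (eq_ae_ip mf mf' mf ff') ipC (eq_ae_ip mf mf' mf' ff').
Qed.

Lemma l2_eq0 f : f \in Ltwo -> l2 f = 0 -> {ae mu, forall x, f x = 0}.
Proof.
move=> lf f0; have mf := Ltwo_measurable lf.
have : (\int[mu]_x `|(f x ^+ 2)%:E| = 0)%E.
  under eq_integral do rewrite gee0_abs ?lee_fin ?sqr_ge0//.
  by rewrite integral_sqr// f0 expr0n.
move=> /(proj1 (ae_eq_integral_abs mu measurableT _)).
case.
  by apply/measurable_EFinP; exact: measurable_funX.
move=> A [mA A0 sA]; exists A; split => // x /= fx; apply: sA => /= /(_ I) [].
by move/eqP; rewrite sqrf_eq0 => /eqP.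
Qed.


(** Fatou's lemma on the squares: a pointwise limit inherits a uniform L^2 bound without a
    dominating function. It serves both completeness and the L^2 bound of the transform. *)
Lemma Fatou_l2 (w : nat -> T -> R) (v : T -> R) c :
  (forall n, w n \in Ltwo) -> 0 <= c -> (forall n, l2 (w n) <= c) ->
  (forall x, w ^~ x @ \oo --> v x) -> v \in Ltwo /\ l2 v <= c.
Proof.
move=> lw c0 wc wv.
have mw n : measurable_fun setT (w n) by exact: Ltwo_measurable.
have mv : measurable_fun setT v by apply: (measurable_fun_cvg mw) => x _.
apply: l2_le_of_integral => //.
have mw2 n : measurable_fun setT (fun x => (w n x ^+ 2)%:E).
  by apply/measurable_EFinP; exact: measurable_funX.
have -> : (\int[mu]_x (v x ^+ 2)%:E = \int[mu]_x limn_einf (fun n => (w n x ^+ 2)%:E))%E.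
  apply: eq_integral => x _; apply/esym.
  apply: (cvg_limn_einf_sup _).1; apply: cvg_EFin; first exact: nearW.
  by under eq_fun do rewrite /= expr2; rewrite expr2; apply: cvgM; exact: wv.
apply: (le_trans (fatou mu measurableT mw2 _)).
  by move=> n x _; rewrite lee_fin sqr_ge0.
rewrite limn_einf_lim; apply: lime_le; first exact: is_cvg_einfs.
apply: nearW => n; apply: (@le_trans _ _ (\int[mu]_x (w n x ^+ 2)%:E)%E).
  by apply: ereal_inf_lbound; exists n => /=.
by rewrite integral_sqr// lee_fin ler_sqr ?nnegrE ?l2_ge0.
Qed.

(** Riesz-Fischer: along a subsequence with increments of norm at most 4^-k the pointwise increments
    are almost everywhere O(2^-k), so the subsequence converges pointwise, and [Fatou_l2] turns the
    pointwise limit into an L^2 limit. *)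
Lemma Ltwo_complete (u : nat -> T -> R) : (forall n, u n \in Ltwo) ->
  (forall e : R, 0 < e -> exists N, forall m n, (N <= m)%N -> (N <= n)%N ->
     l2 (fun x => u m x - u n x) <= e) ->
  exists2 v : T -> R, v \in Ltwo &
    forall e : R, 0 < e -> exists N, forall n, (N <= n)%N ->
      l2 (fun x => u n x - v x) <= e.
Proof.
move=> lu cu.
have cu' k : exists N, forall m n, (N <= m)%N -> (N <= n)%N ->
    l2 (fun x => u m x - u n x) <= (4^-1) ^+ k.
  by apply: cu; rewrite exprn_gt0.
have [N HN] := choice cu'.
(* A sum in place of a maximum: it exceeds every [N j] with [j <= k]. *)
pose s k := (\sum_(j < k.+1) N j)%N.
have sN j k : (j <= k)%N -> (N j <= s k)%N.
  move=> jk; rewrite /s (bigD1 (Ordinal (n:=k.+1) (m:=j) jk))//=.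
  exact: leq_addr.
pose w k := u (s k).
have lw k : w k \in Ltwo by exact: lu.
have mw k : measurable_fun setT (w k) by exact: Ltwo_measurable.
have wd k j : (k <= j)%N -> l2 (fun x => w j x - w k x) <= (4^-1) ^+ k.
  by move=> kj; apply: HN; apply: sN.
(* The factor 2^k still leaves an integral of at most 4^k * 16^-k = 4^-k, which is summable, and a
   finite sum at [x] forces increments of size O(2^-k) there. *)
pose D k x := (2 ^+ k * (w k.+1 x - w k x)) ^+ 2.
have mD k : measurable_fun setT (fun x => (D k x)%:E).
  apply/measurable_EFinP; apply: measurable_funX; apply: measurable_funM => //.
  exact: measurable_funB.
have D0 k x : (0 <= (D k x)%:E)%E by rewrite lee_fin sqr_ge0.
have ID k : (\int[mu]_x (D k x)%:E <= ((4^-1) ^+ k)%:E)%E.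
  have lD : (fun x => 2 ^+ k * (w k.+1 x - w k x)) \in Ltwo.
    by apply: Ltwo_scale; apply: Ltwo_sub.
  rewrite integral_sqr// lee_fin l2Z; last exact: Ltwo_sub.
  rewrite exprMn real_normK ?num_real//.
  have := wd k k.+1 (leqnSn k); set z := l2 _ => zle.
  have z0 : 0 <= z by exact: l2_ge0.
  apply: (@le_trans _ _ ((2 ^+ k) ^+ 2 * ((4^-1) ^+ k) ^+ 2)).
    by rewrite ler_wpM2l ?sqr_ge0// ler_sqr ?nnegrE.
  rewrite -!exprM mulnC (exprM 2 2) (exprM _ 2 k) -exprMn.
  by rewrite le_eqVlt; apply/orP; left; apply/eqP; congr (_ ^+ _); field.
pose S x := (\sum_(k <oo) (D k x)%:E)%E.
have mS : measurable_fun setT S by apply: ge0_emeasurable_sum.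
have IS : (\int[mu]_x S x < +oo)%E.
  rewrite integral_nneseries//.
  apply: (@le_lt_trans _ _ (\sum_(k <oo) ((4^-1) ^+ k)%:E)%E).
    by apply: lee_nneseries => [k *|k *]; [apply: integral_ge0 => x _; exact: D0|exact: ID].
  apply: (@le_lt_trans _ _ 2%:E); last exact: ltry.
  apply: lime_le; first exact: is_cvg_nneseries.
  apply: nearW => n; rewrite sumEFin lee_fin.
  suff : \sum_(0 <= i < n) (4^-1 : R) ^+ i <= 2 - 2 * (4^-1) ^+ n.
    by move=> /le_trans; apply; rewrite gerBl mulr_ge0// exprn_ge0.
  elim: n => [|n IH]; first by rewrite big_nil expr0; lra.
  rewrite big_nat_recr//= exprS.
  have : 0 <= (4^-1 : R) ^+ n by rewrite exprn_ge0.
  by move: IH; lra.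
have S0 x : (0 <= S x)%E by apply: nneseries_ge0.
have iS : mu.-integrable setT S.
  apply/integrableP; split => //.
  by under eq_integral do rewrite gee0_abs//.
pose A := [set x | S x \is a fin_num].
have mA : measurable A by rewrite -[A]setTI; exact: emeasurable_fin_num.
have aeA : {ae mu, forall x, A x}.
  by have := integrable_ae measurableT iS; apply: filterS => x /(_ I).
(* Cutting off outside the full set [A] makes the sequence converge at every point, so its limit is
   defined and measurable everywhere. *)
pose w' k x := \1_A x * w k x.
have cw' x : cvgn (w' ^~ x).
  have [xA|xA] := boolP (x \in A); last first.
    rewrite /w' indicE (negbTE xA); under eq_fun do rewrite mul0r.
    exact: is_cvg_cst.
  have Dx k : (2 ^+ k * `|w k.+1 x - w k x|) ^+ 2 <= fine (S x).
    rewrite exprMn real_normK ?num_real// -exprMn -/(D k x) -lee_fin fineK.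
      apply: le_trans (nneseries_lim_ge k.+1 _) => //.
      by rewrite big_nat_recr//= leeDr// sume_ge0.
    by move: xA; rewrite inE.
  (* For [z >= 0], [z ^+ 2 <= S] gives [z <= 1 + S], which spares a square root. *)
  pose C := 1 + fine (S x).
  have C0 : 0 <= C by rewrite addr_ge0// fine_ge0.
  have dC k : `|w k.+1 x - w k x| <= geometric C (2^-1) k.
    rewrite /= -(@ler_pM2l _ (2 ^+ k)) ?exprn_gt0// mulrCA -exprMn mulfV// expr1n mulr1.
    have := Dx k; set z := _ * _ => zS.
    have z0 : 0 <= z by rewrite mulr_ge0.
    by move: zS z0; rewrite /C; move: (fine _) z => F z; clear; nra.
  have -> : w' ^~ x = w ^~ x.
    by apply/funext => k; rewrite /w' indicE xA mul1r.
  have : cvgn (series (fun k => w k.+1 x - w k x)).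
    apply: normed_cvg; apply: (series_le_cvg _ _ dC) => //.
    - by move=> n; rewrite mulr_ge0 ?exprn_ge0.
    - by apply: is_cvg_geometric_series; rewrite ger0_norm ?invr_ge0//; lra.
  have -> : series (fun k => w k.+1 x - w k x) = (fun n => w n x - w 0%N x).
    apply/funext => n; rewrite /series /= telescope_sumr//.
  move=> cw; have -> : w ^~ x = (fun n => (w n x - w 0%N x) + w 0%N x).
    by apply/funext => n; rewrite subrK.
  by apply: is_cvgD => //; exact: is_cvg_cst.
pose v x := limn (w' ^~ x).
have w'v x : w' ^~ x @ \oo --> v x by exact: cw'.
have lw' k : w' k \in Ltwo.
  apply: (@Ltwo_bounded_mul (\1_A) 1 (w k)) => // x.
  by rewrite indicE; case: (_ \in _); rewrite ?normr1 ?normr0.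
have mw' k : measurable_fun setT (w' k) by exact: Ltwo_measurable.
have ww' k : {ae mu, forall x, w k x = w' k x}.
  by apply: filterS aeA => x Ax; rewrite /w' indicE mem_set// mul1r.
have lv k : (fun x => v x - w' k x) \in Ltwo /\ l2 (fun x => v x - w' k x) <= (4^-1) ^+ k.
  apply: (@Fatou_l2 (fun n x => w' (n + k)%N x - w' k x)) => //.
  - by move=> n; exact: Ltwo_sub.
  - move=> n; have := wd k (n + k)%N (leq_addl _ _); apply: le_trans.
    rewrite le_eqVlt; apply/orP; left; apply/eqP; apply: eq_ae_l2.
    + exact: measurable_funB.
    + exact: measurable_funB.
    + by near=> x; rewrite -(near (ww' k) x)// -(near (ww' (n + k)%N) x).
  - move=> x; apply: cvgB; last exact: cvg_cst.
    have := w'v x; rewrite -(cvg_shiftn k); exact.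
have lv' : v \in Ltwo.
  have -> : v = (fun x => (v x - w' 0%N x) + w' 0%N x) by apply/funext => x; rewrite subrK.
  by apply: Ltwo_add => //; exact: (proj1 (lv 0%N)).
exists v => // e e0.
have [k ke] : exists k, (4^-1 : R) ^+ k <= e / 2.
  have /cvgrPdist_le /(_ (e / 2)) : (4^-1 : R) ^+ n @[n --> \oo] --> 0.
    by apply: cvg_expr; rewrite ger0_norm ?invr_ge0//; lra.
  move=> /(_ _)[|k _ /(_ k)/=]; first by rewrite divr_gt0.
  by rewrite sub0r normrN ger0_norm ?exprn_ge0// => h; exists k; apply: h.
exists (s k) => n skn.
have -> : (fun x => u n x - v x) = (fun x => (u n x - w k x) + (w k x - v x)).
  by apply/funext => x; rewrite addrA subrK.
apply: (le_trans (l2_triangle _ _)); [exact: Ltwo_sub|exact: Ltwo_sub|].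
rewrite (splitr e); apply: lerD.
  apply: le_trans ke; apply: HN; last exact: sN.
  by apply: leq_trans skn; exact: sN.
apply: le_trans ke; apply: le_trans (proj2 (lv k)).
rewrite l2_distC le_eqVlt; apply/orP; left; apply/eqP; apply: eq_ae_l2.
- by apply: measurable_funB => //; exact: Ltwo_measurable.
- by apply: measurable_funB => //; exact: Ltwo_measurable.
- by apply: filterS (ww' k) => x ->.
Unshelve. all: by end_near. Qed.

End SquareIntegrable.

(** * Change of variables along measure-preserving maps *)

Section MeasurePreserving.
Context d (T : measurableType d) (R : realType) (mu : {measure set T -> \bar R}).
Variable phi : T -> T.
Hypothesis mphi : measurable_fun setT phi.
Hypothesis phi_mu : forall A, measurable A -> mu (phi @^-1` A) = mu A.

Lemma integral_pushforward_preserving (f : T -> \bar R) :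
  (\int[pushforward mu phi]_x f x = \int[mu]_x f x)%E.
Proof. by apply: eq_measure_integral => A mA _; exact: phi_mu. Qed.

Lemma ge0_integral_preserving (f : T -> \bar R) : measurable_fun setT f ->
  (forall x, 0 <= f x)%E -> (\int[mu]_x f (phi x) = \int[mu]_x f x)%E.
Proof.
move=> mf f0; rewrite -[RHS]integral_pushforward_preserving.
by rewrite (ge0_integral_pushforward mphi).
Qed.

Lemma integrable_preserving (f : T -> \bar R) : mu.-integrable setT f ->
  mu.-integrable setT (f \o phi).
Proof.
move=> /integrableP[mf fi]; apply/integrableP; split.
  exact: measurableT_comp.
rewrite (ge0_integral_preserving (f := fun x => `|f x|%E))//.
exact: measurableT_comp.
Qed.

Lemma integral_preserving (f : T -> \bar R) : mu.-integrable setT f ->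
  (\int[mu]_x f (phi x) = \int[mu]_x f x)%E.
Proof.
move=> intf; rewrite -[RHS]integral_pushforward_preserving.
rewrite (integral_pushforward mphi)//; first exact: measurable_int intf.
exact: integrable_preserving.
Qed.

Lemma Rintegral_preserving (f : T -> R) : mu.-integrable setT (EFin \o f) ->
  \int[mu]_x f (phi x) = \int[mu]_x f x.
Proof. by move=> intf; congr fine; exact: (integral_preserving intf). Qed.

Lemma Ltwo_preserving (f : T -> R) : f \in Lfun mu 2%:E ->
  (fun x => f (phi x)) \in Lfun mu 2%:E.
Proof.
move=> lf; apply: LtwoP.
  by apply: (measurableT_comp (Ltwo_measurable lf)).
exact: (integrable_preserving (Ltwo_sqr lf)).
Qed.

Lemma ae_preserving (P : T -> Prop) : {ae mu, forall x, P x} ->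
  {ae mu, forall x, P (phi x)}.
Proof.
move=> [A [mA A0 sA]]; exists (phi @^-1` A); split.
- by rewrite -[X in measurable X]setTI; exact: mphi.
- by rewrite phi_mu.
- by move=> x /= Px; exact: sA.
Qed.

End MeasurePreserving.

Lemma bounded_integrableM d (T : measurableType d) (R : realType)
  (mu : {measure set T -> \bar R}) (f k : T -> R) (c : R) :
  mu.-integrable setT (EFin \o f) -> measurable_fun setT k ->
  (forall x, `|k x| <= c) -> mu.-integrable setT (EFin \o (fun x => f x * k x)).
Proof.
move=> intf mk kc.
apply: (@integrableMl _ _ _ mu _ measurableT _ k intf mk _).
exists c; split; first exact: num_real.
by move=> M cM x _; apply: (le_trans (kc x)); exact: ltW.
Qed.

(** * Fubini for product densities with a bounded kernel *)

Section Fubini.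
Context d1 d2 (X : measurableType d1) (Y : measurableType d2) (R : realType).
Variables (m1 : {sigma_finite_measure set X -> \bar R})
          (m2 : {sigma_finite_measure set Y -> \bar R}).

(** The integrand is dominated by |f| times |c||g|, whose double integral factors by Tonelli. *)
Lemma integrable_prod_bounded (f : X -> R) (g : Y -> R) (k : X * Y -> R) (c : R) :
  m1.-integrable setT (EFin \o f) -> m2.-integrable setT (EFin \o g) ->
  measurable_fun setT k -> (forall z, `|k z| <= c) ->
  (m1 \x m2)%E.-integrable setT (fun z => (f z.1 * g z.2 * k z)%:E).
Proof.
move=> intf intg mk kc.
have mf : measurable_fun setT f by apply/measurable_EFinP; exact: measurable_int intf.
have mg : measurable_fun setT g by apply/measurable_EFinP; exact: measurable_int intg.
have mF : measurable_fun setT (fun z => (f z.1 * g z.2 * k z)%:E).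
  apply/measurable_EFinP; apply: measurable_funM => //; apply: measurable_funM.
    exact: (measurableT_comp mf measurable_fst).
  exact: (measurableT_comp mg measurable_snd).
pose G (z : X * Y) := (`|f z.1|%:E * (`|c| * `|g z.2|)%:E)%E.
have mG : measurable_fun setT G.
  apply: emeasurable_funM; apply/measurable_EFinP.
    by apply: measurableT_comp => //; exact: (measurableT_comp mf measurable_fst).
  apply: measurable_funM => //.
  by apply: measurableT_comp => //; exact: (measurableT_comp mg measurable_snd).
have G0 z : (0 <= G z)%E by rewrite /G -EFinM lee_fin mulr_ge0// mulr_ge0.
apply/integrableP; split => //.
apply: (@le_lt_trans _ _ (\int[(m1 \x m2)%E]_z G z)%E).
  apply: ge0_le_integral => //; first exact: measurableT_comp.
  move=> [x y] _; rewrite /G /= lee_fin !normrM -mulrA ler_wpM2l// mulrC.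
  by rewrite ler_wpM2r//; apply: (le_trans (kc _)); exact: ler_norm.
rewrite fubini_tonelli1//= /fubini_F /G /=.
pose I := (\int[m2]_y (`|c| * `|g y|)%:E)%E.
have mcg : measurable_fun setT (fun y => (`|c| * `|g y|)%:E).
  by apply/measurable_EFinP; apply: measurable_funM => //; exact: measurableT_comp.
have I0 : (0 <= I)%E by apply: integral_ge0 => y _; rewrite lee_fin mulr_ge0.
have Ioo : (I < +oo)%E.
  rewrite /I; under eq_integral do rewrite EFinM.
  rewrite ge0_integralZl//; last first.
    by apply/measurable_EFinP; exact: measurableT_comp.
  by apply: lte_mul_pinfty => //; move: intg => /integrableP[_].
rewrite (eq_integral (fun x => `|f x|%:E * I)%E); last first.
  by move=> x _; rewrite ge0_integralZl.
rewrite ge0_integralZr//; last by apply/measurable_EFinP; exact: measurableT_comp.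
have foo : (\int[m1]_x `|f x|%:E < +oo)%E by move: intf => /integrableP[_].
rewrite lte_mul_pinfty//; first by apply: integral_ge0 => x _; rewrite lee_fin.
by rewrite ge0_fin_numE//; apply: integral_ge0 => x _; rewrite lee_fin.
Qed.

(** Transposition of an integral operator. It is applied to the kernel [cas (dot x y)], which is
    symmetric, and to the convolution kernel [phi (x - z)]. *)
Lemma Fubini_adjoint (f : X -> R) (g : Y -> R) (k : X * Y -> R) (c : R) :
  m1.-integrable setT (EFin \o f) -> m2.-integrable setT (EFin \o g) ->
  measurable_fun setT k -> (forall z, `|k z| <= c) ->
  \int[m1]_x (f x * \int[m2]_y (g y * k (x, y))) =
  \int[m2]_y (g y * \int[m1]_x (f x * k (x, y))).
Proof.
move=> intf intg mk kc.
have iF := integrable_prod_bounded intf intg mk kc.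
have igk x : m2.-integrable setT (EFin \o (fun y => g y * k (x, y))).
  apply: (bounded_integrableM (c := c)) => //.
  exact: (measurableT_comp mk (pair1_measurable x)).
have ifk y : m1.-integrable setT (EFin \o (fun x => f x * k (x, y))).
  apply: (bounded_integrableM (c := c)) => //.
  exact: (measurableT_comp mk (pair2_measurable y)).
have := Fubini iF; rewrite /fubini_F /fubini_G /= => H.
rewrite /Rintegral; congr fine.
transitivity (\int[m1]_x \int[m2]_y (f x * g y * k (x, y))%:E)%E.
  apply: eq_integral => x _.
  under [RHS]eq_integral do rewrite -mulrA EFinM.
  rewrite integralZl//; last exact: igk.
  by rewrite EFinM fineK//; exact: (integrable_fin_num measurableT (igk x)).
rewrite H; apply: eq_integral => y _.
rewrite (_ : (fun x => (f x * g y * k (x, y))%:E) =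
    (fun x => (g y)%:E * (f x * k (x, y))%:E)%E); last first.
  by apply/funext => x; rewrite -EFinM mulrCA mulrA.
rewrite integralZl//; last exact: ifk.
by rewrite EFinM fineK//; exact: (integrable_fin_num measurableT (ifk y)).
Qed.

(** The result need not be integrable in [x], so measurability comes from Tonelli applied to the
    positive and negative parts of the integrand. *)
Lemma integrable_Fubini_kernel (g : Y -> R) (k : X * Y -> R) (c : R) :
  m2.-integrable setT (EFin \o g) -> measurable_fun setT k ->
  (forall z, `|k z| <= c) ->
  measurable_fun setT (fun x => \int[m2]_y (g y * k (x, y))).
Proof.
move=> intg mk kc.
have mg : measurable_fun setT g by apply/measurable_EFinP; exact: measurable_int intg.
have mF : measurable_fun setT (fun z : X * Y => (g z.2 * k z)%:E).
  apply/measurable_EFinP; apply: measurable_funM => //.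
  exact: (measurableT_comp mg measurable_snd).
apply: (measurableT_comp (fine_measurable _)) => //.
rewrite (_ : (fun x => _) = (fun x => \int[m2]_y ((fun z : X * Y => (g z.2 * k z)%:E)^\+ (x, y))
   - \int[m2]_y ((fun z : X * Y => (g z.2 * k z)%:E)^\- (x, y)))%E); last first.
  apply/funext => x; rewrite [LHS]integralE.
  by congr (_ - _)%E; apply: eq_integral => y _; rewrite ?funeposE ?funenegE.
apply: emeasurable_funB.
  by apply: measurable_fun_fubini_tonelli_F => //; exact: measurable_funepos.
by apply: measurable_fun_fubini_tonelli_F => //; exact: measurable_funeneg.
Qed.

Lemma Rintegral_prodM (f : X -> R) (g : Y -> R) :
  m1.-integrable setT (EFin \o f) -> m2.-integrable setT (EFin \o g) ->
  \int[(m1 \x m2)%E]_z (f z.1 * g z.2) = (\int[m1]_x f x) * (\int[m2]_y g y).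
Proof.
move=> intf intg.
have iF : (m1 \x m2)%E.-integrable setT (fun z => (f z.1 * g z.2)%:E).
  have := integrable_prod_bounded (k := cst 1) (c := 1) intf intg.
  rewrite (_ : (fun z => _) = (fun z => (f z.1 * g z.2)%:E)); last first.
    by apply/funext => z; rewrite /= mulr1.
  by apply => // z; rewrite /= normr1.
rewrite [LHS]/Rintegral -(integral12_prod_meas1 iF) /fubini_F /=.
rewrite -RintegralZr//; congr fine; apply: eq_integral => x _.
under eq_integral do rewrite EFinM.
rewrite integralZl// EFinM; congr (_ * _)%E.
by rewrite fineK//; exact: (integrable_fin_num measurableT intg).
Qed.

End Fubini.

(** * Lebesgue measure on the plane and its symmetries *)

Section Plane.
Context {R : realType}.
Local Notation leb := (@lebesgue_measure R).
Local Notation E2 := (measurableTypeR R * measurableTypeR R)%type.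

HB.instance Definition _ := Measure.copy (@leb2 R : set E2 -> \bar R)
  (((leb : {measure set (measurableTypeR R) -> \bar R}) \x
    (leb : {sigma_finite_measure set (measurableTypeR R) -> \bar R}))%E).

Lemma leb2_rect (A B : set (measurableTypeR R)) : measurable A -> measurable B ->
  leb2 (A `*` B) = (leb A * leb B)%E.
Proof. by move=> mA mB; exact: product_measure1E. Qed.

(** Squares of one exhausting sequence suffice because that sequence is nondecreasing, so two
    indices can be replaced by their maximum. *)
Fact sigma_finite_leb2 : sigma_finite [set: E2] (@leb2 R).
Proof.
have /sigma_finiteP[F [TF ndF Foo]] := sigma_finiteT
  (leb : {sigma_finite_measure set (measurableTypeR R) -> \bar R}).
exists (fun n => F n `*` F n).
  rewrite -setXTT TF predeqE => -[x y]; split.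
    move=> [/= [n _ Fnx] [k _ Gky]]; exists (maxn n k) => //; split.
    - by move: x Fnx; exact/subsetPset/ndF/leq_maxl.
    - by move: y Gky; exact/subsetPset/ndF/leq_maxr.
  by move=> [n _ []/= ? ?]; split; exists n.
move=> k; have [? ?] := Foo k; split; first exact: measurableX.
by rewrite leb2_rect// lte_mul_pinfty// ge0_fin_numE.
Qed.
HB.instance Definition _ := Measure_isSigmaFinite.Build _ _ _
  (@leb2 R : set E2 -> \bar R) sigma_finite_leb2.

(** The pushforward agrees with the product measure on rectangles, and only one measure does. *)
Lemma leb2_preserving (a b : measurableTypeR R -> measurableTypeR R) :
  measurable_fun setT a -> measurable_fun setT b ->
  (forall A, measurable A -> leb (a @^-1` A) = leb A) ->
  (forall A, measurable A -> leb (b @^-1` A) = leb A) ->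
  forall A : set E2, measurable A -> leb2 ((fun x => (a x.1, b x.2)) @^-1` A) = leb2 A.
Proof.
move=> ma mb la lb A mA.
have mab : measurable_fun [set: E2] (fun x : E2 => (a x.1, b x.2) : E2).
  by apply: measurable_fun_pair; apply: measurableT_comp.
have := @product_measure_unique _ _ _ _ R leb leb
  (pushforward (leb2 : {measure set E2 -> \bar R}) (fun x : E2 => (a x.1, b x.2) : E2)) _ A mA.
move=> H; rewrite -[LHS]/(pushforward leb2 (fun x : E2 => (a x.1, b x.2) : E2) A) -H//.
move=> B C mB mC /=; rewrite /pushforward -[RHS]/(leb B * leb C)%E -la// -(lb C)// -leb2_rect//.
- by rewrite -[X in measurable X]setTI; exact: ma.
- by rewrite -[X in measurable X]setTI; exact: mb.
Qed.

Lemma lebesgue_shift (c : R) (A : set (measurableTypeR R)) : measurable A ->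
  leb ((fun x : R => x + c) @^-1` A) = leb A.
Proof.
move=> mA.
have mshift : measurable_fun [set: measurableTypeR R] (fun x : measurableTypeR R => (x + c : measurableTypeR R)).
  exact: (@measurable_funD _ _ R _ id (cst c)).
apply/esym; apply: (@lebesgue_measure_unique R (pushforward leb (fun x : measurableTypeR R => (x + c : measurableTypeR R)))) => // X [[a b] _ <-] /=.
rewrite /pushforward (_ : _ @^-1` _ = [set` `](a - c), (b - c)]]); last first.
  by apply/seteqP; split => x /=; rewrite !in_itv/= ltrBlDr lerBrDr.
rewrite !lebesgue_measure_itv/= !lte_fin ltrBlDr subrK; case: ifP => // _.
by rewrite -!EFinB; congr EFin; ring.
Qed.

Lemma leb2N (A : set E2) : measurable A -> leb2 ((fun x => - x) @^-1` A) = leb2 A.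
Proof.
move=> mA; apply: (leb2_preserving (a := -%R) (b := -%R)) => //.
- by move=> B mB; exact: lebesgue_measureN.
- by move=> B mB; exact: lebesgue_measureN.
Qed.

Lemma leb2_shift (c : R * R) (A : set E2) : measurable A ->
  leb2 ((fun x => x + c) @^-1` A) = leb2 A.
Proof.
move=> mA; apply: (leb2_preserving (a := fun x => x + c.1) (b := fun x => x + c.2)) => //.
- exact: (@measurable_funD _ _ R _ id (cst c.1)).
- exact: (@measurable_funD _ _ R _ id (cst c.2)).
- by move=> B mB; exact: lebesgue_shift.
- by move=> B mB; exact: lebesgue_shift.
Qed.

Lemma measurable_oppE2 : measurable_fun [set: E2] (fun x : E2 => (- x : E2)).
Proof.
by apply: measurable_fun_pair; apply: (@measurableT_comp _ _ _ _ _ _ (-%R : R -> R)).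
Qed.

Lemma measurable_shiftE2 (c : R * R) :
  measurable_fun [set: E2] (fun x : E2 => (x + c : E2)).
Proof.
apply: measurable_fun_pair.
  by apply: (@measurable_funD _ _ R _ fst (cst c.1)).
by apply: (@measurable_funD _ _ R _ snd (cst c.2)).
Qed.

End Plane.

(** * The Poisson kernel *)

Lemma Rintegral_dominated d (T : measurableType d) (R : realType)
    (mu : {measure set T -> \bar R}) (f_ : nat -> T -> R) (f g : T -> R) :
  (forall n, measurable_fun setT (f_ n)) -> measurable_fun setT f ->
  {ae mu, forall x, f_ ^~ x @ \oo --> f x} ->
  mu.-integrable setT (EFin \o g) -> (forall n x, `|f_ n x| <= g x) ->
  \int[mu]_x f_ n x @[n --> \oo] --> \int[mu]_x f x.
Proof.
move=> mf_ mf ff ig fg.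
have [] := @dominated_convergence _ _ _ mu setT measurableT
  (fun n x => (f_ n x)%:E) (fun x => (f x)%:E) (fun x => (g x)%:E) _ _ _ ig _.
- by move=> n; exact/measurable_EFinP.
- exact/measurable_EFinP.
- by apply: filterS ff => x fx _; apply: cvg_EFin => //; exact: nearW.
- by apply: aeW => x n _; rewrite lee_fin.
move=> iF _ cF; apply: fine_cvg; rewrite fineK//.
exact: integrable_fin_num iF.
Qed.

Lemma ge0_integrable_le d (T : measurableType d) (R : realType)
    (mu : {measure set T -> \bar R}) (f : T -> R) (C : R) :
  measurable_fun setT f -> (forall x, 0 <= f x) ->
  (\int[mu]_x (f x)%:E <= C%:E)%E -> mu.-integrable setT (EFin \o f).
Proof.
move=> mf f0 fC; apply/integrableP; split; first exact/measurable_EFinP.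
apply: le_lt_trans (ltry C); rewrite (eq_integral (fun x => (f x)%:E))//.
by move=> x _; rewrite /= ger0_norm.
Qed.

(** * Derivation rules and integrals over [-n, n] *)

Section Derivatives.
Context {R : realType}.
Implicit Types (f g : R -> R) (x a b c : R).

Lemma is_derive_add f g x a b : is_derive x 1 f a -> is_derive x 1 g b ->
  is_derive x 1 (fun y => f y + g y) (a + b).
Proof. by move=> ? ?; exact: is_deriveD. Qed.

Lemma is_derive_sub f g x a b : is_derive x 1 f a -> is_derive x 1 g b ->
  is_derive x 1 (fun y => f y - g y) (a - b).
Proof. by move=> ? ?; exact: is_deriveB. Qed.

Lemma is_derive_opp f x a : is_derive x 1 f a -> is_derive x 1 (fun y => - f y) (- a).
Proof. by move=> ?; exact: is_deriveN. Qed.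

Lemma is_derive_mul f g x a b : is_derive x 1 f a -> is_derive x 1 g b ->
  is_derive x 1 (fun y => f y * g y) (a * g x + f x * b).
Proof.
move=> df dg; rewrite (_ : a * g x + f x * b = f x *: b + g x *: a).
  exact: is_deriveM.
by rewrite addrC; congr (_ + _); exact: mulrC.
Qed.

Lemma is_derive_comp f g x a b : is_derive (g x) 1 f a -> is_derive x 1 g b ->
  is_derive x 1 (fun y => f (g y)) (a * b).
Proof. by move=> ? ?; exact: is_derive1_comp. Qed.

Lemma is_derive_constM f x a c : is_derive x 1 f a ->
  is_derive x 1 (fun y => c * f y) (c * a).
Proof. by move=> ?; exact: is_deriveZ. Qed.

Lemma is_derive_const x c : is_derive x 1 (fun=> c) 0.
Proof. exact: is_derive_cst. Qed.

Lemma is_derive_linear x c : is_derive x 1 (fun y => c * y) c.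
Proof. by rewrite -[X in is_derive _ _ _ X]mulr1; apply: is_derive_constM; exact: is_derive_id. Qed.

Lemma FTC_Rintegral (F f : R -> R) a b : a <= b ->
  (forall x, a <= x <= b -> is_derive x 1 F (f x)) -> continuous f ->
  \int[@lebesgue_measure R]_(x in `[a, b]) f x = F b - F a.
Proof.
rewrite le_eqVlt => /predU1P[<- _ _|ab dF cf].
  by rewrite subrr set_itv1 Rintegral_set1.
have cF x : a <= x <= b -> {for x, continuous F}.
  move=> xab; apply: differentiable_continuous; apply/derivable1_diffP.
  by case: (dF x xab).
rewrite /Rintegral (@continuous_FTC2 _ f F a b)//=.
- by apply: continuous_subspaceT.
- split.
  + move=> x; rewrite in_itv/= => /andP[ax xb].
    by case: (dF x _) => //; rewrite !ltW.
  + by apply: cvg_at_right_filter; apply: cF; rewrite lexx ltW.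
  + by apply: cvg_at_left_filter; apply: cF; rewrite lexx ltW.
- move=> x; rewrite in_itv/= => /andP[ax xb]; rewrite derive1E.
  by apply: derive_val; apply: dF; rewrite !ltW.
Qed.

Lemma bigcup_symitv : \bigcup_(n : nat) [set` `[(- n%:R)%R, (n%:R : R)]] = setT.
Proof.
rewrite -subTset => x _; pose n := Num.bound (`|x| : R).
have xn : `|x| < n%:R :> R by exact: archi_boundP.
by exists n => //=; rewrite in_itv/= -ler_norml ltW.
Qed.

Lemma integral_symitv_le (f : R -> R) (C : R) : measurable_fun setT f ->
  (forall x, 0 <= f x) ->
  (forall n : nat, (\int[@lebesgue_measure R]_(x in `[(- n%:R)%R, n%:R]) (f x)%:E <= C%:E)%E) ->
  (\int[@lebesgue_measure R]_x (f x)%:E <= C%:E)%E.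
Proof.
move=> mf f0 fC.
have := @ge0_nondecreasing_set_cvg_integral _ (measurableTypeR R) R
  (fun n : nat => [set` `[(- n%:R)%R, (n%:R : R)]]) (fun x => (f x)%:E) (@lebesgue_measure R).
rewrite bigcup_symitv => H.
have cv := H _ _ _ _.
rewrite -(cvg_lim _ (cv _ _ _ _))//.
- apply: lime_le; last by apply: nearW.
  apply/cvg_ex; eexists; apply: cv.
  + move=> n m nm; apply/subsetPset => x /=; rewrite !in_itv/= -!ler_norml => /le_trans; apply.
    by rewrite ler_nat.
  + by move=> n; exact: measurable_itv.
  + by move=> n; apply/measurable_EFinP; apply: measurable_funTS.
  + by move=> n x _; rewrite lee_fin.
- move=> n m nm; apply/subsetPset => x /=; rewrite !in_itv/= -!ler_norml => /le_trans; apply.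
  by rewrite ler_nat.
- by move=> n; apply/measurable_EFinP; apply: measurable_funTS.
- by move=> n x _; rewrite lee_fin.
Qed.

Lemma Rintegral_symitv_cvg (f : R -> R) :
  (@lebesgue_measure R).-integrable setT (EFin \o f) ->
  \int[@lebesgue_measure R]_(x in `[(- n%:R)%R, n%:R]) f x @[n --> \oo] -->
  \int[@lebesgue_measure R]_x f x.
Proof.
move=> intf.
have mf : measurable_fun setT f by apply/measurable_EFinP; exact: measurable_int intf.
under eq_fun do rewrite Rintegral_mkcond.
apply: (@Rintegral_dominated _ (measurableTypeR R) _ _ _ _ (fun x => `|f x|)) => //.
- by move=> n; apply/(measurable_restrictT _ _).1 => //; apply: measurable_funTS.
- apply: aeW => x; apply: cvg_near_cst.
  near=> n; rewrite patchE ifT// inE/= in_itv/= -ler_norml ltW//.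
  apply: (lt_le_trans (archi_boundP (normr_ge0 x))).
  by rewrite ler_nat; near: n; exact: nbhs_infty_ge.
- exact: integrable_norm.
- by move=> n x; rewrite patchE; case: ifP => // _; rewrite normr0.
Unshelve. all: by end_near. Qed.

End Derivatives.

Section Poisson.
Context {R : realType}.
Implicit Types (x y z e : R).
Local Notation leb := (@lebesgue_measure R).

(** The Abel summation weight. Its cosine transform is [poisson e], an approximate identity of mass
    2 pi as [e] tends to 0, so a pair of one-dimensional closed forms carries the whole inversion
    argument. *)
Definition abel e x : R := expR (- (e * `|x|)).
Definition poisson e z : R := 2 * e / (e ^+ 2 + z ^+ 2).

Lemma measurable_abel e : measurable_fun setT (abel e).
Proof.
apply: measurableT_comp => //; apply: measurable_funN.
by apply: measurable_funM => //; exact: measurableT_comp.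
Qed.

Lemma abel_ge0 e x : 0 <= abel e x. Proof. exact: expR_ge0. Qed.

Lemma abel_le1 e x : 0 < e -> abel e x <= 1.
Proof. by move=> e0; rewrite -expR0 ler_expR oppr_le0 mulr_ge0// ltW. Qed.

Lemma abel_even e x : abel e (- x) = abel e x.
Proof. by rewrite /abel normrN. Qed.

Lemma continuous_derive (F f : R -> R) : (forall x, is_derive x 1 F (f x)) -> continuous F.
Proof.
move=> dF x; apply: differentiable_continuous; apply/derivable1_diffP.
by case: (dF x).
Qed.

(** [abel] has a corner at 0, hence no smooth primitive across it: [f] is the smooth expression
    valid on the right half, [F] its primitive, and the left half is obtained by reflection. *)
Lemma Rintegral_symitv_even (F f g : R -> R) (a : R) : 0 <= a ->
  (forall x, is_derive x 1 F (f x)) -> continuous f ->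
  (forall x, g (- x) = g x) -> (forall x, 0 <= x -> g x = f x) ->
  measurable_fun setT g ->
  \int[leb]_(x in `[(- a), a]) g x = 2 * (F a - F 0).
Proof.
move=> a0 dF cf gN gf mg.
have df0 x : 0 <= x <= a -> is_derive x 1 F (f x) by [].
have dfN x : - a <= x <= 0 -> is_derive x 1 (fun y => - F (- y)) (f (- x)).
  move=> _; rewrite -[f (- x)]opprK -(mulrN1 (f (- x))).
  by apply: is_derive_opp; apply: is_derive_comp; exact: is_derive_opp.
have cfN : continuous (fun x => f (- x)).
  by move=> x; apply: continuous_comp; [exact: opp_continuous|exact: cf].
have i1 : \int[leb]_(x in `[0, a]) g x = F a - F 0.
  rewrite -(FTC_Rintegral a0 df0 cf); apply: eq_Rintegral => x.
  by rewrite inE/= in_itv/= => /andP[x0 _]; exact: gf.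
have Na0 : - a <= 0 by rewrite oppr_le0.
have i2 : \int[leb]_(x in `[(- a), 0]) g x = F a - F 0.
  have := FTC_Rintegral Na0 dfN cfN; rewrite oppr0 opprK opprK addrC => <-.
  apply: eq_Rintegral => x.
  by rewrite inE/= in_itv/= => /andP[_ x0]; rewrite -gN; apply: gf; rewrite oppr_ge0.
have intg (b c : R) : leb.-integrable `[b, c] (EFin \o g).
  have cg : continuous (fun x => f `|x|).
    by move=> x; apply: continuous_comp; [exact: norm_continuous|exact: cf].
  rewrite (_ : g = fun x => f `|x|).
    by apply: continuous_compact_integrable; [exact: segment_compact|exact: continuous_subspaceT].
  apply/funext => x; case: (leP 0 x) => x0; first by rewrite ger0_norm// gf.
  by rewrite ltr0_norm// -gN gf// oppr_ge0 ltW.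
have := @Rintegral_itvB R g (BLeft (- a)) (BRight a) 0 (intg _ _).
rewrite !bnd_simp i2 => /(_ Na0 a0) H.
have : \int[leb]_(x in `]0, a]) g x = F a - F 0.
  rewrite Rintegral_itv_obnd_cbnd//; apply: integrableS (intg 0 a) => //.
  exact: subset_itv_oc_cc.
by move: H => <- ; lra.
Qed.

Lemma integrable_abel e : 0 < e -> leb.-integrable setT (EFin \o abel e).
Proof.
move=> e0; apply: (@ge0_integrable_le _ (measurableTypeR R) _ _ _ (2 / e)).
- exact: measurable_abel.
- exact: abel_ge0.
apply: integral_symitv_le; [exact: measurable_abel|exact: abel_ge0|move=> n].
have dF x : is_derive x 1 (fun x => - (e^-1 * expR (- (e * x)))) (expR (- (e * x))).
  have := is_derive_opp (is_derive_constM e^-1 (is_derive_comp (f := expR) (g := fun x => - (e * x)) (is_derive_expR (- (e * x))) (is_derive_opp (is_derive_linear x e)))).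
  by rewrite mulrN mulrN opprK mulrCA mulVf ?mulr1 ?gt_eqF.
have cf : continuous (fun x => expR (- (e * x))).
  move=> x; apply: (@continuous_comp _ _ _ (fun x => - (e * x)) expR); last exact: continuous_expR.
  by apply: continuousN; apply: mulrl_continuous.
have := @Rintegral_symitv_even _ _ (abel e) n%:R (ler0n _ _) dF cf (abel_even e) _ (measurable_abel e).
rewrite /Rintegral => H; rewrite -[leLHS]fineK.
  rewrite H; last by move=> x x0; rewrite /abel ger0_norm.
  rewrite lee_fin mulr0 oppr0 expR0 mulr1 opprK mulrDr ler_wnDl//.
  by rewrite mulrN oppr_le0 mulr_ge0// mulr_ge0 ?expR_ge0// invr_ge0 ltW.
apply: integrable_fin_num => //.
apply: continuous_compact_integrable; first exact: segment_compact.
apply: continuous_subspaceT => x; apply: (@continuous_comp _ _ _ (fun x : R => `|x|) (fun x => expR (- (e * x)))) => //.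
  exact: norm_continuous.
exact: cf.
Qed.

(** The integrand is odd, so reflection shows that the integral equals its opposite. *)
Lemma Rintegral_abel_sin e z : 0 < e -> \int[leb]_x (abel e x * sin (z * x)) = 0.
Proof.
move=> e0; set I := LHS.
have : I = - I; last by lra.
have mI : measurable_fun setT (fun x => sin (z * x)).
  by apply: (measurableT_comp (f := sin)); [exact: continuous_measurable_fun (@continuous_sin R)|exact: mulrl_measurable].
have iI : leb.-integrable setT (EFin \o (fun x => abel e x * sin (z * x))).
  apply: (bounded_integrableM (c := 1)) => //; first exact: integrable_abel.
  by move=> x; exact: sin_max.
rewrite {1}/I -(Rintegral_preserving (mu := leb) (phi := -%R) _ _ iI)//; last first.
  by move=> A mA; exact: lebesgue_measureN.
rewrite -mulN1r -RintegralZl//; apply: eq_Rintegral => x _.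
by rewrite abel_even mulrN sinN mulrN mulN1r.
Qed.

Lemma Rintegral_abel_cos e z : 0 < e -> \int[leb]_x (abel e x * cos (z * x)) = poisson e z.
Proof.
move=> e0; pose D := e ^+ 2 + z ^+ 2.
have D0 : D != 0 by rewrite gt_eqF// ltr_wpDr ?sqr_ge0// exprn_gt0.
have mI : measurable_fun setT (fun x => cos (z * x)).
  by apply: (measurableT_comp (f := cos)); [exact: continuous_measurable_fun (@continuous_cos R)|exact: mulrl_measurable].
have iI : leb.-integrable setT (EFin \o (fun x => abel e x * cos (z * x))).
  apply: (bounded_integrableM (c := 1)) => //; first exact: integrable_abel.
  by move=> x; exact: cos_max.
pose E x := expR (- (e * x)).
(* Primitive of exp(-e x) cos(z x); it tends to 0 at infinity and equals -e / D at 0, whence the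
   value 2 e / D. *)
pose F x := D^-1 * (E x * (z * sin (z * x) - e * cos (z * x))).
have dE x : is_derive x 1 E (E x * - e).
  by apply: is_derive_comp; apply: is_derive_opp; exact: is_derive_linear.
have dcos x : is_derive x 1 (fun x => cos (z * x)) (- sin (z * x) * z).
  by apply: (is_derive_comp (f := cos)); exact: is_derive_linear.
have dsin x : is_derive x 1 (fun x => sin (z * x)) (cos (z * x) * z).
  by apply: (is_derive_comp (f := sin)); exact: is_derive_linear.
have dF x : is_derive x 1 F (E x * cos (z * x)).
  have := is_derive_constM D^-1 (is_derive_mul (dE x)
     (is_derive_sub (is_derive_constM z (dsin x)) (is_derive_constM e (dcos x)))).
  by congr is_derive; move: D0; rewrite /D => D0; field.
have cf : continuous (fun x => E x * cos (z * x)).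
  by apply: continuous_derive => x; exact: (is_derive_mul (dE x) (dcos x)).
have FE (n : nat) : \int[leb]_(x in `[(- n%:R)%R, n%:R]) (abel e x * cos (z * x)) = 2 * (F n%:R - F 0).
  apply: (Rintegral_symitv_even _ dF cf) => //.
  - by move=> x; rewrite abel_even mulrN cosN.
  - by move=> x x0; rewrite /abel /E ger0_norm.
  - by apply: measurable_funM => //; exact: measurable_abel.
have := Rintegral_symitv_cvg iI; under eq_fun do rewrite FE.
move=> /cvg_lim <- //; apply: cvg_lim => //.
have -> : poisson e z = 2 * (0 - F 0).
  by rewrite /F /E !mulr0 sin0 cos0 oppr0 expR0 /poisson -/D; field.
apply: cvgM; first exact: cvg_cst.
apply: cvgB; last exact: cvg_cst.
have qlim : `|D^-1| * (`|z| + e) * expR (- e) ^+ n @[n --> \oo] --> 0.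
  rewrite -[0](mulr0 (`|D^-1| * (`|z| + e))); apply: cvgM; first exact: cvg_cst.
  by apply: cvg_expr; rewrite ger0_norm ?expR_ge0// expR_lt1 oppr_lt0.
apply: norm_cvg0; apply: squeeze_cvgr qlim; last exact: cvg_cst.
apply: nearW => n; rewrite normr_ge0/= /F /E normrM -mulrA ler_wpM2l//.
rewrite normrM -expRM_natl (ger0_norm (expR_ge0 _)) mulrC mulrN [n%:R * _]mulrC ler_wpM2r ?expR_ge0//.
apply: (le_trans (ler_normB _ _)); rewrite !normrM (gtr0_norm e0) lerD//.
  by rewrite ler_piMr ?sin_max.
by rewrite ler_piMr ?cos_max ?ltW.
Qed.

Lemma poisson_ge0 e z : 0 < e -> 0 <= poisson e z.
Proof. by move=> e0; rewrite divr_ge0 ?addr_ge0 ?sqr_ge0// mulr_ge0// ltW. Qed.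

Lemma continuous_poisson e y : 0 < e -> continuous (fun x => poisson e (x - y)).
Proof.
move=> e0 x; apply: cvgM; first exact: cvg_cst.
apply: cvgV; first by rewrite gt_eqF// ltr_wpDr ?sqr_ge0// exprn_gt0.
apply: cvgD; first exact: cvg_cst.
rewrite expr2; under eq_fun do rewrite expr2.
by apply: cvgM; apply: cvgB; [exact: cvg_id|exact: cvg_cst|exact: cvg_id|exact: cvg_cst].
Qed.

Lemma measurable_poisson e y : 0 < e -> measurable_fun setT (fun x => poisson e (x - y)).
Proof. by move=> e0; apply: continuous_measurable_fun; exact: continuous_poisson. Qed.

Lemma poisson_le e z : 0 < e -> poisson e z <= 2 / e.
Proof.
move=> e0; rewrite /poisson ler_pdivrMr ?ltr_wpDr ?sqr_ge0 ?exprn_gt0//.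
have -> : 2 / e * (e ^+ 2 + z ^+ 2) = 2 * e + 2 / e * z ^+ 2 by field; rewrite gt_eqF.
by rewrite lerDl mulr_ge0 ?sqr_ge0// divr_ge0// ltW.
Qed.

Lemma is_derive_poisson e y x : 0 < e ->
  is_derive x 1 (fun x => 2 * atan (e^-1 * (x - y))) (poisson e (x - y)).
Proof.
move=> e0; have d1 : is_derive x 1 (fun x => e^-1 * (x - y)) (e^-1 * (1 - 0)).
  by apply: is_derive_constM; apply: is_derive_sub.
have := is_derive_constM 2 (is_derive_comp (f := atan) (g := fun x => e^-1 * (x - y)) (is_derive1_atan (e^-1 * (x - y))) d1).
congr is_derive; rewrite /poisson; field; rewrite ?gt_eqF//=.
rewrite ltr_wpDr ?sqr_ge0// ?exprn_gt0//.
Qed.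

Lemma Rintegral_poisson e y a b : 0 < e -> a <= b ->
  \int[leb]_(x in `[a, b]) poisson e (x - y) =
  2 * atan (e^-1 * (b - y)) - 2 * atan (e^-1 * (a - y)).
Proof.
move=> e0 ab; apply: (FTC_Rintegral (F := fun x => 2 * atan (e^-1 * (x - y)))) => //.
  by move=> x _; exact: is_derive_poisson.
exact: continuous_poisson.
Qed.

Lemma integrable_poisson_itv e y a b : 0 < e ->
  leb.-integrable `[a, b] (EFin \o (fun x => poisson e (x - y))).
Proof.
move=> e0; apply: continuous_compact_integrable; first exact: segment_compact.
by apply: continuous_subspaceT; exact: continuous_poisson.
Qed.

Lemma integral_poisson_le e y : 0 < e ->
  (\int[leb]_x (poisson e (x - y))%:E <= (2 * pi)%:E)%E.
Proof.
move=> e0; apply: integral_symitv_le.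
- exact: measurable_poisson.
- by move=> x; exact: poisson_ge0.
move=> n; have := Rintegral_poisson y e0 (_ : - n%:R <= n%:R).
rewrite /Rintegral => H; rewrite -[leLHS]fineK; last first.
  by apply: integrable_fin_num => //; exact: integrable_poisson_itv.
rewrite H ?lee_fin; last by rewrite (@le_trans _ _ 0) ?oppr_le0.
have := atan_ltpi2 (e^-1 * (n%:R - y)); have := atan_gtNpi2 (e^-1 * (- n%:R - y)).
by lra.
Qed.

Lemma integrable_poisson e y : 0 < e ->
  leb.-integrable setT (EFin \o (fun x => poisson e (x - y))).
Proof.
move=> e0; apply: (@ge0_integrable_le _ (measurableTypeR R) _ _ _ (2 * pi)).
- exact: measurable_poisson.
- by move=> x; exact: poisson_ge0.
- exact: integral_poisson_le.
Qed.

Lemma Rintegral_poisson_le e y : 0 < e -> \int[leb]_x poisson e (x - y) <= 2 * pi.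
Proof.
move=> e0; rewrite -lee_fin /Rintegral fineK; first exact: integral_poisson_le.
by apply: (integrable_fin_num measurableT (integrable_poisson y e0)).
Qed.

(** The Poisson integral at [y] of the indicator of an interval, in closed form: its bound 2 pi and
    its limit as [e] tends to 0 are read off the arctangent. *)
Definition poisson_box e y a b : R :=
  2 * atan (e^-1 * (b - y)) - 2 * atan (e^-1 * (a - y)).

Lemma poisson_box_le e y a b : `|poisson_box e y a b| <= 2 * pi.
Proof.
have := atan_ltpi2 (e^-1 * (a - y)); have := atan_gtNpi2 (e^-1 * (a - y)).
have := atan_ltpi2 (e^-1 * (b - y)); have := atan_gtNpi2 (e^-1 * (b - y)).
by rewrite /poisson_box ler_norml => *; apply/andP; split; lra.
Qed.

Lemma cvg_atan_pos c : 0 < c -> (atan (n.+1%:R * c) : R) @[n --> \oo] --> pi / 2.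
Proof.
move=> c0; apply: (cvg_comp _ _ _ (@cvgy_atan R)).
apply/cvgryPge => A; near=> n.
rewrite -ler_pdivrMr//; apply: le_trans (ler_norm _) _.
apply/ltW; apply: (lt_trans (archi_boundP (normr_ge0 _))).
by rewrite ltr_nat ltnS; near: n; exact: nbhs_infty_ge.
Unshelve. all: by end_near. Qed.

Lemma cvg_atan_neg c : c < 0 -> (atan (n.+1%:R * c) : R) @[n --> \oo] --> - (pi / 2).
Proof.
move=> c0; rewrite -[c]opprK; under eq_fun do rewrite mulrN atanN.
by apply: cvgN; apply: cvg_atan_pos; rewrite oppr_gt0.
Qed.

(** Each arctangent tends to pi/2 or -pi/2 according to the side on which [y] lies. At an endpoint
    the limit would be pi, half the inner value; endpoints are excluded and form a null set. *)
Lemma cvg_poisson_box y a b : a < b -> y != a -> y != b ->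
  poisson_box (n.+1%:R^-1) y a b @[n --> \oo] --> 2 * pi * \1_[set` `]a, b]] y.
Proof.
move=> ab ya yb; rewrite /poisson_box; under eq_fun do rewrite invrK.
have [yltb|ygeb] := ltP y b.
  have [yla|yga] := ltP y a.
    rewrite indicE memNset ?mulr0; last first.
      by rewrite /= in_itv/= ltNge ltW.
    have -> : 0 = 2 * (pi / 2) - 2 * (pi / 2) :> R by rewrite subrr.
    apply: cvgB; apply: cvgM; try exact: cvg_cst.
      by apply: cvg_atan_pos; rewrite subr_gt0.
    by apply: cvg_atan_pos; rewrite subr_gt0.
  rewrite indicE mem_set ?mulr1; last by rewrite /= in_itv/= lt_neqAle eq_sym ya yga ltW.
  have -> : 2 * pi = 2 * (pi / 2) - 2 * (- (pi / 2)) :> R by field.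
  apply: cvgB; apply: cvgM; try exact: cvg_cst.
    by apply: cvg_atan_pos; rewrite subr_gt0.
  by apply: cvg_atan_neg; rewrite subr_lt0 lt_neqAle eq_sym ya.
rewrite indicE memNset ?mulr0; last first.
  by rewrite /= in_itv/= => /andP[_]; apply/negP; rewrite -ltNge lt_neqAle eq_sym yb.
have -> : 0 = 2 * (- (pi / 2)) - 2 * (- (pi / 2)) :> R by rewrite subrr.
apply: cvgB; apply: cvgM; try exact: cvg_cst.
  by apply: cvg_atan_neg; rewrite subr_lt0 lt_neqAle eq_sym yb.
by apply: cvg_atan_neg; rewrite subr_lt0 (lt_le_trans ab).
Qed.

End Poisson.

(** * The Hartley transform *)

Section HartleyL1.
Context {R : realType}.
Implicit Types (e : R) (x y xi : R * R) (f g : R * R -> R).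
Local Notation leb := (@lebesgue_measure R).
Local Notation E2 := (measurableTypeR R * measurableTypeR R)%type.
Local Notation mu := (@leb2 R).
Local Notation L1 f := (mu.-integrable setT (EFin \o f)).

Definition cas (t : R) : R := cos t + sin t.

Lemma cas_le2 t : `|cas t| <= 2.
Proof. by apply: (le_trans (ler_normD _ _)); rewrite -(addrK 1 2) addrK lerD ?cos_max ?sin_max. Qed.

(** The origin of inversion: against an even weight the sine term integrates to 0, and what remains
    depends only on [a - b]. *)
Lemma casM a b : cas a * cas b = cos (a - b) + sin (a + b).
Proof. by rewrite /cas cosB sinD; ring. Qed.

Lemma continuous_cas : continuous cas.
Proof. by move=> t; apply: cvgD; [exact: continuous_cos|exact: continuous_sin]. Qed.

Lemma measurable_cas : measurable_fun setT cas.
Proof. by apply: continuous_measurable_fun; exact: continuous_cas. Qed.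

Lemma dotC x y : dot x y = dot y x.
Proof. by rewrite /dot mulrC [x.2 * _]mulrC. Qed.

Lemma measurable_dot : measurable_fun [set: E2 * E2] (fun z : E2 * E2 => dot z.1 z.2).
Proof.
apply: measurable_funD; apply: measurable_funM.
- exact: (measurableT_comp measurable_fst measurable_fst).
- exact: (measurableT_comp measurable_fst measurable_snd).
- exact: (measurableT_comp measurable_snd measurable_fst).
- exact: (measurableT_comp measurable_snd measurable_snd).
Qed.

Lemma measurable_dotr xi : measurable_fun [set: E2] (fun x : E2 => dot x xi).
Proof. exact: (measurableT_comp measurable_dot (pair2_measurable (xi : E2))). Qed.

Lemma measurable_cas_dot : measurable_fun [set: E2 * E2] (fun z : E2 * E2 => cas (dot z.1 z.2)).
Proof. exact: (measurableT_comp measurable_cas measurable_dot). Qed.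

Lemma measurable_cas_dotr xi : measurable_fun [set: E2] (fun x : E2 => cas (dot x xi)).
Proof. exact: (measurableT_comp measurable_cas (measurable_dotr xi)). Qed.

Definition hartley1 f xi : R := \int[mu]_x (f x * cas (dot x xi)).

Lemma L1_measurable f : L1 f -> measurable_fun [set: E2] f.
Proof. by move=> /measurable_int /measurable_EFinP. Qed.

Lemma integrable_hartley1 f xi : L1 f -> L1 (fun x => f x * cas (dot x xi)).
Proof.
move=> lf; apply: (bounded_integrableM (c := 2)) => //.
  exact: measurable_cas_dotr.
by move=> x; exact: cas_le2.
Qed.

Lemma measurable_hartley1 f : L1 f -> measurable_fun [set: E2] (hartley1 f).
Proof.
move=> lf; rewrite (_ : hartley1 f = fun xi => \int[mu]_x (f x * cas (dot xi x))).
  exact: (@integrable_Fubini_kernel _ _ E2 E2 R mu f (fun z => cas (dot z.1 z.2)) 2 lf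
    measurable_cas_dot (fun z => cas_le2 _)).
by apply/funext => xi; apply: eq_Rintegral => x _; rewrite dotC.
Qed.

Lemma hartley1_le f xi : L1 f -> `|hartley1 f xi| <= \int[mu]_x (2 * `|f x|).
Proof.
move=> lf; have lh := integrable_hartley1 xi lf.
apply: (le_trans (le_normr_Rintegral measurableT lh)).
apply: le_Rintegral => //.
- exact: (integrable_norm lh).
- exact: (integrableZl measurableT 2 (integrable_norm lf)).
- by move=> x _; rewrite normrM mulrC ler_wpM2r// cas_le2.
Qed.

Lemma hartley1_sym f g : L1 f -> L1 g ->
  \int[mu]_x (f x * hartley1 g x) = \int[mu]_x (hartley1 f x * g x).
Proof.
move=> lf lg.
transitivity (\int[mu]_x (f x * \int[mu]_y (g y * cas (dot x y)))).
  apply: eq_Rintegral => x _; congr (_ * _); apply: eq_Rintegral => y _.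
  by rewrite dotC.
rewrite (@Fubini_adjoint _ _ E2 E2 R mu mu f g (fun z => cas (dot z.1 z.2)) 2 lf lg
    measurable_cas_dot (fun z => cas_le2 _)).
by apply: eq_Rintegral => y _; rewrite mulrC.
Qed.

Definition abel2 e xi : R := abel e xi.1 * abel e xi.2.
Definition poisson2 e x y : R := poisson e (x.1 - y.1) * poisson e (x.2 - y.2).

Lemma measurable_abel2 e : measurable_fun [set: E2] (abel2 e).
Proof.
apply: measurable_funM; apply: measurableT_comp; try exact: measurable_abel.
  exact: measurable_fst.
exact: measurable_snd.
Qed.

Lemma abel2_ge0 e xi : 0 <= abel2 e xi.
Proof. by rewrite mulr_ge0 ?abel_ge0. Qed.

Lemma abel2_le1 e xi : 0 < e -> abel2 e xi <= 1.
Proof. by move=> e0; rewrite mulr_ile1 ?abel_ge0 ?abel_le1. Qed.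

Lemma abel2_norm_le1 e xi : 0 < e -> `|abel2 e xi| <= 1.
Proof. by move=> e0; rewrite ger0_norm ?abel2_ge0 ?abel2_le1. Qed.

Lemma integrable_prod2 (a b : R -> R) : leb.-integrable setT (EFin \o a) ->
  leb.-integrable setT (EFin \o b) -> L1 (fun x => a x.1 * b x.2).
Proof.
move=> ia ib.
have := @integrable_prod_bounded _ _ (measurableTypeR R) (measurableTypeR R) R leb leb a b (fun=> 1) 1 ia ib
   (measurable_cst _) _.
rewrite (_ : (fun z : R * R => (a z.1 * b z.2 * 1)%:E) = EFin \o (fun x : R * R => a x.1 * b x.2)).
  by apply => z; rewrite normr1.
by apply/funext => z; rewrite /= mulr1.
Qed.

Lemma Rintegral_prod2 (a b : R -> R) : leb.-integrable setT (EFin \o a) ->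
  leb.-integrable setT (EFin \o b) ->
  \int[mu]_x (a x.1 * b x.2) = (\int[leb]_t a t) * (\int[leb]_t b t).
Proof.
by move=> ia ib; exact: (@Rintegral_prodM _ _ (measurableTypeR R) (measurableTypeR R) R leb leb a b ia ib).
Qed.

Lemma integrable_abel2 e : 0 < e -> L1 (abel2 e).
Proof. by move=> e0; apply: integrable_prod2; exact: integrable_abel. Qed.

Lemma integrable_abel_cos e z : 0 < e ->
  leb.-integrable setT (EFin \o (fun t => abel e t * cos (z * t))).
Proof.
move=> e0; apply: (bounded_integrableM (c := 1)) => //; first exact: integrable_abel.
  apply: (measurableT_comp (f := cos)); last exact: mulrl_measurable.
  exact: continuous_measurable_fun (@continuous_cos R).
by move=> x; exact: cos_max.
Qed.

Lemma integrable_abel_sin e z : 0 < e ->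
  leb.-integrable setT (EFin \o (fun t => abel e t * sin (z * t))).
Proof.
move=> e0; apply: (bounded_integrableM (c := 1)) => //; first exact: integrable_abel.
  apply: (measurableT_comp (f := sin)); last exact: mulrl_measurable.
  exact: continuous_measurable_fun (@continuous_sin R).
by move=> x; exact: sin_max.
Qed.

(** After [casM] and the addition formulas each term separates in the two frequency coordinates;
    every term with a sine factor vanishes by parity, and the product of cosines gives two Poisson
    kernels. *)
Lemma Rintegral_abel2_cas e x y : 0 < e ->
  \int[mu]_xi (abel2 e xi * (cas (dot x xi) * cas (dot y xi))) = poisson2 e x y.
Proof.
move=> e0.
pose c z t := abel e t * cos (z * t); pose s z t := abel e t * sin (z * t).
have ic z := integrable_abel_cos z e0; have is_ z := integrable_abel_sin z e0.
pose z1 := x.1 - y.1; pose z2 := x.2 - y.2; pose w1 := x.1 + y.1; pose w2 := x.2 + y.2.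
transitivity (\int[mu]_xi ((c z1 xi.1 * c z2 xi.2 - s z1 xi.1 * s z2 xi.2)
   + (s w1 xi.1 * c w2 xi.2 + c w1 xi.1 * s w2 xi.2))).
  apply: eq_Rintegral => xi _; rewrite casM.
  rewrite (_ : dot x xi - dot y xi = z1 * xi.1 + z2 * xi.2); last first.
    by rewrite /dot /z1 /z2; ring.
  rewrite (_ : dot x xi + dot y xi = w1 * xi.1 + w2 * xi.2); last first.
    by rewrite /dot /w1 /w2; ring.
  by rewrite cosD sinD /abel2 /c /s; ring.
have icc a b := integrable_prod2 (ic a) (ic b).
have iss a b := integrable_prod2 (is_ a) (is_ b).
have isc a b := integrable_prod2 (is_ a) (ic b).
have ics a b := integrable_prod2 (ic a) (is_ b).
have iB := integrableB measurableT (icc z1 z2) (iss z1 z2).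
have iD := integrableD measurableT (isc w1 w2) (ics w1 w2).
have eB := RintegralB measurableT (icc z1 z2) (iss z1 z2).
have eD := RintegralD measurableT (isc w1 w2) (ics w1 w2).
rewrite [LHS](RintegralD measurableT iB iD) [X in X + _]eB [X in _ + X]eD.
rewrite (Rintegral_prod2 (ic z1) (ic z2)) (Rintegral_prod2 (is_ z1) (is_ z2)).
rewrite (Rintegral_prod2 (is_ w1) (ic w2)) (Rintegral_prod2 (ic w1) (is_ w2)).
rewrite !Rintegral_abel_cos// !Rintegral_abel_sin//.
by rewrite !(mul0r, mulr0) subr0 !addr0.
Qed.

Lemma integrable_abel2_hartley1 e g : 0 < e -> L1 g -> L1 (fun xi => abel2 e xi * hartley1 g xi).
Proof.
move=> e0 lg; apply: (bounded_integrableM (c := \int[mu]_x (2 * `|g x|))).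
- exact: integrable_abel2.
- exact: measurable_hartley1.
- by move=> xi; exact: hartley1_le.
Qed.

(** A regularised Parseval identity. The weight makes all products integrable, so the symmetry of
    the transform can be used twice to move both transforms onto [abel2]. *)
Lemma abel2_hartley1 e f g : 0 < e -> L1 f -> L1 g ->
  \int[mu]_xi (abel2 e xi * (hartley1 f xi * hartley1 g xi)) =
  \int[mu]_x (f x * \int[mu]_y (g y * poisson2 e x y)).
Proof.
move=> e0 lf lg.
pose G xi := abel2 e xi * hartley1 g xi.
have lG : L1 G by exact: integrable_abel2_hartley1.
transitivity (\int[mu]_xi (hartley1 f xi * G xi)).
  by apply: eq_Rintegral => xi _; rewrite /G mulrCA.
rewrite -(hartley1_sym lf lG); apply: eq_Rintegral => x _; congr (_ * _).
pose K xi := abel2 e xi * cas (dot x xi).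
have lK : L1 K.
  rewrite /K (_ : (fun _ => _) = fun xi => abel2 e xi * cas (dot xi x)).
    exact/integrable_hartley1/integrable_abel2.
  by apply/funext => xi; rewrite dotC.
transitivity (\int[mu]_xi (hartley1 g xi * K xi)).
  by apply: eq_Rintegral => xi _; rewrite /G /K dotC mulrAC mulrC.
rewrite -(hartley1_sym lg lK); apply: eq_Rintegral => y _; congr (_ * _).
rewrite -Rintegral_abel2_cas//; apply: eq_Rintegral => xi _.
by rewrite /K -mulrA (dotC xi y).
Qed.


Lemma poisson2_ge0 e x y : 0 < e -> 0 <= poisson2 e x y.
Proof. by move=> e0; rewrite mulr_ge0// poisson_ge0. Qed.

Lemma poisson2C e x y : poisson2 e x y = poisson2 e y x.
Proof.
by rewrite /poisson2 /poisson -(sqrrN (x.1 - y.1)) -(sqrrN (x.2 - y.2)) !opprB.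
Qed.

Lemma poisson2_norm_le e x y : 0 < e -> `|poisson2 e x y| <= (2 / e) ^+ 2.
Proof.
move=> e0; rewrite ger0_norm ?poisson2_ge0// expr2.
by rewrite ler_pM ?poisson_ge0 ?poisson_le.
Qed.

Lemma measurable_poisson2 e : 0 < e ->
  measurable_fun [set: E2 * E2] (fun z : E2 * E2 => poisson2 e z.1 z.2).
Proof.
move=> e0; have mp : measurable_fun setT (poisson e).
  have := measurable_poisson 0 e0; rewrite (_ : (fun t : R => poisson e (t - 0)) = poisson e)//.
  by apply/funext => t; rewrite subr0.
apply: measurable_funM; apply: (measurableT_comp mp); apply: measurable_funB.
- exact: (measurableT_comp measurable_fst measurable_fst).
- exact: (measurableT_comp measurable_fst measurable_snd).
- exact: (measurableT_comp measurable_snd measurable_fst).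
- exact: (measurableT_comp measurable_snd measurable_snd).
Qed.

Lemma integrable_poisson2 e y : 0 < e -> L1 (fun x => poisson2 e x y).
Proof.
move=> e0; exact: (integrable_prod2 (integrable_poisson y.1 e0) (integrable_poisson y.2 e0)).
Qed.

Lemma Rintegral_poisson2_le e y : 0 < e -> \int[mu]_x poisson2 e x y <= (2 * pi) ^+ 2.
Proof.
move=> e0.
rewrite [leLHS](Rintegral_prod2 (integrable_poisson y.1 e0) (integrable_poisson y.2 e0)).
rewrite expr2 ler_pM ?Rintegral_poisson_le//; apply: Rintegral_ge0 => t _; exact: poisson_ge0.
Qed.

Lemma integral_poisson2_le e y : 0 < e ->
  (\int[mu]_x (poisson2 e x y)%:E <= ((2 * pi) ^+ 2)%:E)%E.
Proof.
move=> e0; rewrite -[leLHS]fineK; first by rewrite lee_fin; exact: Rintegral_poisson2_le.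
exact: (integrable_fin_num measurableT (integrable_poisson2 y e0)).
Qed.

(** Tonelli, then the mass bound of the kernel in its first variable. *)
Lemma poisson2_mass e (q : R * R -> R) : 0 < e -> L1 q -> (forall y, 0 <= q y) ->
  L1 (fun x => \int[mu]_y (q y * poisson2 e x y)) /\
  \int[mu]_x \int[mu]_y (q y * poisson2 e x y) <= (2 * pi) ^+ 2 * \int[mu]_y q y.
Proof.
move=> e0 lq q0; have mq := L1_measurable lq.
have iq x : L1 (fun y => q y * poisson2 e x y).
  apply: (bounded_integrableM (c := (2 / e) ^+ 2)) => //.
    exact: (measurableT_comp (measurable_poisson2 e0) (pair1_measurable (x : E2))).
  by move=> y; exact: poisson2_norm_le.
have m2 : measurable_fun [set: E2 * E2] (fun z : E2 * E2 => (q z.2 * poisson2 e z.1 z.2)%:E).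
  apply/measurable_EFinP; apply: measurable_funM; last exact: measurable_poisson2.
  exact: (measurableT_comp mq measurable_snd).
have pos x y : 0 <= q y * poisson2 e x y by rewrite mulr_ge0// poisson2_ge0.
have mI : measurable_fun [set: E2] (fun x => \int[mu]_y (q y * poisson2 e x y)).
  exact: (@integrable_Fubini_kernel _ _ E2 E2 R mu q (fun z => poisson2 e z.1 z.2) _ lq
    (measurable_poisson2 e0) (fun z => poisson2_norm_le z.1 z.2 e0)).
have I0 x : 0 <= \int[mu]_y (q y * poisson2 e x y) by apply: Rintegral_ge0.
have bound : (\int[mu]_x (\int[mu]_y (q y * poisson2 e x y))%:E <=
    ((2 * pi) ^+ 2 * \int[mu]_y q y)%:E)%E.
  have -> : (\int[mu]_x (\int[mu]_y (q y * poisson2 e x y))%:E =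
      \int[mu]_x \int[mu]_y (q y * poisson2 e x y)%:E)%E.
    apply: eq_integral; by move=> x _; rewrite /Rintegral fineK//; exact: (integrable_fin_num measurableT (iq x)).
  have := @fubini_tonelli _ _ E2 E2 R mu mu (fun z => (q z.2 * poisson2 e z.1 z.2)%:E) m2 _.
  move=> ->; last by move=> z; rewrite lee_fin.
  apply: (@le_trans _ _ (\int[mu]_y (((2 * pi) ^+ 2)%:E * (q y)%:E))%E).
    apply: ge0_le_integral => //.
    - by move=> y _; apply: integral_ge0 => x _; rewrite lee_fin.
    - apply: (@measurable_fun_fubini_tonelli_G _ _ E2 E2 R mu (fun z : E2 * E2 => (q z.2 * poisson2 e z.1 z.2)%:E)) => //.
      by move=> z; rewrite lee_fin.
    - by apply/measurable_EFinP; exact: measurable_funM.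
    - move=> y _; rewrite /fubini_G /=; under eq_integral do rewrite EFinM.
      rewrite ge0_integralZl//; last 3 first.
      + by apply/measurable_EFinP; exact: (L1_measurable (integrable_poisson2 y e0)).
      + by move=> x _; rewrite lee_fin poisson2_ge0.
      + by rewrite lee_fin.
      by rewrite muleC lee_wpmul2r ?lee_fin// integral_poisson2_le.
  rewrite integralZl// /Rintegral -[X in (_ * X <= _)%E]fineK//.
  exact: (integrable_fin_num measurableT lq).
have lI := ge0_integrable_le mI I0 bound; split => //.
rewrite -lee_fin [X in (X%:E <= _)%E]/Rintegral fineK//.
exact: (integrable_fin_num measurableT lI).
Qed.

(* With p the Poisson kernel, the left-hand side is the integral of
   f(x) f(y) p(x,y), and 2 f(x) f(y) <= f(x)^2 + f(y)^2. *)
Lemma abel2_hartley1_sqr_le e f : 0 < e -> L1 f -> f \in Lfun mu 2%:E ->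
  \int[mu]_xi (abel2 e xi * (hartley1 f xi * hartley1 f xi)) <= (2 * pi) ^+ 2 * ip mu f f.
Proof.
move=> e0 lf l2f; rewrite abel2_hartley1//.
pose q y := f y ^+ 2; have lq : L1 q by exact: Ltwo_sqr.
have q0 y : 0 <= q y by exact: sqr_ge0.
have [lQ Qle] := poisson2_mass e0 lq q0.
have mp x : measurable_fun [set: E2] (fun y : E2 => poisson2 e x y).
  exact: (measurableT_comp (measurable_poisson2 e0) (pair1_measurable (x : E2))).
have bp x y : `|poisson2 e x y| <= (2 / e) ^+ 2 by exact: poisson2_norm_le.
have ifp x : L1 (fun y => f y * poisson2 e x y) by exact: (bounded_integrableM lf (mp x) (bp x)).
have iqp x : L1 (fun y => q y * poisson2 e x y) by exact: (bounded_integrableM lq (mp x) (bp x)).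
have ip' x : L1 (poisson2 e x).
  by rewrite (_ : poisson2 e x = fun y => poisson2 e y x); [exact: integrable_poisson2|apply/funext => y; exact: poisson2C].
have key x : f x * (\int[mu]_y (f y * poisson2 e x y)) <=
    2^-1 * ((2 * pi) ^+ 2 * q x + \int[mu]_y (q y * poisson2 e x y)).
  have P1 : \int[mu]_y poisson2 e x y <= (2 * pi) ^+ 2.
    by under eq_Rintegral do rewrite poisson2C; exact: Rintegral_poisson2_le.
  have i1 : L1 (fun y => q x * poisson2 e x y) by exact: (integrableZl measurableT (q x) (ip' x)).
  have i2 : L1 (fun y => q x * poisson2 e x y + q y * poisson2 e x y).
    exact: (integrableD measurableT i1 (iqp x)).
  rewrite -(RintegralZl (f x) measurableT (ifp x)).
  apply: (@le_trans _ _ (\int[mu]_y (2^-1 * (q x * poisson2 e x y + q y * poisson2 e x y)))).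
    apply: le_Rintegral => //.
    - exact: (integrableZl measurableT (f x) (ifp x)).
    - exact: (integrableZl measurableT 2^-1 i2).
    - move=> y _; have := poisson2_ge0 x y e0; move: (poisson2 e x y) => p p0.
      have := mulr_ge0 p0 (sqr_ge0 (f x - f y)); rewrite /q.
      by move: (f x) (f y) => a b; nra.
  rewrite (RintegralZl _ measurableT i2) ler_pM2l// (RintegralD measurableT i1 (iqp x)) lerD2r.
  by rewrite (RintegralZl _ measurableT (ip' x)) mulrC ler_wpM2r.
have mfp : measurable_fun [set: E2] (fun x => \int[mu]_y (f y * poisson2 e x y)).
  exact: (@integrable_Fubini_kernel _ _ E2 E2 R mu f (fun z => poisson2 e z.1 z.2) _ lf
    (measurable_poisson2 e0) (fun z => poisson2_norm_le z.1 z.2 e0)).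
have lq4 : L1 (fun x => (2 * pi) ^+ 2 * q x) by exact: (integrableZl measurableT _ lq).
have lqQ : L1 (fun x => (2 * pi) ^+ 2 * q x + \int[mu]_y (q y * poisson2 e x y)).
  exact: (integrableD measurableT lq4 lQ).
apply: (@le_trans _ _ (\int[mu]_x (2^-1 * ((2 * pi) ^+ 2 * q x + \int[mu]_y (q y * poisson2 e x y))))).
  apply: le_Rintegral => //.
    apply: (bounded_integrableM (c := (2 / e) ^+ 2 * \int[mu]_y `|f y|) lf mfp) => x.
    apply: (le_trans (le_normr_Rintegral measurableT (ifp x))).
    rewrite -(RintegralZl _ measurableT (integrable_norm lf)).
    apply: le_Rintegral => //.
    - exact: (integrable_norm (ifp x)).
    - exact: (integrableZl measurableT _ (integrable_norm lf)).
    - by move=> y _; rewrite normrM mulrC ler_wpM2r.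
  exact: (integrableZl measurableT _ lqQ).
rewrite (RintegralZl _ measurableT lqQ) (RintegralD measurableT lq4 lQ) (RintegralZl _ measurableT lq).
have -> : ip mu f f = \int[mu]_x q x by apply: eq_Rintegral => x _; rewrite /q expr2.
by move: Qle; move: (\int[mu]_x q x) (Rintegral _ _ _) => a b; lra.
Qed.

Lemma cvg_abel2 xi : (abel2 (n.+1%:R^-1 / 2) xi : R) @[n --> \oo] --> (1 : R).
Proof.
have h t : (abel (n.+1%:R^-1 / 2) t : R) @[n --> \oo] --> (1 : R).
  have : (expR (- (n.+1%:R^-1 / 2 * `|t|)) : R) @[n --> \oo] --> (expR (- (0 / 2 * `|t|)) : R).
    apply: (@cvg_comp _ _ _ _ expR); last exact: continuous_expR.
    apply: cvgN; apply: cvgM; last exact: cvg_cst.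
    by apply: cvgM; [exact: cvg_harmonic|exact: cvg_cst].
  by rewrite !mul0r oppr0 expR0.
by rewrite -[X in _ --> X]mulr1; apply: cvgM; exact: h.
Qed.

Lemma abel2_half e xi : abel2 (e / 2) xi ^+ 2 = abel2 e xi.
Proof.
rewrite /abel2 exprMn /abel -!expRM_natl; by congr (expR _ * expR _); field.
Qed.

(** The weighted bound is uniform in [e], and Fatou removes the weight. Only the inequality is
    obtained here; the isometry follows later from inversion. *)
Lemma hartley1_L2 f : L1 f -> f \in Lfun mu 2%:E ->
  hartley1 f \in Lfun mu 2%:E /\ l2 mu (hartley1 f) <= 2 * pi * l2 mu f.
Proof.
move=> lf l2f.
have pi2 : 0 <= 2 * pi :> R by rewrite mulr_ge0// pi_ge0.
have c0 : 0 <= 2 * pi * l2 mu f by rewrite mulr_ge0 ?l2_ge0.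
(* The parameter is halved because squaring [w n] doubles it, by [abel2_half]. *)
pose w n xi := abel2 (n.+1%:R^-1 / 2) xi * hartley1 f xi.
have e0 n : 0 < n.+1%:R^-1 / 2 :> R by rewrite divr_gt0.
have mw n : measurable_fun [set: E2] (w n).
  by apply: measurable_funM; [exact: measurable_abel2|exact: measurable_hartley1].
have wP n : w n \in Lfun mu 2%:E /\ l2 mu (w n) <= 2 * pi * l2 mu f.
  apply: l2_le_of_integral => //.
  have iw : L1 (fun xi => w n xi ^+ 2).
    rewrite (_ : (fun xi => _) = fun xi => abel2 n.+1%:R^-1 xi * hartley1 f xi * hartley1 f xi).
      apply: (bounded_integrableM (integrable_abel2_hartley1 _ lf) (measurable_hartley1 lf)) => //.
      by move=> xi; exact: hartley1_le.
    by apply/funext => xi; rewrite /w exprMn abel2_half expr2 mulrA.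
  rewrite -[leLHS]fineK; last exact: (integrable_fin_num measurableT iw).
  rewrite lee_fin exprMn l2_sqr; apply: le_trans (abel2_hartley1_sqr_le (e := n.+1%:R^-1) _ lf l2f) => //.
  rewrite le_eqVlt; apply/orP; left; apply/eqP; apply: eq_Rintegral => xi _.
  by rewrite /w exprMn abel2_half expr2.
apply: (@Fatou_l2 _ E2 _ _ w) => //.
- by move=> n; case: (wP n).
- by move=> n; case: (wP n).
- move=> xi; rewrite -[hartley1 f xi]mul1r; apply: cvgM; last exact: cvg_cst.
  exact: cvg_abel2.
Qed.

End HartleyL1.

Section AlmostEverywhere.
Context d (T : measurableType d) (R : realType) (mu : {measure set T -> \bar R}).
Implicit Types P Q : T -> Prop.

Lemma ae_impl P Q : {ae mu, forall x, P x} -> (forall x, P x -> Q x) ->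
  {ae mu, forall x, Q x}.
Proof. by move=> aP PQ; apply: filterS aP. Qed.

Lemma ae_impl2 P1 P2 Q : {ae mu, forall x, P1 x} -> {ae mu, forall x, P2 x} ->
  (forall x, P1 x -> P2 x -> Q x) -> {ae mu, forall x, Q x}.
Proof. by move=> aP1 aP2 PQ; apply: filterS2 aP1 aP2. Qed.

Lemma ae_impl3 P1 P2 P3 Q : {ae mu, forall x, P1 x} -> {ae mu, forall x, P2 x} ->
  {ae mu, forall x, P3 x} -> (forall x, P1 x -> P2 x -> P3 x -> Q x) ->
  {ae mu, forall x, Q x}.
Proof. by move=> aP1 aP2 aP3 PQ; apply: filterS3 aP1 aP2 aP3. Qed.

End AlmostEverywhere.

(** * Integrable functions determined by a generating class of sets *)

Section Vanishing.
Context d1 d2 (X : measurableType d1) (T : measurableType d2) (R : realType)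
  (mu : {measure set X -> \bar R}).

Lemma indic_le1 (U : Type) (A : set U) (x : U) : `|\1_A x : R| <= 1.
Proof. by rewrite indicE; case: (_ \in _); rewrite ?normr1 ?normr0. Qed.

(** Dynkin's theorem: the sets on which the weighted integral vanishes form a lambda-system
    containing the pi-system [G]. The sets [g n] give the vanishing over the whole space, which may
    not belong to [G]. The map [phi] lets the same statement treat one coordinate at a time. *)
Lemma Rintegral_indic_vanish (w : X -> R) (phi : X -> T) (G : set (set T)) (g : nat -> set T) :
  mu.-integrable setT (EFin \o w) -> measurable_fun setT phi ->
  @measurable _ T = <<s G >> -> setI_closed G ->
  (forall n, G (g n)) -> (forall x, \forall n \near \oo, g n x) ->
  (forall A, G A -> \int[mu]_x (w x * \1_A (phi x)) = 0) ->
  forall A, measurable A -> \int[mu]_x (w x * \1_A (phi x)) = 0.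
Proof.
move=> iw mphi GE GI Gg gcov G0.
have mw : measurable_fun setT w by apply/measurable_EFinP; exact: measurable_int iw.
have mind A : measurable A -> measurable_fun setT (fun x => \1_A (phi x) : R).
  move=> mA; have h : measurable_fun setT (\1_A : T -> R) by exact: measurable_indic.
  exact: (measurableT_comp h mphi).
have iwA A : measurable A -> mu.-integrable setT (EFin \o (fun x => w x * \1_A (phi x))).
  move=> mA; apply: (bounded_integrableM (c := 1) iw (mind _ mA)) => x.
  exact: indic_le1.
have mG A : G A -> measurable A by move=> GA; rewrite GE; exact: sub_sigma_algebra.
have wT : \int[mu]_x w x = 0.
  have cv : \int[mu]_x (w x * \1_(g n) (phi x)) @[n --> \oo] --> \int[mu]_x w x.
    apply: (@Rintegral_dominated _ X R mu _ _ (fun x => `|w x|)) => //.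
    - by move=> n; apply: measurable_funM => //; apply: mind; exact: mG.
    - apply: aeW => x; apply: cvg_near_cst; move: (gcov (phi x)); apply: filterS => n gx.
      by rewrite indicE mem_set// mulr1.
    - exact: integrable_norm.
    - by move=> n x; rewrite normrM ler_piMr// indic_le1.
  have -> : 0 = \int[mu]_x w x; last by [].
  rewrite -(cvg_lim _ cv)//; apply/esym/cvg_lim => //.
  by under eq_fun do rewrite G0//; exact: cvg_cst.
pose D := [set A : set T | measurable A /\ \int[mu]_x (w x * \1_A (phi x)) = 0].
suff : <<s G >> `<=` D by move=> sub A mA; apply: (proj2 (sub A _)); rewrite -GE.
rewrite -setI_closed_g_dynkin_g_sigma_algebra//; apply: smallest_sub; last first.
  by move=> A GA; split; [exact: mG|exact: G0].
split.
- split => //; rewrite -[RHS]wT; apply: eq_Rintegral => x _.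
  by rewrite indicT mulr1.
- move=> A [mA A0]; split; first exact: measurableC.
  transitivity (\int[mu]_x (w x - w x * \1_A (phi x))).
    apply: eq_Rintegral => x _; rewrite !indicE in_setC.
    by case: (_ \in _); rewrite /= ?mulr0 ?mulr1 ?subr0 ?subrr.
  by rewrite RintegralB// ?A0 ?wT ?subr0//; exact: iwA.
- move=> F tF DF; have mF n : measurable (F n) by have [] := DF n.
  split; first exact: bigcupT_measurable.
  (* Disjointness makes the indicators of partial unions additive, so each [S n] integrates to 0;
     dominated convergence passes to the full union. *)
  pose S n x := w x * \1_(\big[setU/set0]_(i < n) F i) (phi x).
  have mU n : measurable (\big[setU/set0]_(i < n) F i) by exact: bigsetU_measurable.
  have S0 n : \int[mu]_x S n x = 0.
    elim: n => [|n IH].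
      rewrite /S; under eq_Rintegral do rewrite big_ord0 indicE in_set0 mulr0.
      by rewrite Rintegral_cst// mul0r.
    have -> : \int[mu]_x S n.+1 x = \int[mu]_x (S n x + w x * \1_(F n) (phi x)).
      apply: eq_Rintegral => x _; rewrite /S big_ord_recr/= -mulrDr; congr (_ * _).
      rewrite !indicE in_setU; have [xn|xn] := boolP (phi x \in F n); last first.
        by rewrite orbF addr0.
      rewrite orbT; suff -> : (phi x \in \big[setU/set0]_(i < n) F i) = false by rewrite add0r.
      apply/negbTE/negP; rewrite inE -bigcup_mkord => -[k /= kn Fk].
      have kNn : k != n by rewrite ltn_eqF.
      have /trivIsetP /(_ k n I I kNn) := tF.
      by apply/eqP/set0P; exists (phi x); split => //; rewrite inE in xn.
    by rewrite RintegralD// ?IH ?(proj2 (DF n)) ?addr0//; exact: iwA.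
  have cv : \int[mu]_x S n x @[n --> \oo] --> \int[mu]_x (w x * \1_(\bigcup_n F n) (phi x)).
    apply: (@Rintegral_dominated _ X R mu _ _ (fun x => `|w x|)) => //.
    - by move=> n; apply: measurable_funM => //; exact: mind.
    - by apply: measurable_funM => //; apply: mind; exact: bigcupT_measurable.
    - apply: aeW => x; apply: cvg_near_cst.
      have [[k _ Fk]|nF] := pselect ((\bigcup_n F n) (phi x)).
        near=> n; rewrite /S !indicE !mem_set//; first by exists k.
        rewrite -bigcup_mkord; exists k => //=; near: n; exact: nbhs_infty_gt.
      near=> n; rewrite /S !indicE !memNset// -bigcup_mkord => -[k _ Fk].
      by apply: nF; exists k.
    - exact: integrable_norm.
    - by move=> n x; rewrite normrM ler_piMr// indic_le1.
  have -> : 0 = \int[mu]_x (w x * \1_(\bigcup_n F n) (phi x)); last by [].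
  rewrite -(cvg_lim _ cv)//; apply/esym/cvg_lim => //.
  by under eq_fun do rewrite S0; exact: cvg_cst.
Unshelve. all: by end_near. Qed.

Lemma ae0_of_indic (w : X -> R) : mu.-integrable setT (EFin \o w) ->
  (forall A, measurable A -> \int[mu]_x (w x * \1_A x) = 0) ->
  {ae mu, forall x, w x = 0}.
Proof.
move=> iw w0.
have := @integral_ae_eq _ X R mu setT measurableT (cst 0%E) (EFin \o w) iw (measurable_cst _) _.
move=> H; have {}H : ae_eq mu setT (EFin \o w) (cst 0%E).
  apply: H => A _ mA; rewrite integral0 integral_mkcond.
  have iwA : mu.-integrable setT (EFin \o (fun x => w x * \1_A x)).
    apply: (bounded_integrableM (c := 1)) => // x.
    exact: indic_le1.
  transitivity (\int[mu]_x (w x * \1_A x)%:E)%E.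
    apply: eq_integral => x _; rewrite patchE indicE.
    by case: (_ \in _); rewrite /= ?mulr1 ?mulr0.
  rewrite -[LHS]fineK; last exact: (integrable_fin_num measurableT iwA).
  by congr EFin; exact: w0.
by apply: filterS H => x /(_ I)[].
Qed.

End Vanishing.

(** * Boxes as a separating family, and the transform paired with a box *)

Section Boxes.
Context {R : realType}.
Implicit Types (e a b c d : R) (x y xi : R * R) (f g : R * R -> R).
Local Notation leb := (@lebesgue_measure R).
Local Notation E2 := (measurableTypeR R * measurableTypeR R)%type.
Local Notation mu := (@leb2 R).
Local Notation L1 f := (mu.-integrable setT (EFin \o f)).
Local Notation Ltwo := (Lfun mu 2%:E).

(** Half-open sides, because such intervals generate the measurable sets of the line and are stable
    under intersection. *)
Definition box a b c d x : R := \1_[set` `]a, b]] x.1 * \1_[set` `]c, d]] x.2.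

Lemma box_L1 a b c d : L1 (box a b c d).
Proof. by apply: integrable_prod2; exact: integrable_indic_itv. Qed.

Lemma box_sqr a b c d x : box a b c d x ^+ 2 = box a b c d x.
Proof.
by rewrite /box !indicE; do 2 case: (_ \in _); rewrite ?mulr0 ?mul0r ?expr0n ?mulr1 ?expr1n.
Qed.

Lemma box_L2 a b c d : box a b c d \in Ltwo.
Proof.
apply: LtwoP; first exact: L1_measurable (box_L1 a b c d).
rewrite (_ : (fun x => _) = EFin \o box a b c d); first exact: box_L1.
by apply/funext => x; rewrite /= box_sqr.
Qed.

Lemma ocitv_cover (t : R) : \forall n \near \oo, [set` `](- n%:R)%R, (n%:R : R)]] t.
Proof.
near=> n; rewrite /= in_itv/=.
have : `|t| < n%:R.
  apply: (lt_le_trans (archi_boundP (normr_ge0 t))).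
  by rewrite ler_nat; near: n; exact: nbhs_infty_ge.
by rewrite ltr_norml => /andP[-> /ltW ->].
Unshelve. all: by end_near. Qed.

Lemma ocitv_setI (p q r s : R) :
  [set` `]p, q]] `&` [set` `]r, s]] = [set` `](Num.max p r), (Num.min q s)]].
Proof.
apply/seteqP; split => t /=; rewrite !in_itv/= gt_max le_min.
  by move=> [/andP[-> ->] /andP[-> ->]].
by move=> /andP[/andP[-> ->] /andP[-> ->]].
Qed.

(** Three uses of the vanishing principle: intervals are replaced by measurable sets in the first
    coordinate, then in the second, then rectangles by measurable sets of the plane. *)
Lemma L1_box_vanish f : L1 f -> (forall a b c d, \int[mu]_x (f x * box a b c d x) = 0) ->
  {ae mu, forall x, f x = 0}.
Proof.
move=> lf f0.
have mo (A : set (measurableTypeR R)) : ocitv A -> measurable A.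
  by move=> oA; apply: sub_sigma_algebra.
have go n : ocitv [set` `](- n%:R)%R, (n%:R : R)]] by exists (- n%:R, n%:R).
have ind1 (A : set (measurableTypeR R)) : measurable A -> measurable_fun [set: E2] (fun x : E2 => \1_A x.1 : R).
  move=> mA; have h : measurable_fun setT (\1_A : measurableTypeR R -> R) by exact: measurable_indic.
  exact: (measurableT_comp h measurable_fst).
have ind2 (A : set (measurableTypeR R)) : measurable A -> measurable_fun [set: E2] (fun x : E2 => \1_A x.2 : R).
  move=> mA; have h : measurable_fun setT (\1_A : measurableTypeR R -> R) by exact: measurable_indic.
  exact: (measurableT_comp h measurable_snd).
have s1 (A B : set (measurableTypeR R)) : measurable A -> ocitv B -> \int[mu]_x (f x * \1_B x.2 * \1_A x.1) = 0.
  move=> mA oB.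
  refine (@Rintegral_indic_vanish _ _ E2 (measurableTypeR R) R mu (fun x => f x * \1_B x.2) fst (@ocitv R)
     (fun n => [set` `](- n%:R)%R, (n%:R : R)]]) _ _ _ _ _ _ _ A mA) => //.
  - by apply: (bounded_integrableM (c := 1) lf (ind2 _ (mo _ oB))) => x; exact: indic_le1.
  - exact: ocitvI.
  - exact: ocitv_cover.
  - move=> _ [[a b] _ <-]; move: oB => [[c d] _ <-]; rewrite -[RHS](f0 a b c d).
    by apply: eq_Rintegral => x _; rewrite /box mulrAC mulrA.
have s2 (A B : set (measurableTypeR R)) : measurable A -> measurable B -> \int[mu]_x (f x * \1_A x.1 * \1_B x.2) = 0.
  move=> mA mB.
  refine (@Rintegral_indic_vanish _ _ E2 (measurableTypeR R) R mu (fun x => f x * \1_A x.1) snd (@ocitv R)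
     (fun n => [set` `](- n%:R)%R, (n%:R : R)]]) _ _ _ _ _ _ _ B mB) => //.
  - by apply: (bounded_integrableM (c := 1) lf (ind1 _ mA)) => x; exact: indic_le1.
  - exact: ocitvI.
  - exact: ocitv_cover.
  - move=> C oC; rewrite -[RHS](s1 A C)//.
    by apply: eq_Rintegral => x _; rewrite mulrAC.
apply: (@ae0_of_indic _ E2 R mu) => // A mA.
refine (@Rintegral_indic_vanish _ _ E2 E2 R mu f id
   [set A `*` B | A in measurable & B in measurable] (fun=> setT) _ _ _ _ _ _ _ A mA) => //.
- exact: measurable_prod_measurableType.
- move=> _ _ [A1 mA1 [B1 mB1 <-]] [A2 mA2 [B2 mB2 <-]].
  exists (A1 `&` A2); first exact: measurableI.
  by exists (B1 `&` B2); [exact: measurableI|rewrite setXI].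
- by move=> _; exists setT => //; exists setT => //; rewrite setXTT.
- by move=> x; exact: nearW.
- move=> _ [C mC [B mB <-]]; rewrite -[RHS](s2 C B mC mB); apply: eq_Rintegral => x _.
  by rewrite -mulrA; congr (_ * _); rewrite !indicE -natrM mulnb in_setX.
Qed.

(** Multiplication by a large box makes [f] integrable, and the intersection of two boxes is again a
    box. *)
Lemma Ltwo_box_vanish f : f \in Ltwo -> (forall a b c d, ip mu f (box a b c d) = 0) ->
  {ae mu, forall x, f x = 0}.
Proof.
move=> lf f0.
pose fN (n : nat) x := f x * box (- n%:R) n%:R (- n%:R) n%:R x.
have lN n : L1 (fN n) by exact: (Ltwo_mul lf (box_L2 _ _ _ _)).
have fN0 n : {ae mu, forall x, fN n x = 0}.
  apply: L1_box_vanish => // a b c d.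
  rewrite -[RHS](f0 (Num.max (- n%:R) a) (Num.min n%:R b) (Num.max (- n%:R) c) (Num.min n%:R d)).
  apply: eq_Rintegral => x _; rewrite /fN -mulrA; congr (_ * _); rewrite /box.
  rewrite mulrACA !indicE -!natrM !mulnb -!in_setI; congr (_%:R).
  by rewrite !ocitv_setI.
apply: (ae_impl (ae_foralln fN0)) => x fx.
have [n xn] : exists n, box (- n%:R) n%:R (- n%:R) n%:R x = 1.
  near \oo => n; exists n; rewrite /box !indicE !mem_set ?mulr1//.
    by near: n; exact: ocitv_cover.
  by near: n; exact: ocitv_cover.
by have := fx n; rewrite /fN xn mulr1.
Unshelve. all: by end_near. Qed.


Lemma Rintegral_indic_poisson e a b t : 0 < e -> a < b ->
  leb.-integrable setT (EFin \o (fun s => \1_[set` `]a, b]] s * poisson e (t - s))) /\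
  \int[leb]_s (\1_[set` `]a, b]] s * poisson e (t - s)) = poisson_box e t a b.
Proof.
move=> e0 ab; have pC s : poisson e (t - s) = poisson e (s - t).
  by rewrite /poisson -(sqrrN (t - s)) opprB.
have E : (fun s => \1_[set` `]a, b]] s * poisson e (t - s)) =
    (fun s => poisson e (s - t)) \_ [set` `]a, b]].
  by apply/funext => s; rewrite patchE indicE pC; case: (_ \in _); rewrite ?mul1r ?mul0r.
have i1 : leb.-integrable [set` `]a, b]] (EFin \o (fun s => poisson e (s - t))).
  apply: integrableS (integrable_poisson_itv t a b e0) => //.
  exact: subset_itv_oc_cc.
split.
  rewrite E; apply: eq_integrable ((@integrable_mkcond _ (measurableTypeR R) _ _ _ _ (measurable_itv _)).1 i1) => //.
  by move=> s _; rewrite /= restrict_EFin.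
rewrite /poisson_box -(Rintegral_poisson t e0 (ltW ab)) E -Rintegral_mkcond.
by rewrite Rintegral_itv_obnd_cbnd.
Qed.

Lemma ae_neq_fst a : {ae mu, forall x, x.1 != a}.
Proof.
exists ([set a] `*` setT); split.
- exact: measurableX.
- by rewrite leb2_rect//= lebesgue_measure_set1 mul0e.
- by move=> x /=; move/negP; rewrite negbK => /eqP ->.
Qed.

Lemma ae_neq_snd a : {ae mu, forall x, x.2 != a}.
Proof.
exists (setT `*` [set a]); split.
- exact: measurableX.
- by rewrite leb2_rect//= lebesgue_measure_set1 mule0.
- by move=> x /=; move/negP; rewrite negbK => /eqP ->.
Qed.

(** The two sides are limits of the same Abel-weighted integral. On the frequency side domination is
    by the product of two L^2 transforms; on the space side the Poisson integral of the box is
    bounded by (2 pi)^2 and converges off the four boundary lines. *)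
Lemma hartley1_box f a b c d : a < b -> c < d -> L1 f -> f \in Ltwo ->
  ip mu (hartley1 f) (hartley1 (box a b c d)) = (2 * pi) ^+ 2 * ip mu f (box a b c d).
Proof.
move=> ab cd lf l2f.
have lB := box_L1 a b c d; have l2B := box_L2 a b c d.
have [hf _] := hartley1_L2 lf l2f; have [hB _] := hartley1_L2 lB l2B.
have i2 := Ltwo_mul hf hB.
pose I n := \int[mu]_xi (abel2 n.+1%:R^-1 xi * (hartley1 f xi * hartley1 (box a b c d) xi)).
have c1 : I n @[n --> \oo] --> ip mu (hartley1 f) (hartley1 (box a b c d)).
  apply: (@Rintegral_dominated _ E2 R mu _ _ (fun xi => `|hartley1 f xi * hartley1 (box a b c d) xi|)).
  - move=> n; apply: measurable_funM; first exact: measurable_abel2.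
    exact: L1_measurable i2.
  - exact: L1_measurable i2.
  - apply: aeW => xi; rewrite -[X in _ --> X]mul1r; apply: cvgM; last exact: cvg_cst.
    under eq_fun do rewrite -abel2_half expr2.
    by have := cvgM (cvg_abel2 xi) (cvg_abel2 xi); rewrite mulr1; exact.
  - exact: (integrable_norm i2).
  - by move=> n xi; rewrite normrM ler_piMl// abel2_norm_le1.
pose P n x := poisson_box (n.+1%:R^-1) x.1 a b * poisson_box (n.+1%:R^-1) x.2 c d.
have IE n : I n = \int[mu]_x (f x * P n x).
  have e0 : 0 < n.+1%:R^-1 :> R by [].
  rewrite /I abel2_hartley1//; apply: eq_Rintegral => x _; congr (_ * _); rewrite /P.
  have [i1 <-] := Rintegral_indic_poisson x.1 e0 ab.
  have [i3 <-] := Rintegral_indic_poisson x.2 e0 cd.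
  rewrite -(Rintegral_prod2 i1 i3); apply: eq_Rintegral => y _.
  by rewrite /box /poisson2 mulrACA.
have mpb (g : measurableTypeR R * measurableTypeR R -> R) n p q : measurable_fun setT g ->
    measurable_fun setT (fun x => poisson_box (n.+1%:R^-1) (g x) p q).
  move=> mg; have h r : measurable_fun setT (fun x => 2 * atan (n.+1%:R^-1^-1 * (r - g x)) : R).
    apply: measurable_funM => //; apply: (measurableT_comp (f := @atan R)).
      by apply: continuous_measurable_fun => t; exact: continuous_atan.
    by apply: measurable_funM => //; exact: measurable_funB.
  by apply: measurable_funB; exact: h.
have c2 : \int[mu]_x (f x * P n x) @[n --> \oo] --> \int[mu]_x ((2 * pi) ^+ 2 * (f x * box a b c d x)).
  apply: (@Rintegral_dominated _ E2 R mu _ _ (fun x => (2 * pi) ^+ 2 * `|f x|)).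
  - move=> n; apply: measurable_funM; first exact: L1_measurable.
    by apply: measurable_funM; apply: mpb; [exact: measurable_fst|exact: measurable_snd].
  - by apply: measurable_funM => //; exact: L1_measurable (Ltwo_mul l2f l2B).
  - apply: (ae_impl2 (ae_impl2 (ae_neq_fst a) (ae_neq_fst b) (fun x p q => conj p q))
      (ae_impl2 (ae_neq_snd c) (ae_neq_snd d) (fun x p q => conj p q))) => x [xa xb] [xc xd].
    have -> : (2 * pi) ^+ 2 * (f x * box a b c d x) =
        f x * ((2 * pi * \1_[set` `]a, b]] x.1) * (2 * pi * \1_[set` `]c, d]] x.2)).
      by rewrite /box; ring.
    apply: cvgM; first exact: cvg_cst.
    by apply: cvgM; exact: cvg_poisson_box.
  - exact: (integrableZl measurableT _ (integrable_norm lf)).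
  - move=> n x; rewrite normrM mulrC ler_wpM2r// normrM expr2.
    by rewrite ler_pM// poisson_box_le.
have : I n @[n --> \oo] --> \int[mu]_x ((2 * pi) ^+ 2 * (f x * box a b c d x)).
  by under eq_fun do rewrite IE.
move=> c3; rewrite -[RHS](RintegralZl _ measurableT (Ltwo_mul l2f l2B)).
exact: (cvg_unique _ c1 c3).
Qed.

End Boxes.

Section LtwoConvergence.
Context d (T : measurableType d) (R : realType) (mu : {measure set T -> \bar R}).
Implicit Types (u : nat -> T -> R) (f g h : T -> R).
Local Notation Ltwo := (Lfun mu 2%:E).

Definition cvgL2 u g := forall e : R, 0 < e -> exists N, forall n, (N <= n)%N ->
  l2 mu (fun x => u n x - g x) <= e.

Lemma cvgL2_ip u g h : (forall n, u n \in Ltwo) -> g \in Ltwo -> h \in Ltwo ->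
  cvgL2 u g -> ip mu (u n) h @[n --> \oo] --> ip mu g h.
Proof.
move=> lu lg lh ug; apply/cvgrPdist_le => e e0.
have c0 : 0 < 1 + l2 mu h by rewrite ltr_pwDl// l2_ge0.
have [N HN] := ug (e / (1 + l2 mu h)) (divr_gt0 e0 c0).
exists N => // n /= Nn; rewrite distrC -ipBl//.
apply: (le_trans (ip_CS (Ltwo_sub (lu n) lg) lh)).
apply: (@le_trans _ _ (e / (1 + l2 mu h) * l2 mu h)).
  by rewrite ler_wpM2r ?l2_ge0// HN.
rewrite mulrAC ler_pdivrMr// ler_wpM2l ?lerDr//; exact: ltW.
Qed.

Lemma cvgL2_unique u f g : (forall n, u n \in Ltwo) -> f \in Ltwo -> g \in Ltwo ->
  cvgL2 u f -> cvgL2 u g -> {ae mu, forall x, f x = g x}.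
Proof.
move=> lu lf lg uf ug.
have : l2 mu (fun x => f x - g x) = 0.
  apply/eqP; rewrite eq_le l2_ge0 andbT; apply/ler_addgt0Pl => e e0.
  have e20 : 0 < e / 2 by rewrite divr_gt0.
  have [N HN] := uf _ e20; have [M HM] := ug _ e20.
  have -> : (fun x => f x - g x) = (fun x => (f x - u (maxn N M) x) + (u (maxn N M) x - g x)).
    by apply/funext => x; rewrite addrA subrK.
  rewrite addr0; apply: (le_trans (l2_triangle _ _)); [exact: Ltwo_sub|exact: Ltwo_sub|].
  rewrite (splitr e); apply: lerD; last by apply: HM; exact: leq_maxr.
  by rewrite l2_distC; apply: HN; exact: leq_maxl.
move=> /(l2_eq0 (Ltwo_sub lf lg)) H; apply: (ae_impl H) => x /eqP.
by rewrite subr_eq0 => /eqP.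
Qed.

Lemma cvgL2_le u f c : (forall n, u n \in Ltwo) -> f \in Ltwo -> cvgL2 u f ->
  (forall n, l2 mu (u n) <= c) -> l2 mu f <= c.
Proof.
move=> lu lf uf uc; apply/ler_addgt0Pl => e e0; have [N HN] := uf e e0.
have -> : f = (fun x => (f x - u N x) + u N x) by apply/funext => x; rewrite subrK.
apply: (le_trans (l2_triangle _ _)); [exact: Ltwo_sub|exact: lu|].
by apply: lerD => //; rewrite l2_distC; exact: HN.
Qed.

End LtwoConvergence.

(* The instances of the general lemmas in the plane, where inferring the
   product measurable structure anew at each use would be very slow. *)
Section PlaneSquareIntegrable.
Context {R : realType}.
Local Notation E2 := (measurableTypeR R * measurableTypeR R)%type.
Local Notation mu := (@leb2 R).
Local Notation Ltwo := (Lfun mu 2%:E).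
Implicit Types (f g h : R * R -> R) (c : R).

Lemma plane_measurable f : f \in Ltwo -> measurable_fun [set: E2] f.
Proof. exact: (@Ltwo_measurable _ E2 R mu). Qed.

Lemma plane_add f g : f \in Ltwo -> g \in Ltwo -> (fun x => f x + g x) \in Ltwo.
Proof. exact: (@Ltwo_add _ E2 R mu). Qed.

Lemma plane_sub f g : f \in Ltwo -> g \in Ltwo -> (fun x => f x - g x) \in Ltwo.
Proof. exact: (@Ltwo_sub _ E2 R mu). Qed.

Lemma plane_scale c f : f \in Ltwo -> (fun x => c * f x) \in Ltwo.
Proof. exact: (@Ltwo_scale _ E2 R mu). Qed.

Lemma plane_opp f : f \in Ltwo -> (fun x => - f x) \in Ltwo.
Proof. exact: (@Ltwo_opp _ E2 R mu). Qed.

Lemma plane_ipDl f g h : f \in Ltwo -> g \in Ltwo -> h \in Ltwo ->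
  ip mu (fun x => f x + g x) h = ip mu f h + ip mu g h.
Proof. exact: (@ipDl _ E2 R mu). Qed.

Lemma plane_ipDr f g h : f \in Ltwo -> g \in Ltwo -> h \in Ltwo ->
  ip mu h (fun x => f x + g x) = ip mu h f + ip mu h g.
Proof. exact: (@ipDr _ E2 R mu). Qed.

Lemma plane_ipBl f g h : f \in Ltwo -> g \in Ltwo -> h \in Ltwo ->
  ip mu (fun x => f x - g x) h = ip mu f h - ip mu g h.
Proof. exact: (@ipBl _ E2 R mu). Qed.

Lemma plane_ipBr f g h : f \in Ltwo -> g \in Ltwo -> h \in Ltwo ->
  ip mu h (fun x => f x - g x) = ip mu h f - ip mu h g.
Proof. exact: (@ipBr _ E2 R mu). Qed.

Lemma plane_ipZr c f g : f \in Ltwo -> g \in Ltwo ->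
  ip mu f (fun x => c * g x) = c * ip mu f g.
Proof. exact: (@ipZr _ E2 R mu). Qed.

Lemma plane_CS f g : f \in Ltwo -> g \in Ltwo -> `|ip mu f g| <= l2 mu f * l2 mu g.
Proof. exact: (@ip_CS _ E2 R mu). Qed.

Lemma plane_triangle f g : f \in Ltwo -> g \in Ltwo ->
  l2 mu (fun x => f x + g x) <= l2 mu f + l2 mu g.
Proof. exact: (@l2_triangle _ E2 R mu). Qed.

Lemma plane_eq0 f : f \in Ltwo -> l2 mu f = 0 -> {ae mu, forall x, f x = 0}.
Proof. exact: (@l2_eq0 _ E2 R mu). Qed.

Lemma plane_eq_ae_ip f f' g : measurable_fun [set: E2] f -> measurable_fun [set: E2] f' ->
  measurable_fun [set: E2] g ->
  {ae mu, forall x, f x = f' x} -> ip mu f g = ip mu f' g.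
Proof. exact: (@eq_ae_ip _ E2 R mu). Qed.

End PlaneSquareIntegrable.

(** * Extension of the transform to L^2, inversion and Plancherel *)

Section HartleyL2.
Context {R : realType}.
Implicit Types (x y xi : R * R) (f g : R * R -> R) (n : nat).
Local Notation leb := (@lebesgue_measure R).
Local Notation E2 := (measurableTypeR R * measurableTypeR R)%type.
Local Notation mu := (@leb2 R).
Local Notation L1 f := (mu.-integrable setT (EFin \o f)).
Local Notation Ltwo := (Lfun mu 2%:E).

(** The same Euclidean balls as in [fourier_ball], so that both transforms are limits along the same
    truncations. *)
Definition disk n : set E2 := [set x | dot x x <= n%:R ^+ 2].
Definition trunc n f x : R := f x * \1_(disk n) x.

Lemma measurable_disk n : measurable (disk n).
Proof.
have m : measurable_fun [set: E2] (fun x : E2 => dot x x).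
  apply: measurable_funD; apply: measurable_funM; try exact: measurable_fst; exact: measurable_snd.
have := m measurableT _ (measurable_itv `]-oo, (n%:R : R) ^+ 2]).
by rewrite setTI; congr measurable; apply/seteqP; split => x /=; rewrite in_itv.
Qed.

Lemma measurable_indic_disk n : measurable_fun [set: E2] (\1_(disk n) : E2 -> R).
Proof. by apply: measurable_indic; exact: measurable_disk. Qed.

Lemma disk_cover x : \forall n \near \oo, disk n x.
Proof.
near=> n; rewrite /disk /=.
have h : 1 + dot x x <= n%:R.
  apply: (le_trans (ler_norm _)); apply/ltW/(lt_le_trans (archi_boundP (normr_ge0 _))).
  by rewrite ler_nat; near: n; exact: nbhs_infty_ge.
have d0 : 0 <= dot x x by rewrite addr_ge0// -expr2 sqr_ge0.
by move: h d0; move: (dot x x) (n%:R : R) => a b; nra.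
Unshelve. all: by end_near. Qed.

Lemma indic_disk_L2 n : (\1_(disk n) : R * R -> R) \in Ltwo.
Proof.
apply: (@Ltwo_le _ E2 R mu _ (box (- n.+1%:R) n.+1%:R (- n.+1%:R) n.+1%:R)).
- exact: measurable_indic_disk.
- exact: box_L2.
- move=> x; rewrite {1}indicE; have [/set_mem|_] := boolP (x \in disk n); last by rewrite normr0.
  move=> xn; have n0 : 0 <= (n%:R : R) by [].
  suff -> : box (- n.+1%:R) n.+1%:R (- n.+1%:R) n.+1%:R x = 1 by rewrite !normr1.
  have : `|x.1| <= n%:R /\ `|x.2| <= n%:R.
    by move: xn; rewrite /disk /= /dot => h; split; rewrite ler_norml; apply/andP; split; nra.
  rewrite !ler_norml => -[/andP[a1 a2] /andP[b1 b2]].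
  by rewrite /box !indicE !mem_set ?mulr1//= in_itv/= -natr1; apply/andP; split; lra.
Qed.

Lemma trunc_measurable n f : f \in Ltwo -> measurable_fun [set: E2] (trunc n f).
Proof.
move=> lf; apply: measurable_funM; last exact: measurable_indic_disk.
exact: (plane_measurable lf).
Qed.

Lemma trunc_le n f x : `|trunc n f x| <= `|f x|.
Proof. by rewrite normrM ler_piMr// indic_le1. Qed.

Lemma trunc_L2 n f : f \in Ltwo -> trunc n f \in Ltwo.
Proof. by move=> lf; apply: (Ltwo_le (trunc_measurable n lf) lf) => x; exact: trunc_le. Qed.

Lemma trunc_L1 n f : f \in Ltwo -> L1 (trunc n f).
Proof. by move=> lf; exact: (Ltwo_mul lf (indic_disk_L2 n)). Qed.

(** Dominated convergence for the squared distance, with (u - f)^2 <= 2 (g^2 + f^2). *)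
Lemma cvgL2_dominated (u : nat -> R * R -> R) f g : (forall n, measurable_fun [set: E2] (u n)) ->
  f \in Ltwo -> g \in Ltwo -> (forall n x, `|u n x| <= `|g x|) ->
  {ae mu, forall x, u n x @[n --> \oo] --> f x} -> cvgL2 mu u f.
Proof.
move=> mu_ lf lg ug uf.
have lu n : u n \in Ltwo by exact: (Ltwo_le (mu_ n) lg (ug n)).
have iG : L1 (fun x => 2 * (g x ^+ 2 + f x ^+ 2)).
  exact: (integrableZl measurableT 2 (integrableD measurableT (Ltwo_sqr lg) (Ltwo_sqr lf))).
have cv : \int[mu]_x ((u n x - f x) ^+ 2) @[n --> \oo] --> \int[mu]_x (0 : R).
  apply: (@Rintegral_dominated _ E2 R mu _ _ (fun x => 2 * (g x ^+ 2 + f x ^+ 2))) => //.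
  - move=> n; apply: measurable_funX; apply: measurable_funB => //; exact: (plane_measurable lf).
  - apply: (ae_impl uf) => x ufx.
    have : (u n x - f x) * (u n x - f x) @[n --> \oo] --> (f x - f x) * (f x - f x).
      by apply: cvgM; apply: cvgB => //; exact: cvg_cst.
    by rewrite subrr mulr0; under eq_fun do rewrite -expr2.
  - move=> n x; rewrite ger0_norm ?sqr_ge0//.
    have h : (u n x) ^+ 2 <= (g x) ^+ 2.
      by rewrite -(real_normK (num_real (u n x))) -(real_normK (num_real (g x))) lerXn2r ?nnegrE// ug.
    have := sqr_ge0 (u n x + f x); move: h.
    by move: (u n x) (f x) (g x) => a b c; nra.
rewrite Rintegral_cst// mul0r in cv.
move=> e e0; have e20 : 0 < e ^+ 2 by rewrite exprn_gt0.
move/cvgrPdist_le : cv => /(_ _ e20)[N _ HN]; exists N => n Nn.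
have := HN n Nn; rewrite sub0r normrN ger0_norm; last by apply: Rintegral_ge0 => x _; exact: sqr_ge0.
rewrite (_ : \int[mu]_x _ = l2 mu (fun x => u n x - f x) ^+ 2); last first.
  by rewrite l2_sqr; apply: eq_Rintegral => x _; rewrite expr2.
by rewrite ler_sqr ?nnegrE ?l2_ge0// ltW.
Qed.

Lemma cvg_trunc f : f \in Ltwo -> cvgL2 mu (trunc^~ f) f.
Proof.
move=> lf; apply: (cvgL2_dominated (g := f)) => //.
- by move=> n; exact: trunc_measurable.
- by move=> n x; exact: trunc_le.
- apply: aeW => x; apply: cvg_near_cst; near=> n.
  rewrite /trunc indicE mem_set ?mulr1//; near: n; exact: disk_cover.
Unshelve. all: by end_near. Qed.

Lemma hartley1_add f g xi : L1 f -> L1 g ->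
  hartley1 (fun x => f x + g x) xi = hartley1 f xi + hartley1 g xi.
Proof.
move=> lf lg; rewrite /hartley1.
rewrite -(RintegralD measurableT (integrable_hartley1 xi lf) (integrable_hartley1 xi lg)).
by apply: eq_Rintegral => x _; rewrite mulrDl.
Qed.

Lemma hartley1_scale (c : R) f xi : L1 f -> hartley1 (fun x => c * f x) xi = c * hartley1 f xi.
Proof.
move=> lf; rewrite /hartley1 -(RintegralZl c measurableT (integrable_hartley1 xi lf)).
by apply: eq_Rintegral => x _; rewrite mulrA.
Qed.

Lemma hartley1_sub f g xi : L1 f -> L1 g ->
  hartley1 (fun x => f x - g x) xi = hartley1 f xi - hartley1 g xi.
Proof.
move=> lf lg; rewrite /hartley1.
rewrite -(RintegralB measurableT (integrable_hartley1 xi lf) (integrable_hartley1 xi lg)).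
by apply: eq_Rintegral => x _; rewrite mulrBl.
Qed.

Lemma hartley1_trunc_L2 n f : f \in Ltwo -> hartley1 (trunc n f) \in Ltwo.
Proof. by move=> lf; have [] := hartley1_L2 (trunc_L1 n lf) (trunc_L2 n lf). Qed.

Lemma hartley1_sub_le f g : L1 f -> f \in Ltwo -> L1 g -> g \in Ltwo ->
  l2 mu (fun xi => hartley1 f xi - hartley1 g xi) <= 2 * pi * l2 mu (fun x => f x - g x).
Proof.
move=> lf l2f lg l2g.
rewrite (_ : (fun xi => _) = hartley1 (fun x => f x - g x)).
  apply: (proj2 (hartley1_L2 _ _)); first exact: (integrableB measurableT lf lg).
  exact: plane_sub.
by apply/funext => xi; rewrite hartley1_sub.
Qed.

(** Truncations are Cauchy in L^2, their transforms are Cauchy by the bound 2 pi, and completeness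
    gives the limit. The implication under the existential lets the choice define a total
    function. *)
Fact hartley_subproof f : exists g, f \in Ltwo ->
  g \in Ltwo /\ cvgL2 mu (fun n => hartley1 (trunc n f)) g.
Proof.
have [lf|] := boolP (f \in Ltwo); last by exists f.
have [|e e0|v lv cv] := @Ltwo_complete _ E2 R mu (fun n => hartley1 (trunc n f)).
- by move=> n; exact: hartley1_trunc_L2.
- have pp : 0 < 2 * pi :> R by rewrite mulr_gt0// pi_gt0.
  have e1 : 0 < e / (2 * pi) / 2 by rewrite !divr_gt0.
  have [N HN] := cvg_trunc lf e1; exists N => m n Nm Nn.
  have lm := trunc_L2 m lf; have ln := trunc_L2 n lf.
  apply: (le_trans (hartley1_sub_le (trunc_L1 m lf) lm (trunc_L1 n lf) ln)).
  rewrite mulrC -ler_pdivlMr//.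
  have -> : (fun x => trunc m f x - trunc n f x) =
      (fun x => (trunc m f x - f x) + (f x - trunc n f x)).
    by apply/funext => x; rewrite addrA subrK.
  apply: (le_trans (plane_triangle _ _)); [exact: plane_sub|exact: plane_sub|].
  rewrite (splitr (e / _)); apply: lerD; first exact: HN.
  by rewrite l2_distC; exact: HN.
- by exists v.
Qed.

Definition hartley f : R * R -> R := sval (cid (hartley_subproof f)).

Lemma hartleyP f : f \in Ltwo ->
  hartley f \in Ltwo /\ cvgL2 mu (fun n => hartley1 (trunc n f)) (hartley f).
Proof. exact: (svalP (cid (hartley_subproof f))). Qed.

Lemma hartley_L2 f : f \in Ltwo -> hartley f \in Ltwo.
Proof. by move=> /hartleyP[]. Qed.

Lemma hartley_measurable f : f \in Ltwo -> measurable_fun [set: E2] (hartley f).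
Proof. by move=> /hartley_L2; exact: plane_measurable. Qed.

Lemma hartley_unique f g : f \in Ltwo -> g \in Ltwo ->
  cvgL2 mu (fun n => hartley1 (trunc n f)) g -> {ae mu, forall xi, hartley f xi = g xi}.
Proof.
move=> lf lg fg; have [lh fh] := hartleyP lf.
by apply: (@cvgL2_unique _ E2 R mu (fun n => hartley1 (trunc n f))) => // n; exact: hartley1_trunc_L2.
Qed.

Lemma hartley_L1 f : L1 f -> f \in Ltwo -> {ae mu, forall xi, hartley f xi = hartley1 f xi}.
Proof.
move=> lf l2f; apply: hartley_unique => //; first by have [] := hartley1_L2 lf l2f.
have pp : 0 < 2 * pi :> R by rewrite mulr_gt0// pi_gt0.
move=> e e0; have [N HN] := cvg_trunc l2f (divr_gt0 e0 pp).
exists N => n Nn; apply: (le_trans (hartley1_sub_le (trunc_L1 n l2f) (trunc_L2 n l2f) lf l2f)).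
by rewrite mulrC -ler_pdivlMr// HN.
Qed.

Lemma hartley_le f : f \in Ltwo -> l2 mu (hartley f) <= 2 * pi * l2 mu f.
Proof.
move=> lf; have [lh fh] := hartleyP lf.
apply: (cvgL2_le _ lh fh) => n; first exact: hartley1_trunc_L2.
have [_] := hartley1_L2 (trunc_L1 n lf) (trunc_L2 n lf); move=> /le_trans; apply.
rewrite ler_wpM2l ?mulr_ge0 ?pi_ge0//.
apply: l2_le => //; first exact: trunc_measurable.
by move=> x; exact: trunc_le.
Qed.

Lemma hartley_add f g : f \in Ltwo -> g \in Ltwo ->
  {ae mu, forall xi, hartley (fun x => f x + g x) xi = hartley f xi + hartley g xi}.
Proof.
move=> lf lg; apply: hartley_unique; [exact: plane_add| |].
  by apply: plane_add; exact: hartley_L2.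
have [lhf hf] := hartleyP lf; have [lhg hg] := hartleyP lg.
move=> e e0; have e20 : 0 < e / 2 by rewrite divr_gt0.
have [N HN] := hf _ e20; have [M HM] := hg _ e20; exists (maxn N M) => n.
rewrite geq_max => /andP[Nn Mn].
rewrite [X in l2 _ X](_ : _ = (fun x => (hartley1 (trunc n f) x - hartley f x) +
     (hartley1 (trunc n g) x - hartley g x))); last first.
  apply/funext => xi; rewrite -(addrACA _ _ (- _)) -opprD -(hartley1_add xi (trunc_L1 n lf) (trunc_L1 n lg)).
  by congr (hartley1 _ _ - _); apply/funext => x; rewrite /trunc mulrDl.
apply: (le_trans (plane_triangle _ _)).
- by apply: plane_sub => //; exact: hartley1_trunc_L2.
- by apply: plane_sub => //; exact: hartley1_trunc_L2.
- by rewrite (splitr e); apply: lerD; [exact: HN|exact: HM].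
Qed.

Lemma hartley_scale (c : R) f : f \in Ltwo ->
  {ae mu, forall xi, hartley (fun x => c * f x) xi = c * hartley f xi}.
Proof.
move=> lf; apply: hartley_unique; [exact: plane_scale| |].
  by apply: plane_scale; exact: hartley_L2.
have [lhf hf] := hartleyP lf.
have c0 : 0 < 1 + `|c| by rewrite ltr_pwDl.
move=> e e0; have [N HN] := hf _ (divr_gt0 e0 c0); exists N => n Nn.
rewrite [X in l2 _ X](_ : _ = (fun x => c * (hartley1 (trunc n f) x - hartley f x))); last first.
  apply/funext => xi; rewrite mulrBr -(hartley1_scale c xi (trunc_L1 n lf)).
  by congr (hartley1 _ _ - _); apply/funext => x; rewrite /trunc mulrA.
rewrite l2Z; last by apply: plane_sub => //; exact: hartley1_trunc_L2.
apply: (@le_trans _ _ (`|c| * (e / (1 + `|c|)))); first by rewrite ler_wpM2l// HN.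
by rewrite mulrCA ler_piMr ?(ltW e0)// ler_pdivrMr// mul1r lerDr.
Qed.

Lemma hartley_sub f g : f \in Ltwo -> g \in Ltwo ->
  {ae mu, forall xi, hartley (fun x => f x - g x) xi = hartley f xi - hartley g xi}.
Proof.
move=> lf lg; have H1 := hartley_scale (-1) lg.
have H2 := hartley_add lf (plane_scale (-1) lg).
apply: (ae_impl2 H1 H2) => xi e1 e2.
rewrite (_ : (fun x => f x - g x) = (fun x => f x + -1 * g x)) ?e2 ?e1 ?mulN1r//.
by apply/funext => x; rewrite mulN1r.
Qed.

(** The identity for truncations is passed to the limit first in the truncation of [g], then in that
    of [f]. *)
Lemma hartley_sym f g : f \in Ltwo -> g \in Ltwo ->
  ip mu (hartley f) g = ip mu f (hartley g).
Proof.
move=> lf lg; have [lhf hf] := hartleyP lf; have [lhg hg] := hartleyP lg.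
have s1 n m : ip mu (hartley1 (trunc n f)) (trunc m g) = ip mu (trunc n f) (hartley1 (trunc m g)).
  by rewrite [RHS](hartley1_sym (trunc_L1 n lf) (trunc_L1 m lg)).
have s2 n : ip mu (hartley1 (trunc n f)) g = ip mu (trunc n f) (hartley g).
  have c1 := @cvgL2_ip _ E2 R mu (trunc^~ g) g (hartley1 (trunc n f)) (fun m => trunc_L2 m lg) lg
    (hartley1_trunc_L2 n lf) (cvg_trunc lg).
  have c2 := @cvgL2_ip _ E2 R mu (fun m => hartley1 (trunc m g)) (hartley g) (trunc n f)
    (fun m => hartley1_trunc_L2 m lg) lhg (trunc_L2 n lf) hg.
  rewrite ipC [RHS]ipC -(cvg_lim _ c1)// -(cvg_lim _ c2)//; congr (limn _).
  by apply/funext => m; rewrite ipC s1 ipC.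
have c1 := @cvgL2_ip _ E2 R mu (trunc^~ f) f (hartley g) (fun m => trunc_L2 m lf) lf lhg (cvg_trunc lf).
have c2 := @cvgL2_ip _ E2 R mu (fun m => hartley1 (trunc m f)) (hartley f) g
    (fun m => hartley1_trunc_L2 m lf) lhf lg hf.
rewrite -(cvg_lim _ c1)// -(cvg_lim _ c2)//; congr (limn _).
by apply/funext => m; exact: s2.
Qed.

Lemma hartley_box f (a b c d : R) : f \in Ltwo ->
  ip mu (hartley f) (hartley (box a b c d)) = (2 * pi) ^+ 2 * ip mu f (box a b c d).
Proof.
move=> lf; have [lhf hf] := hartleyP lf; have lB := box_L2 a b c d.
(* Degenerate boxes are split off because [hartley1_box] requires nonempty sides. *)
have box0 : (b <= a) || (d <= c) -> box a b c d = (fun=> 0).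
  move=> h; apply/funext => x; rewrite /box !indicE.
  case/orP: h => h.
    by rewrite memNset ?mul0r//= in_itv/= => /andP[h1 h2]; lra.
  by rewrite (@memNset _ [set` `]c, d]]) ?mulr0//= in_itv/= => /andP[h1 h2]; lra.
have zero : (b <= a) || (d <= c) ->
    ip mu (hartley f) (hartley (box a b c d)) = (2 * pi) ^+ 2 * ip mu f (box a b c d).
  move=> h.
  have h0 : l2 mu (hartley (box a b c d)) = 0.
    apply/eqP; rewrite eq_le l2_ge0 andbT; apply: (le_trans (hartley_le lB)); rewrite (box0 h).
    by rewrite /l2 /ip; under eq_Rintegral do rewrite mulr0; rewrite Rintegral_cst// mul0r sqrtr0 mulr0.
  have := plane_CS lhf (hartley_L2 lB).
  rewrite h0 mulr0 normr_le0 => /eqP ->; rewrite (box0 h) /ip.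
  by under eq_Rintegral do rewrite mulr0; rewrite Rintegral_cst// mul0r mulr0.
have [ab|ba] := ltP a b; last by apply: zero; rewrite ba.
have [cd|dc] := ltP c d; last by apply: zero; rewrite dc orbT.
have B1 := hartley_L1 (box_L1 a b c d) lB.
have [lhB _] := hartley1_L2 (box_L1 a b c d) lB.
rewrite ipC (plane_eq_ae_ip (hartley_measurable lB) (plane_measurable lhB) (plane_measurable lhf) B1) ipC.
have c1 := @cvgL2_ip _ E2 R mu (fun m => hartley1 (trunc m f)) (hartley f) (hartley1 (box a b c d))
    (fun m => hartley1_trunc_L2 m lf) lhf lhB hf.
have c2 := @cvgL2_ip _ E2 R mu (trunc^~ f) f (box a b c d) (fun m => trunc_L2 m lf) lf lB (cvg_trunc lf).
have c3 : (2 * pi) ^+ 2 * ip mu (trunc n f) (box a b c d) @[n --> \oo] --> (2 * pi) ^+ 2 * ip mu f (box a b c d).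
  by apply: cvgM => //; exact: cvg_cst.
rewrite -(cvg_lim _ c1)// -(cvg_lim _ c3)//; congr (limn _); apply/funext => n.
by apply: hartley1_box => //; [exact: trunc_L1|exact: trunc_L2].
Qed.

(** By symmetry and [hartley_box], the difference of the two sides is orthogonal to every box. *)
Lemma hartleyK f : f \in Ltwo ->
  {ae mu, forall x, hartley (hartley f) x = (2 * pi) ^+ 2 * f x}.
Proof.
move=> lf; have lhf := hartley_L2 lf; have lhhf := hartley_L2 lhf.
have lcf := plane_scale ((2 * pi) ^+ 2) lf.
have := @Ltwo_box_vanish R (fun x => hartley (hartley f) x - (2 * pi) ^+ 2 * f x) (plane_sub lhhf lcf) _.
move=> H; have {}H : {ae mu, forall x, hartley (hartley f) x - (2 * pi) ^+ 2 * f x = 0}.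
  apply: H => a b c d; have lB := box_L2 a b c d.
  by rewrite (plane_ipBl lhhf lcf lB) (hartley_sym lhf lB) (hartley_box _ _ _ _ lf) (ipZl _ lf lB) subrr.
by apply: (ae_impl H) => x /eqP; rewrite subr_eq0 => /eqP.
Qed.

Lemma plancherel f g : f \in Ltwo -> g \in Ltwo ->
  ip mu (hartley f) (hartley g) = (2 * pi) ^+ 2 * ip mu f g.
Proof.
move=> lf lg; rewrite -hartley_sym//; last exact: hartley_L2.
rewrite (plane_eq_ae_ip (hartley_measurable (hartley_L2 lf)) _ (plane_measurable lg) (hartleyK lf)).
  by rewrite ipZl.
exact: (plane_measurable (plane_scale _ lf)).
Qed.

Lemma hartley_ae f g : f \in Ltwo -> g \in Ltwo -> {ae mu, forall x, f x = g x} ->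
  {ae mu, forall xi, hartley f xi = hartley g xi}.
Proof.
move=> lf lg fg; have := hartley_sub lf lg => H1.
have l0 : l2 mu (hartley (fun x => f x - g x)) = 0.
  apply/eqP; rewrite eq_le l2_ge0 andbT; apply: (le_trans (hartley_le (plane_sub lf lg))).
  rewrite (@eq_ae_l2 _ E2 R mu _ (fun=> 0)).
  - by rewrite /l2 /ip; under eq_Rintegral do rewrite mulr0; rewrite Rintegral_cst// mul0r sqrtr0 mulr0.
  - exact: (plane_measurable (plane_sub lf lg)).
  - exact: measurable_cst.
  - by apply: (ae_impl fg) => x ->; rewrite subrr.
apply: (ae_impl2 H1 (plane_eq0 (hartley_L2 (plane_sub lf lg)) l0)) => xi -> /eqP.
by rewrite subr_eq0 => /eqP.
Qed.

(** A second application of the transform multiplies both functions by the nonzero constant (2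
    pi)^2. *)
Lemma hartley_inj f g : f \in Ltwo -> g \in Ltwo ->
  {ae mu, forall xi, hartley f xi = hartley g xi} -> {ae mu, forall x, f x = g x}.
Proof.
move=> lf lg fg; have H := hartley_ae (hartley_L2 lf) (hartley_L2 lg) fg.
have pp : (2 * pi) ^+ 2 != 0 :> R by rewrite expf_neq0// mulf_neq0// gt_eqF// pi_gt0.
apply: (ae_impl3 H (hartleyK lf) (hartleyK lg)) => x e1 e2 e3.
by apply: (mulfI pp); rewrite -e2 -e3.
Qed.

End HartleyL2.

(** * The Fourier transform and real even multipliers *)

Section Fourier.
Context {R : realType}.
Implicit Types (x y xi : R * R) (f h : R * R -> R) (g : R * R -> R[i]) (n : nat).
Local Notation leb := (@lebesgue_measure R).
Local Notation E2 := (measurableTypeR R * measurableTypeR R)%type.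
Local Notation mu := (@leb2 R).
Local Notation L1 f := (mu.-integrable setT (EFin \o f)).
Local Notation Ltwo := (Lfun mu 2%:E).

(* e^(-i t) = (cas t + cas (-t)) / 2
   + i (cas (-t) - cas t) / 2. *)
Definition fourier_of h xi : R[i] := Complex ((h xi + h (- xi)) / 2) ((h (- xi) - h xi) / 2).

Lemma dotNr x xi : dot x (- xi) = - dot x xi.
Proof. by rewrite /dot /= !mulrN opprD. Qed.

Lemma fourier_ballE n f xi : f \in Ltwo ->
  fourier_ball n f xi = fourier_of (hartley1 (trunc n f)) xi.
Proof.
move=> lf; have lt := trunc_L1 n lf.
have ip_ (q : R * R -> R) : \int[mu]_(x in [set x | dot x x <= n%:R ^+ 2]) q x =
    \int[mu]_x (q x * \1_(disk n) x).
  rewrite [LHS](@Rintegral_mkcond _ E2 R mu); apply: eq_Rintegral => x _.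
  by rewrite patchE indicE -/(disk n); case: ifP; rewrite ?mulr1 ?mulr0.
have i1 := integrable_hartley1 xi lt; have i2 := integrable_hartley1 (- xi) lt.
rewrite /fourier_ball /integralC /fourier_of /hartley1; congr Complex; rewrite ip_.
- rewrite -(RintegralD measurableT i1 i2) mulrC -(RintegralZl _ measurableT (integrableD measurableT i1 i2)).
  apply: eq_Rintegral => x _; rewrite /= /trunc dotNr /cas sinN cosN expR0; lra.
- rewrite -(RintegralB measurableT i2 i1) mulrC -(RintegralZl _ measurableT (integrableB measurableT i2 i1)).
  apply: eq_Rintegral => x _; rewrite /= /trunc dotNr /cas !sinN !cosN expR0; lra.
Qed.

Lemma Ltwo_reflect h : h \in Ltwo -> (fun xi => h (- xi)) \in Ltwo.
Proof. exact: (@Ltwo_preserving _ E2 R mu _ measurable_oppE2 leb2N). Qed.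

Lemma ae_reflect (P : R * R -> Prop) : {ae mu, forall x, P x} -> {ae mu, forall x, P (- x)}.
Proof. exact: (@ae_preserving _ E2 R mu _ measurable_oppE2 leb2N). Qed.

Lemma fourier_of_L2C h : h \in Ltwo -> L2C (fourier_of h).
Proof.
move=> lh; have lr := Ltwo_reflect lh.
have E : forall a b : R, a / b = b^-1 * a by move=> a b; rewrite mulrC.
split; rewrite /L2 /=.
- under eq_fun do rewrite E; exact: (plane_scale _ (plane_add lh lr)).
- under eq_fun do rewrite E; exact: (plane_scale _ (plane_sub lr lh)).
Qed.

Lemma normcE (z : R[i]) : Normc.normc z = Num.sqrt (complex.Re z ^+ 2 + complex.Im z ^+ 2).
Proof. by case: z. Qed.

Lemma L2C_normc g : L2C g -> (fun xi => Normc.normc (g xi)) \in Ltwo.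
Proof.
move=> [lr li]; have ms : measurable_fun [set: E2] (fun xi => Normc.normc (g xi)).
  under eq_fun do rewrite normcE.
  apply: (@measurableT_comp _ _ _ _ _ _ (@Num.sqrt R)).
    by apply: continuous_measurable_fun; exact: sqrt_continuous.
  apply: measurable_funD; apply: measurable_funX; [exact: (plane_measurable lr)|exact: (plane_measurable li)].
apply: (@LtwoP _ E2 R mu _ ms).
have E : (fun xi => (Normc.normc (g xi) ^+ 2)%:E) = (fun xi => (complex.Re (g xi) ^+ 2 + complex.Im (g xi) ^+ 2)%:E).
  by apply/funext => xi; rewrite normcE sqr_sqrtr// addr_ge0// sqr_ge0.
rewrite E; exact: (integrableD measurableT (Ltwo_sqr lr) (Ltwo_sqr li)).
Qed.

Lemma Re_le_normc (z : R[i]) : `|complex.Re z| <= Normc.normc z.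
Proof. by rewrite normcE -sqrtr_sqr ler_wsqrtr// lerDl sqr_ge0. Qed.

Lemma Im_le_normc (z : R[i]) : `|complex.Im z| <= Normc.normc z.
Proof. by rewrite normcE -sqrtr_sqr ler_wsqrtr// lerDr sqr_ge0. Qed.

Lemma cvgL2_Lnorm (u : nat -> R * R -> R) : (forall n, u n \in Ltwo) ->
  ('N[mu]_2%:E[EFin \o u n]%E @[n --> \oo] --> 0%E) <-> cvgL2 mu u (fun=> 0).
Proof.
move=> lu.
have E n : (fun x => u n x - 0) = u n by apply/funext => x; rewrite subr0.
have -> : (fun n => 'N[mu]_2%:E[EFin \o u n]%E) = (fun n => (l2 mu (u n))%:E).
  by apply/funext => n; rewrite (@Lnorm_l2 _ E2 R mu).
split.
- move=> /fine_cvgP[_ /cvgrPdist_le H] e e0; have [N _ HN] := H e e0.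
  exists N => n Nn; have := HN n Nn.
  by rewrite E /= sub0r normrN ger0_norm ?l2_ge0.
- move=> H; apply: cvg_EFin; first by near=> n.
  apply/cvgrPdist_le => e e0; have [N HN] := H e e0; exists N => // n Nn /=.
  by rewrite sub0r normrN ger0_norm ?l2_ge0//; have := HN n Nn; rewrite E.
Unshelve. all: by end_near. Qed.

Lemma fourier_of_sub h1 h2 xi : fourier_of h1 xi - fourier_of h2 xi = fourier_of (fun x => h1 x - h2 x) xi.
Proof. rewrite /fourier_of; simpc; congr Complex; lra. Qed.

(** The cross terms cancel: the squared modulus is the average of the squares of [h] at [xi] and at
    [- xi], and reflection preserves the measure. Hence convergence of Hartley transforms is
    convergence of Fourier transforms. *)
Lemma l2_normc_fourier_of h : h \in Ltwo -> l2 mu (fun xi => Normc.normc (fourier_of h xi)) = l2 mu h.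
Proof.
move=> lh; have lr := Ltwo_reflect lh; rewrite /l2; congr Num.sqrt; rewrite /ip.
have i1 := Ltwo_sqr lh; have i2 := Ltwo_sqr lr.
have e1 : \int[mu]_x (h (- x) ^+ 2) = \int[mu]_x (h x ^+ 2).
  exact: (@Rintegral_preserving _ E2 R mu _ measurable_oppE2 leb2N _ i1).
transitivity (\int[mu]_x (2^-1 * (h x ^+ 2 + h (- x) ^+ 2))).
  apply: eq_Rintegral => x _; rewrite -expr2 normcE sqr_sqrtr ?addr_ge0 ?sqr_ge0//=; by field.
rewrite (RintegralZl _ measurableT (integrableD measurableT i1 i2)).
rewrite (RintegralD measurableT i1 i2) e1.
rewrite (_ : \int[mu]_x (h x * h x) = \int[mu]_x (h x ^+ 2)); first by field.
by apply: eq_Rintegral => x _; rewrite expr2.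
Qed.

Lemma is_fourier_fourier_of f : f \in Ltwo -> is_fourier f (fourier_of (hartley f)).
Proof.
move=> lf; have [lh ch] := hartleyP lf.
split => //; first exact: fourier_of_L2C.
have ld n : (fun xi => hartley f xi - hartley1 (trunc n f) xi) \in Ltwo.
  by apply: plane_sub => //; exact: hartley1_trunc_L2.
rewrite (_ : (fun n => _) = (fun n => 'N[mu]_2%:E[EFin \o (fun xi =>
    Normc.normc (fourier_of (fun x => hartley f x - hartley1 (trunc n f) x) xi))%R]%E)); last first.
  apply/funext => n; congr ('N[mu]_2%:E[EFin \o _]%E); apply/funext => xi.
  by rewrite fourier_ballE// fourier_of_sub.
apply/cvgL2_Lnorm; first by move=> n; apply: L2C_normc; exact: fourier_of_L2C.
move=> e e0; have [N HN] := ch e e0; exists N => n Nn.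
under [X in l2 _ X]eq_fun do rewrite subr0.
by rewrite l2_normc_fourier_of// l2_distC; exact: HN.
Qed.

(** Uniqueness of L^2 limits, applied separately to real and imaginary parts, both controlled by the
    modulus. *)
Lemma is_fourier_ae f g : f \in Ltwo -> is_fourier f g ->
  {ae mu, forall xi, g xi = fourier_of (hartley f) xi}.
Proof.
move=> lf [_ [lr li]] cg; have [_ [lr' li'] cg'] := is_fourier_fourier_of lf.
have lF n : L2C (fourier_ball n f).
  rewrite (_ : fourier_ball n f = fourier_of (hartley1 (trunc n f))); last first.
    by apply/funext => xi; rewrite fourier_ballE.
  by apply: fourier_of_L2C; exact: hartley1_trunc_L2.
have key g0 : L2C g0 -> 'N[mu]_2%:E[EFin \o (fun xi => Normc.normc (g0 xi - fourier_ball n f xi)%R)]%E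
      @[n --> \oo] --> 0%E ->
    cvgL2 mu (fun n xi => complex.Re (fourier_ball n f xi)) (fun xi => complex.Re (g0 xi)) /\
    cvgL2 mu (fun n xi => complex.Im (fourier_ball n f xi)) (fun xi => complex.Im (g0 xi)).
  move=> [l0r l0i] c0.
  have ReB (a b : R[i]) : complex.Re (a - b) = complex.Re a - complex.Re b by case: a; case: b.
  have ImB (a b : R[i]) : complex.Im (a - b) = complex.Im a - complex.Im b by case: a; case: b.
  have ln n : L2C (fun xi => g0 xi - fourier_ball n f xi).
    have [r i] := lF n; split; rewrite /L2.
    - by under eq_fun do rewrite ReB; exact: (plane_sub l0r r).
    - by under eq_fun do rewrite ImB; exact: (plane_sub l0i i).
  have {}c0 := (cvgL2_Lnorm (fun n => L2C_normc (ln n))).1 c0.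
  split => e e0; have [N HN] := c0 e e0; exists N => n Nn; apply: le_trans (HN n Nn);
    under [X in _ <= l2 _ X]eq_fun do rewrite subr0; rewrite l2_distC.
  - have [r i] := ln n; apply: l2_le.
    + by under eq_fun do rewrite -ReB; exact: (plane_measurable r).
    + exact: L2C_normc (ln n).
    + by move=> x; rewrite -ReB (ger0_norm (x := Normc.normc _)) ?Re_le_normc// normcE sqrtr_ge0.
  - have [r i] := ln n; apply: l2_le.
    + by under eq_fun do rewrite -ImB; exact: (plane_measurable i).
    + exact: L2C_normc (ln n).
    + by move=> x; rewrite -ImB (ger0_norm (x := Normc.normc _)) ?Im_le_normc// normcE sqrtr_ge0.
have [r1 i1] := key _ (conj lr li) cg; have [r2 i2] := key _ (conj lr' li') cg'.
have Er := @cvgL2_unique _ E2 R mu _ _ _ (fun n => (lF n).1) lr lr' r1 r2.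
have Ei := @cvgL2_unique _ E2 R mu _ _ _ (fun n => (lF n).2) li li' i1 i2.
apply: (ae_impl2 Er Ei) => xi; case: (g xi) => a b /= -> ->.
by [].
Qed.

Lemma fourier_ae f : f \in Ltwo -> {ae mu, forall xi, fourier f xi = fourier_of (hartley f) xi}.
Proof.
move=> lf; apply: is_fourier_ae => //; rewrite /fourier.
by case: xgetP => [g _ //|/(_ (fourier_of (hartley f)))]; case; exact: is_fourier_fourier_of.
Qed.

(** The way back: an identity between Fourier transforms yields one between Hartley transforms. *)
Lemma fourier_of_inv h xi : complex.Re (fourier_of h xi) - complex.Im (fourier_of h xi) = h xi.
Proof. by rewrite /=; lra. Qed.

Variables (k : R * R -> R) (c : R).
Hypothesis mk : measurable_fun [set: E2] k.
Hypothesis k_bounded : forall xi, `|k xi| <= c.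
Hypothesis k_even : forall xi, k (- xi) = k xi.

(** The choice in [multiplier] is not vacuous: the inverse transform [h0] of [k] times the transform
    of [f] satisfies its specification. Evenness of [k] is what lets it factor out of [fourier_of],
    which mixes [xi] and [- xi]. *)
Lemma multiplierP f : f \in Ltwo -> multiplier (fun xi => (k xi)%:C)%C f \in Ltwo /\
  {ae mu, forall xi, hartley (multiplier (fun xi => (k xi)%:C)%C f) xi = k xi * hartley f xi}.
Proof.
move=> lf; have lh := hartley_L2 lf.
have lk : (fun xi => k xi * hartley f xi) \in Ltwo.
  exact: (@Ltwo_bounded_mul _ E2 R mu _ _ _ mk k_bounded lh).
pose h0 x := ((2 * pi) ^+ 2)^-1 * hartley (fun xi => k xi * hartley f xi) x.
have lh0 : h0 \in Ltwo by apply: plane_scale; exact: hartley_L2.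
have pp : (2 * pi) ^+ 2 != 0 :> R by rewrite expf_neq0// mulf_neq0// gt_eqF// pi_gt0.
have Hh0 : {ae mu, forall xi, hartley h0 xi = k xi * hartley f xi}.
  apply: (ae_impl2 (hartley_scale ((2 * pi) ^+ 2)^-1 (hartley_L2 lk)) (hartleyK lk)) => xi -> ->.
  by rewrite mulKf.
have kM (a b : R * R -> R) xi : a xi = k xi * b xi -> a (- xi) = k (- xi) * b (- xi) ->
    fourier_of a xi = ((k xi)%:C)%C * fourier_of b xi.
  rewrite k_even => e1 e2; rewrite /fourier_of e1 e2; simpc; congr Complex; lra.
have mP : L2 (multiplier (fun xi => (k xi)%:C)%C f) /\ {ae mu, forall xi,
    fourier (multiplier (fun xi => (k xi)%:C)%C f) xi = ((k xi)%:C)%C * fourier f xi}.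
  rewrite /multiplier; case: xgetP => [m _ //|/(_ h0)]; case; split => //.
  apply: (ae_impl3 (fourier_ae lf) (fourier_ae lh0) (ae_impl2 Hh0 (ae_reflect Hh0) (fun x p q => conj p q))).
  by move=> xi -> -> [e1 e2]; exact: kM.
have [lm em] := mP; split => //.
apply: (ae_impl3 em (fourier_ae lf) (fourier_ae lm)) => xi e1 e2 e3.
rewrite -[LHS]fourier_of_inv -e3 e1 e2; rewrite /fourier_of; simpc => /=; lra.
Qed.

End Fourier.

(** * Test functions *)

Section Taylor.
Context {R : realType}.
Implicit Types (u v w : R -> R) (a b C : R).

Lemma mean_value_le u v a b C : (forall x : R, is_derive x 1 u (v x)) ->
  (forall x, Num.min a b <= x <= Num.max a b -> `|v x| <= C) -> `|u b - u a| <= C * `|b - a|.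
Proof.
move=> uv; wlog ab : a b / a <= b => [H|] vC.
  have [/H|/ltW /H h] := leP a b; first exact.
  by rewrite distrC (distrC b); apply: h => x; rewrite minC maxC; exact: vC.
have [|c cab ->] := MVT_segment ab (fun x _ => uv x).
  by apply: continuous_subspaceT; exact: (continuous_derive uv).
by rewrite normrM ler_wpM2r// vC// min_l// max_r// -(itvP cab) (itvP cab).
Qed.

(** Two nested mean value estimates, which is why the constant is [C] and not [C / 2]. *)
Lemma taylor2 u v w a b C : (forall x : R, is_derive x 1 u (v x)) ->
  (forall x : R, is_derive x 1 v (w x)) ->
  (forall x, Num.min a b <= x <= Num.max a b -> `|w x| <= C) ->
  `|u b - u a - (b - a) * v a| <= C * (b - a) ^+ 2.
Proof.
move=> uv vw wC.
have E : u b - u a - (b - a) * v a = (u b - v a * b) - (u a - v a * a) by ring.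
rewrite E -real_normK ?num_real// expr2 mulrA.
apply: (@mean_value_le (fun x => u x - v a * x) (fun x => v x - v a)) => x.
  by apply: is_derive_sub; exact: is_derive_linear.
move=> xab; have C0 : 0 <= C by apply: (le_trans (normr_ge0 _) (wC x xab)).
apply: (@le_trans _ _ (C * `|x - a|)).
  apply: (mean_value_le vw) => y yax; apply: wC.
  move: xab yax; rewrite !ge_min !le_max; lra.
rewrite ler_wpM2l//; move: xab; rewrite ge_min le_max.
rewrite ler_norml; case: (ger0P (b - a)) => h; lra.
Qed.

End Taylor.

(** * Borel measurability of continuous functions of two variables *)

Section ContinuousPlane.
Context {R : realType}.
Implicit Types (x y : R * R) (f : R * R -> R).
Local Notation E2 := (measurableTypeR R * measurableTypeR R)%type.

Lemma open_measurable_plane (A : set (R * R)) : open A -> measurable (A : set E2).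
Proof.
move=> oA.
pose d (n : nat) : R := n.+1%:R^-1.
pose B (p q : rat) (n : nat) : set E2 :=
  [set` `]ratr p - d n, ratr p + d n[] `*` [set` `]ratr q - d n, ratr q + d n[].
have -> : A = \bigcup_(p : rat) \bigcup_(q : rat) \bigcup_(n : nat)
    (if pselect (B p q n `<=` A) then B p q n else set0).
  apply/seteqP; split => x.
  - move=> Ax; have /nbhs_ballP[e /= e0 eA] : nbhs x A by exact: open_nbhs_nbhs.
    pose n := Num.bound (2 / e).
    have n0 : 0 < d n by rewrite /d.
    (* A point of the box is within [d n] of its rational centre, which is within [d n] of [x]. *)
    have ne : d n * 2 < e.
      rewrite /d mulrC ltr_pdivrMr// mulrC -ltr_pdivrMr//.
      apply: (lt_le_trans (le_lt_trans (ler_norm _) (archi_boundP (normr_ge0 _)))).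
      by rewrite ler_nat /n ger0_norm ?divr_ge0// ltW.
    have [p pin] : exists q : rat, ratr q \in `]x.1 - d n, x.1 + d n[.
      by apply: rat_in_itvoo; lra.
    have [q qin] : exists q : rat, ratr q \in `]x.2 - d n, x.2 + d n[.
      by apply: rat_in_itvoo; lra.
    move: pin qin; rewrite !in_itv/= => /andP[p1 p2] /andP[q1 q2].
    exists p => //; exists q => //; exists n => //.
    case: pselect => [?|]/=; first by split; rewrite /= in_itv/=; apply/andP; split; lra.
    case=> y [/=]; rewrite !in_itv/= => /andP[y1 y2] /andP[z1 z2]; apply: eA.
    by split; rewrite /ball/= ltr_norml; apply/andP; split; lra.
  - by move=> [p _ [q _ [n _]]]; case: pselect => // h; exact: h.
apply: bigcupT_measurable_rat => p; apply: bigcupT_measurable_rat => q.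
apply: bigcupT_measurable => n; case: pselect => [?|?] //=.
by apply: measurableX; exact: measurable_itv.
Qed.

Lemma continuous_measurable_plane f : continuous f -> measurable_fun [set: E2] f.
Proof.
move=> /continuousP cf mD; apply: (measurability _ (RGenOpens.measurableE R)) => //.
move=> _ [_ [a [b ->] <-]]; rewrite setTI; apply: open_measurable_plane.
exact/cf/interval_open.
Qed.

End ContinuousPlane.

Section DerivativeFromTaylor.
Context {R : realType}.

(** A quadratic remainder gives the derivative together with its value. This is how convolutions,
    and bumps at the edge of their support, are differentiated. *)
Lemma derive_of_taylor (V : normedModType R) (F : V -> R) (x v : V) (D K : R) :
  (forall h, `|F (x + h *: v) - F x - h * D| <= K * h ^+ 2) ->
  derivable F x v /\ 'D_v F x = D.
Proof.
move=> H.
have c : h^-1 *: (F (h *: v + x) - F x) @[h --> (0 : R)^'] --> D.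
  apply/cvgrPdist_le => e e0; near=> h.
  have h0 : h != 0 by near: h; exact: nbhs_dnbhs_neq.
  have -> : D - h^-1 *: (F (h *: v + x) - F x) = - (h^-1 * (F (x + h *: v) - F x - h * D)).
    by rewrite [h *: v + x]addrC mulrBr mulKf// opprB.
  rewrite normrN normrM normfV mulrC ler_pdivrMr ?normr_gt0//.
  apply: (le_trans (H h)); rewrite -(real_normK (num_real h)) expr2 mulrA ler_wpM2r//.
  apply: (@le_trans _ _ (`|K| * `|h|)); first by rewrite ler_wpM2r// ler_norm.
  have K0 : 0 < `|K| + 1 by rewrite ltr_wpDl.
  apply: (@le_trans _ _ ((`|K| + 1) * `|h|)); first by rewrite ler_wpM2r// lerDl.
  rewrite mulrC -ler_pdivlMr//; near: h.
  apply: dnbhs0_le; exact: divr_gt0.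
split; first by apply/cvg_ex; exists D.
exact: (cvg_lim _ c).
Unshelve. all: by end_near. Qed.

End DerivativeFromTaylor.

(** * Calculus of test functions and the transform of a derivative *)

Section TestFunctions.
Context {R : realType}.
Implicit Types (x y z v xi : R * R) (f phi psi : R * R -> R) (b : bool) (h t : R).
Local Notation leb := (@lebesgue_measure R).
Local Notation E2 := (measurableTypeR R * measurableTypeR R)%type.
Local Notation mu := (@leb2 R).
Local Notation L1 f := (mu.-integrable setT (EFin \o f)).
Local Notation Ltwo := (Lfun mu 2%:E).

Definition axis b : R * R := if b then (0, 1) else (1, 0).
Definition coord b x : R := if b then x.2 else x.1.
Definition dd b : (R * R -> R) -> R * R -> R := if b then d2 else d1.

Lemma ddE b phi x : dd b phi x = 'D_(axis b) phi x.
Proof. by case: b. Qed.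

Lemma axis_norm b : `|axis b| = 1.
Proof. by rewrite prod_normE; case: b => /=; rewrite normr0 normr1; [rewrite max_r|rewrite max_l]. Qed.

Lemma test_derivable phi b x : test_function phi -> derivable phi x (axis b).
Proof. by move=> [H _]; have [_ h1 h2] := H [::]; case: b; [exact: h2|exact: h1]. Qed.

Lemma test_continuous phi : test_function phi -> continuous phi.
Proof. by move=> [H _]; have [] := H [::]. Qed.

Lemma test_support phi : test_function phi ->
  exists2 M : R, 0 <= M & forall x, M < `|x| -> phi x = 0.
Proof.
move=> [_ [M HM]]; exists (Num.max 0 M); first by rewrite le_max lexx.
by move=> x; rewrite gt_max => /andP[_ /HM].
Qed.

Lemma test_dd phi b : test_function phi -> test_function (dd b phi).
Proof.
move=> tp; have [M M0 HM] := test_support tp; have [H _] := tp; split.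
  (* [dseq] is a right fold, so the derivative applied first is the last entry of the sequence. *)
  move=> s; have -> : dseq s (dd b phi) = dseq (rcons s b) phi.
    by rewrite /dseq foldr_rcons; case: b.
  exact: H.
exists M => x Mx; rewrite ddE (@near_eq_derive _ _ _ phi (cst 0)) ?derive_cst//.
have : nbhs x [set y | M < `|y|].
  apply: open_nbhs_nbhs; split => //.
  exact: (open_comp (fun y _ => @norm_continuous _ _ y) (@open_gt _ M)).
by apply: filterS => y /HM.
Qed.

Lemma test_dseq phi s : test_function phi -> test_function (dseq s phi).
Proof. by move=> tp; elim: s => //= b s IH; exact: (test_dd b). Qed.

Lemma dseq_comb (p q : R) phi psi s : test_function phi -> test_function psi ->
  dseq s (fun x => p * phi x + q * psi x) = (fun x => p * dseq s phi x + q * dseq s psi x).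
Proof.
move=> tp tq; elim: s => //= b s ->; apply/funext => x.
have dp := @test_derivable _ b x (test_dseq s tp); have dq := @test_derivable _ b x (test_dseq s tq).
rewrite -/(dd b) !ddE.
have dp' : derivable (p \*: dseq s phi) x (axis b) by exact: derivableZ.
have dq' : derivable (q \*: dseq s psi) x (axis b) by exact: derivableZ.
by have := deriveD dp' dq'; rewrite (deriveZ p dp) (deriveZ q dq).
Qed.

Lemma test_comb (p q : R) phi psi : test_function phi -> test_function psi ->
  test_function (fun x => p * phi x + q * psi x).
Proof.
move=> tp tq; split.
  move=> s; rewrite dseq_comb//; have ts := test_dseq s tp; have ts' := test_dseq s tq.
  have D b x : derivable (fun x => p * dseq s phi x + q * dseq s psi x) x (axis b).
    have dp : derivable (p \*: dseq s phi) x (axis b) by apply: derivableZ; exact: test_derivable.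
    have dq : derivable (q \*: dseq s psi) x (axis b) by apply: derivableZ; exact: test_derivable.
    exact: (derivableD dp dq).
  split; [|exact: (D false)|exact: (D true)].
  by move=> x; apply: cvgD; apply: cvgM; (try exact: cvg_cst);
    [exact: (test_continuous ts)|exact: (test_continuous ts')].
have [M _ HM] := test_support tp; have [N _ HN] := test_support tq.
by exists (Num.max M N) => x; rewrite gt_max => /andP[/HM -> /HN ->]; rewrite !mulr0 addr0.
Qed.

Lemma is_derive_axis phi b x t : (forall x, derivable phi x (axis b)) ->
  is_derive t 1 (fun t => phi (x + t *: axis b)) (dd b phi (x + t *: axis b)).
Proof.
move=> dphi; have E : (fun h : R => h^-1 *: (phi (x + (h *: 1 + t) *: axis b) - phi (x + t *: axis b))) =
    (fun h => h^-1 *: (phi (h *: axis b + (x + t *: axis b)) - phi (x + t *: axis b))).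
  apply/funext => h; congr (_ *: (phi _ - _)).
  by rewrite scalerDl addrCA -[h *: 1]/(h * 1) mulr1.
apply: DeriveDef.
  have := dphi (x + t *: axis b); rewrite /derivable.
  rewrite -[X in cvg (X @ _)]E. exact.
by rewrite ddE /derive E.
Qed.

Lemma test_bounded phi : test_function phi -> exists2 C : R, 0 <= C & forall x, `|phi x| <= C.
Proof.
move=> tp; have [M M0 HM] := test_support tp.
have cK : compact ([set` `[(- M), M]] `*` [set` `[(- M), M]] : set (R * R)).
  by apply: compact_setX; exact: segment_compact.
have := compact_bounded (continuous_compact (continuous_subspaceT (test_continuous tp)) cK).
move=> [C [_ HC]]; exists (Num.max 0 (C + 1)); first by rewrite le_max lexx.
move=> x; rewrite le_max; have [xM|/HM ->] := leP `|x| M; last by rewrite normr0 lexx.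
apply/orP; right; apply: (HC (C + 1)); first by rewrite ltrDl.
exists x => //; move: xM.
by rewrite prod_normE ge_max !ler_norml => /andP[h1 h2]; split; rewrite /= in_itv.
Qed.

Lemma box_in (r : R) x : `|x| < r -> box (- r) r (- r) r x = 1.
Proof.
rewrite prod_normE gt_max !ltr_norml => /andP[/andP[a1 a2] /andP[a3 a4]].
by rewrite /box !indicE !mem_set ?mulr1//= in_itv/=; apply/andP; split => //; exact: ltW.
Qed.

Lemma test_L2 phi : test_function phi -> phi \in Ltwo.
Proof.
move=> tp; have [M M0 HM] := test_support tp; have [C C0 HC] := test_bounded tp.
apply: (@Ltwo_le _ E2 R mu _ (fun x => C * box (- (M + 1)) (M + 1) (- (M + 1)) (M + 1) x)).
- exact: continuous_measurable_plane (test_continuous tp).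
- exact: (plane_scale _ (box_L2 _ _ _ _)).
- move=> x; have [xM|/HM ->] := leP `|x| M; last by rewrite normr0.
  by rewrite box_in ?mulr1 ?(ger0_norm C0)//; lra.
Qed.

Lemma test_L1 phi : test_function phi -> L1 phi.
Proof.
move=> tp; have [M M0 HM] := test_support tp.
have := Ltwo_mul (test_L2 tp) (box_L2 (- (M + 1)) (M + 1) (- (M + 1)) (M + 1)).
congr (integrable _ _ _); apply/funext => x /=; have [xM|/HM ->] := leP `|x| M; last by rewrite mul0r.
by rewrite box_in ?mulr1//; lra.
Qed.

Lemma test_lip_axis phi b : test_function phi ->
  exists2 C : R, 0 <= C & forall x h, `|phi (x + h *: axis b) - phi x| <= C * `|h|.
Proof.
move=> tp; have [C C0 HC] := test_bounded (test_dd b tp); exists C => // x h.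
have := @mean_value_le R (fun t => phi (x + t *: axis b)) (fun t => dd b phi (x + t *: axis b)) 0 h C.
rewrite scale0r addr0 subr0; apply => [t|t _]; last exact: HC.
by apply: is_derive_axis => y; exact: test_derivable.
Qed.

Lemma test_taylor phi b : test_function phi -> exists2 C : R, 0 <= C &
  forall x h, `|phi (x + h *: axis b) - phi x - h * dd b phi x| <= C * h ^+ 2.
Proof.
move=> tp; have [C C0 HC] := test_bounded (test_dd b (test_dd b tp)); exists C => // x h.
have := @taylor2 R (fun t => phi (x + t *: axis b)) (fun t => dd b phi (x + t *: axis b))
  (fun t => dd b (dd b phi) (x + t *: axis b)) 0 h C.
rewrite scale0r addr0 subr0; apply => [t|t|t _]; last exact: HC.
- by apply: is_derive_axis => y; exact: test_derivable.
- by apply: is_derive_axis => y; apply: test_derivable; exact: test_dd.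
Qed.

Lemma plane_axis x y : x = y + (x.1 - y.1) *: axis false + (x.2 - y.2) *: axis true.
Proof.
rewrite /axis; case: x => x1 x2; case: y => y1 y2; congr pair => /=;
  rewrite /GRing.scale/= ?mulr0 ?mulr1 ?addr0; ring.
Qed.

(** Only derivatives along the axes are at hand, so the increment is taken along a path with one
    segment parallel to each axis. *)
Lemma test_lip phi : test_function phi ->
  exists2 C : R, 0 <= C & forall x y, `|phi x - phi y| <= C * `|x - y|.
Proof.
move=> tp; have [C C0 HC] := test_lip_axis false tp; have [D D0 HD] := test_lip_axis true tp.
exists (C + D); first exact: addr_ge0.
move=> x y; set z := y + (x.1 - y.1) *: axis false.
have -> : phi x - phi y = (phi (z + (x.2 - y.2) *: axis true) - phi z) +
    (phi (y + (x.1 - y.1) *: axis false) - phi y).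
  by rewrite -plane_axis addrA subrK.
apply: (le_trans (ler_normD _ _)); rewrite addrC mulrDl.
have n1 : `|x.1 - y.1| <= `|x - y| by rewrite prod_normE le_max lexx.
have n2 : `|x.2 - y.2| <= `|x - y| by rewrite prod_normE le_max lexx orbT.
by apply: lerD; [apply: (le_trans (HC _ _))|apply: (le_trans (HD _ _))]; rewrite ler_wpM2l.
Qed.

Lemma Rintegral_le_bound (f g : R * R -> R) : L1 f -> L1 g ->
  (forall x, `|f x| <= g x) -> `|\int[mu]_x f x| <= \int[mu]_x g x.
Proof.
move=> lf lg fg; apply: (le_trans (le_normr_Rintegral measurableT lf)).
by apply: (le_Rintegral measurableT (integrable_norm lf) lg) => x _; exact: fg.
Qed.

(** Division by [h] followed by [h] tending to 0; it identifies first-order coefficients of two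
    expansions without handling limits. *)
Lemma le0_of_quad (X K : R) : (forall h, 0 < h <= 1 -> h * X <= K * h ^+ 2) -> X <= 0.
Proof.
move=> H; apply/ler_addgt0Pl => e e0; rewrite addr0.
have K0 : 0 < `|K| + 1 by rewrite ltr_wpDl.
pose h := Num.min 1 (e / (`|K| + 1)).
have h0 : 0 < h by rewrite lt_min ltr01 divr_gt0.
have := H h; rewrite h0 ge_min lexx/= => /(_ isT).
rewrite expr2 mulrA mulrC ler_pM2r// => /le_trans; apply.
have h1 : h <= e / (`|K| + 1) by rewrite ge_min lexx orbT.
apply: (@le_trans _ _ ((`|K| + 1) * h)); first by rewrite ler_wpM2r ?(ltW h0)// (le_trans (ler_norm K))// lerDl.
by rewrite mulrC -ler_pdivlMr.
Qed.

Lemma is_derive_cas t : is_derive t 1 (@cas R) (cas (- t)).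
Proof.
have -> : cas (- t) = - sin t + cos t by rewrite /cas cosN sinN addrC.
by rewrite /cas; apply: is_derive_add.
Qed.

Lemma is_derive_casN t : is_derive t 1 (fun t => @cas R (- t)) (- cas t).
Proof.
have -> : (fun t => @cas R (- t)) = (fun t => cos t - sin t).
  by apply/funext => s; rewrite /cas cosN sinN.
have -> : - cas t = - sin t - cos t by rewrite /cas opprD addrC.
by apply: is_derive_sub.
Qed.

Lemma cas_taylor s t : `|@cas R (s + t) - cas s - t * cas (- s)| <= 2 * t ^+ 2.
Proof.
have := @taylor2 R (@cas R) (fun t => cas (- t)) (fun t => - cas t) s (s + t) 2
  is_derive_cas is_derive_casN.
rewrite (addrC s) addrK; apply => y _; rewrite normrN; exact: cas_le2.
Qed.

Lemma dotDl x y xi : dot (x + y) xi = dot x xi + dot y xi.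
Proof. by rewrite /dot /=; ring. Qed.

Lemma dot_axis b h xi : dot (h *: axis b) xi = h * coord b xi.
Proof. by rewrite /dot /axis /coord; case: b => /=; rewrite /GRing.scale/= ?mulr0 ?mulr1 ?mul0r ?add0r ?addr0. Qed.

Lemma L1_shift f v : L1 f -> L1 (fun x => f (x + v)).
Proof. exact: (@integrable_preserving _ E2 R mu _ (measurable_shiftE2 v) (leb2_shift v)). Qed.

Lemma Rintegral_shift f v : L1 f -> \int[mu]_x f (x + v) = \int[mu]_x f x.
Proof. exact: (@Rintegral_preserving _ E2 R mu _ (measurable_shiftE2 v) (leb2_shift v)). Qed.

(** Integration by parts in difference form. The integral [A h] of the shifted [phi] against [cas]
    is expanded to first order in [h] in two ways, on [phi] itself and, after a change of variable,
    on [cas]; the linear terms must agree. *)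
Lemma hartley1_dd phi b xi : test_function phi ->
  hartley1 (dd b phi) xi = - coord b xi * hartley1 phi (- xi).
Proof.
move=> tp; have l1 := test_L1 tp; have l1' := test_L1 (test_dd b tp).
have [C C0 HC] := test_taylor b tp; have [M M0 HM] := test_support tp.
have [N N0 HN] := test_support (test_dd b tp).
(* Large enough to contain the supports of [phi], of its shifts by at most 1, and of its derivative,
   so that the pointwise remainder is supported in the box. *)
pose r := M + N + 2; pose B := box (- r) r (- r) r.
set p := coord b xi.
pose A h := \int[mu]_x (phi (x + h *: axis b) * cas (dot x xi)).
have lA h : L1 (fun x => phi (x + h *: axis b) * cas (dot x xi)).
  exact: integrable_hartley1 (L1_shift _ l1).
have i0 := integrable_hartley1 xi l1; have i1 := integrable_hartley1 xi l1'.
have i2 := integrable_hartley1 (- xi) l1.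
have A0 : hartley1 phi xi = A 0.
  by apply: eq_Rintegral => x _; rewrite scale0r addr0.
(* Expansion of [phi]; the factor 2 bounds [cas]. *)
have e1 h : 0 < h <= 1 -> `|A h - A 0 - h * hartley1 (dd b phi) xi| <= 2 * C * (\int[mu]_x B x) * h ^+ 2.
  move=> /andP[h0 h1]; have i3 := integrableZl measurableT h i1.
  rewrite -A0 /A /hartley1 -(RintegralZl h measurableT i1) -(RintegralB measurableT (lA h) i0).
  rewrite -(RintegralB measurableT (integrableB measurableT (lA h) i0) i3).
  rewrite mulrAC -(RintegralZl _ measurableT (box_L1 _ _ _ _)).
  apply: Rintegral_le_bound.
  - exact: (integrableB measurableT (integrableB measurableT (lA h) i0) i3).
  - exact: (integrableZl measurableT _ (box_L1 _ _ _ _)).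
  - move=> x; rewrite /=.
    have -> : phi (x + h *: axis b) * cas (dot x xi) - phi x * cas (dot x xi) - h * (dd b phi x * cas (dot x xi)) =
      (phi (x + h *: axis b) - phi x - h * dd b phi x) * cas (dot x xi) by ring.
    have [xr|rx] := ltP `|x| r.
      rewrite /B box_in// mulr1 normrM (_ : 2 * C * h ^+ 2 = (C * h ^+ 2) * 2); last by ring.
      by apply: ler_pM => //; exact: cas_le2.
    have n1 : `|h *: axis b| <= 1 by rewrite normrZ axis_norm mulr1 ger0_norm// ltW.
    have n2 : `|x| <= `|x + h *: axis b| + `|h *: axis b|.
      by apply: (le_trans _ (ler_normB _ _)); rewrite addrK.
    rewrite !HM ?HN ?mulr0 ?subr0 ?mul0r ?normr0; rewrite ?/r in rx *; try lra.
    rewrite -/r -/B; apply: mulr_ge0; first by rewrite mulr_ge0 ?sqr_ge0// mulr_ge0.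
    by rewrite /B /box !indicE; exact: mulr_ge0.
(* Expansion of [cas] after translating by [h] along the axis, which shifts its argument by
   [- (h * p)]. *)
have e2 h : `|A h - A 0 + h * (p * hartley1 phi (- xi))| <= 2 * p ^+ 2 * (\int[mu]_x `|phi x|) * h ^+ 2.
  have lc : L1 (fun x => phi x * cas (dot x xi - h * p)).
    apply: (bounded_integrableM (c := 2) l1) => [|x]; last exact: cas_le2.
    apply: (measurableT_comp (f := @cas R)); first exact: measurable_cas.
    by apply: measurable_funB => //; exact: measurable_dotr.
  have -> : A h = \int[mu]_x (phi x * cas (dot x xi - h * p)).
    rewrite -(Rintegral_shift (h *: axis b) lc); apply: eq_Rintegral => x _.
    by rewrite dotDl dot_axis addrK.
  have i3 := integrableZl measurableT (h * p) i2.
  rewrite -A0 mulrA /hartley1 -(RintegralZl (h * p) measurableT i2) -(RintegralB measurableT lc i0).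
  rewrite -(RintegralD measurableT (integrableB measurableT lc i0) i3).
  rewrite mulrAC -(RintegralZl _ measurableT (integrable_norm l1)).
  apply: Rintegral_le_bound.
  - exact: (integrableD measurableT (integrableB measurableT lc i0) i3).
  - exact: (integrableZl measurableT _ (integrable_norm l1)).
  - move=> x; rewrite /= dotNr.
    have -> : phi x * cas (dot x xi - h * p) - phi x * cas (dot x xi) + h * p * (phi x * cas (- dot x xi)) =
      phi x * (cas (dot x xi + - (h * p)) - cas (dot x xi) - (- (h * p)) * cas (- dot x xi)) by ring.
    rewrite normrM mulrC; apply: ler_wpM2r => //.
    by apply: (le_trans (cas_taylor _ _)); rewrite le_eqVlt; apply/orP; left; apply/eqP; ring.
apply/eqP; rewrite mulNr -subr_eq0 opprK -normr_le0.
apply: (@le0_of_quad _ (2 * C * (\int[mu]_x B x) + 2 * p ^+ 2 * (\int[mu]_x `|phi x|))) => h h01.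
have h0 : 0 < h by case/andP: h01.
rewrite -{1}(gtr0_norm h0) -normrM mulrDl.
have -> : h * (hartley1 (dd b phi) xi + p * hartley1 phi (- xi)) =
  (A h - A 0 + h * (p * hartley1 phi (- xi))) - (A h - A 0 - h * hartley1 (dd b phi) xi) by ring.
by rewrite [leRHS]addrC; apply: (le_trans (ler_normB _ _)); apply: lerD; [exact: e2|exact: e1].
Qed.

End TestFunctions.

(** * Convolution of a test function with an integrable function of bounded support *)

Section Convolution.
Context {R : realType}.
Implicit Types (x y z v xi : R * R) (phi psi : R * R -> R) (b : bool) (h t : R).
Local Notation leb := (@lebesgue_measure R).
Local Notation E2 := (measurableTypeR R * measurableTypeR R)%type.
Local Notation mu := (@leb2 R).
Local Notation L1 f := (mu.-integrable setT (EFin \o f)).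
Local Notation Ltwo := (Lfun mu 2%:E).

Definition conv phi (f : R * R -> R) x : R := \int[mu]_z (f z * phi (x - z)).

Variables (f : R * R -> R) (r : R).
Hypothesis f_L1 : L1 f.
Hypothesis f_supp : forall x, r < `|x| -> f x = 0.

Lemma measurable_conv_kernel phi x : test_function phi ->
  measurable_fun [set: E2] (fun z : E2 => phi (x - z)).
Proof.
move=> tp; apply: continuous_measurable_plane => z.
apply: (continuous_comp (f := fun z => x - z) (g := phi)).
  by apply: continuousB; [exact: cst_continuous|exact: cvg_id].
exact: test_continuous.
Qed.

Lemma conv_L1 phi x : test_function phi -> L1 (fun z => f z * phi (x - z)).
Proof.
move=> tp; have [C C0 HC] := test_bounded tp.
by apply: (bounded_integrableM (c := C) f_L1) => //; exact: measurable_conv_kernel.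
Qed.

(** The Taylor remainder of [phi] is uniform in the point, so it integrates against |f|; derivatives
    therefore fall on [phi] alone. *)
Lemma conv_taylor phi b : test_function phi -> exists2 C : R, 0 <= C & forall x h,
  `|conv phi f (x + h *: axis b) - conv phi f x - h * conv (dd b phi) f x| <= C * h ^+ 2.
Proof.
move=> tp; have [C C0 HC] := test_taylor b tp; have nf := integrable_norm f_L1.
exists (C * \int[mu]_z `|f z|).
  by apply: mulr_ge0 => //; apply: Rintegral_ge0 => z _.
move=> x h; have i1 := conv_L1 (x + h *: axis b) tp; have i2 := conv_L1 x tp.
have i3 := conv_L1 x (test_dd b tp); have i4 := integrableZl measurableT h i3.
rewrite /conv -(RintegralZl h measurableT i3) -(RintegralB measurableT i1 i2).
rewrite -(RintegralB measurableT (integrableB measurableT i1 i2) i4).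
rewrite mulrAC -(RintegralZl _ measurableT nf); apply: Rintegral_le_bound.
- exact: (integrableB measurableT (integrableB measurableT i1 i2) i4).
- exact: (integrableZl measurableT _ nf).
- move=> z /=; have -> : x + h *: axis b - z = x - z + h *: axis b by rewrite addrAC.
  rewrite (_ : _ - _ = f z * (phi (x - z + h *: axis b) - phi (x - z) - h * dd b phi (x - z))); last by ring.
  by rewrite normrM mulrC ler_wpM2r.
Qed.

Lemma conv_continuous phi : test_function phi -> continuous (conv phi f).
Proof.
move=> tp x; have [C C0 HC] := test_lip tp; have nf := integrable_norm f_L1.
set I := \int[mu]_z `|f z|.
have I0 : 0 <= I by apply: Rintegral_ge0 => z _.
have H y : `|conv phi f x - conv phi f y| <= C * I * `|x - y|.
  have i1 := conv_L1 x tp; have i2 := conv_L1 y tp.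
  rewrite /conv -(RintegralB measurableT i1 i2) mulrAC -(RintegralZl _ measurableT nf).
  apply: Rintegral_le_bound; [exact: (integrableB measurableT i1 i2)|exact: (integrableZl measurableT _ nf)|].
  move=> z /=; rewrite -mulrBr normrM mulrC ler_wpM2r//.
  by apply: (le_trans (HC _ _)); rewrite opprB addrA subrK.
apply/cvgrPdist_le => e e0.
have D0 : 0 < C * I + 1 by rewrite ltr_wpDl// mulr_ge0.
have nb : nbhs x (ball x (e / (C * I + 1))) by apply: nbhsx_ballx; exact: divr_gt0.
apply: filterS nb => y; rewrite prod_norm_ball /ball_/= => xy.
apply: (le_trans (H y)).
apply: (@le_trans _ _ ((C * I + 1) * `|x - y|)); first by rewrite ler_wpM2r// lerDl.
by rewrite mulrC -ler_pdivlMr// ltW.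
Qed.

Lemma conv_dd phi b : test_function phi -> dd b (conv phi f) = conv (dd b phi) f.
Proof.
move=> tp; have [C C0 HC] := conv_taylor b tp; apply/funext => x; rewrite ddE.
by have [] := derive_of_taylor (HC x).
Qed.

Lemma conv_dseq phi s : test_function phi -> dseq s (conv phi f) = conv (dseq s phi) f.
Proof.
move=> tp; elim: s => //= b s ->; rewrite -/(dd b).
by apply: conv_dd; exact: test_dseq.
Qed.

Lemma conv_test phi : test_function phi -> test_function (conv phi f).
Proof.
move=> tp; split.
  move=> s; rewrite conv_dseq//; have ts := test_dseq s tp.
  have D b x : derivable (conv (dseq s phi) f) x (axis b).
    by have [C C0 HC] := conv_taylor b ts; have [] := derive_of_taylor (HC x).
  by split; [exact: conv_continuous|exact: (D false)|exact: (D true)].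
have [M M0 HM] := test_support tp; exists (M + r) => x xMr.
rewrite /conv; under eq_Rintegral => z _.
  rewrite (_ : f z * phi (x - z) = 0); last first.
    have [zr|/f_supp ->] := leP `|z| r; last by rewrite mul0r.
    rewrite HM ?mulr0//.
    have := ler_normD (x - z) z; rewrite subrK; lra.
  over.
by rewrite Rintegral_cst// mul0r.
Qed.

Lemma hartley1_even_cos phi xi : L1 phi -> (forall x, phi (- x) = phi x) ->
  \int[mu]_x (phi x * sin (dot x xi)) = 0 /\
  \int[mu]_x (phi x * cos (dot x xi)) = hartley1 phi xi.
Proof.
move=> lp ev; have md : measurable_fun [set: E2] (fun x : E2 => dot x xi) := measurable_dotr xi.
have is_ : L1 (fun x => phi x * sin (dot x xi)).
  apply: (bounded_integrableM (c := 1) lp) => [|x]; last exact: sin_max.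
  exact: (measurableT_comp (continuous_measurable_fun (@continuous_sin R)) md).
have ic : L1 (fun x => phi x * cos (dot x xi)).
  apply: (bounded_integrableM (c := 1) lp) => [|x]; last exact: cos_max.
  exact: (measurableT_comp (continuous_measurable_fun (@continuous_cos R)) md).
have s0 : \int[mu]_x (phi x * sin (dot x xi)) = 0.
  set S := (LHS); suff : S + S = 0 by lra.
  rewrite /S -{1}(@Rintegral_preserving _ E2 R mu _ measurable_oppE2 leb2N _ is_).
  have is' : L1 (fun x => phi (- x) * sin (dot (- x) xi)).
    exact: (@integrable_preserving _ E2 R mu _ measurable_oppE2 leb2N _ is_).
  rewrite -(RintegralD measurableT is' is_).
  rewrite (_ : (fun x => _) = (fun=> 0)) ?Rintegral_cst ?mul0r//.
  apply/funext => x; rewrite ev dotC dotNr sinN dotC; ring.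
split => //; rewrite -[LHS]addr0 -{1}s0 -(RintegralD measurableT ic is_).
by apply: eq_Rintegral => x _; rewrite mulrDr.
Qed.

(** For a general [phi] the transform of a convolution would also involve reflected frequencies;
    evenness kills the sine integral and leaves a plain product. *)
Lemma hartley1_conv phi xi : test_function phi -> (forall x, phi (- x) = phi x) ->
  hartley1 (conv phi f) xi = hartley1 phi xi * hartley1 f xi.
Proof.
move=> tp ev; have lp := test_L1 tp.
have [M M0 HM] := test_support tp; have [C C0 HC] := test_bounded tp.
(* A cutoff equal to 1 wherever the convolution integrand is nonzero. It makes the outer density
   [B * cas] integrable, as the Fubini lemma asks, without changing any value. *)
pose q := M + `|r| + 1; pose B := box (- q) q (- q) q.
have lB : L1 (fun x => B x * cas (dot x xi)) by exact: integrable_hartley1 (box_L1 _ _ _ _).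
have mk : measurable_fun setT (fun w : E2 * E2 => phi (w.1 - w.2)).
  apply: (measurableT_comp (f := phi : E2 -> R)).
    exact: continuous_measurable_plane (test_continuous tp).
  apply: measurable_fun_pair => /=; apply: measurable_funB => /=.
  - exact: (measurableT_comp measurable_fst measurable_fst).
  - exact: (measurableT_comp measurable_fst measurable_snd).
  - exact: (measurableT_comp measurable_snd measurable_fst).
  - exact: (measurableT_comp measurable_snd measurable_snd).
have [cM cMr] : (forall x z, f z * phi (x - z) * (1 - B x) = 0) /\ (forall x z, f z * B x * phi (x - z) = f z * phi (x - z)).
  have key x z : B x = 1 \/ f z * phi (x - z) = 0.
    have [xq|qx] := ltP `|x| q; first by left; exact: box_in.
    right; have [zr|/f_supp ->] := leP `|z| r; last by rewrite mul0r.
    rewrite HM ?mulr0//; have := ler_normD (x - z) z; rewrite subrK.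
    have := ler_norm r; rewrite /q in qx; lra.
  split => x z; have [->|h] := key x z; rewrite ?subrr ?mulr0 ?mulr1 ?h ?mul0r//.
  by rewrite mulrAC h mul0r.
have F := @Fubini_adjoint _ _ E2 E2 R mu mu _ _ _ C lB f_L1 mk (fun w => HC _).
transitivity (\int[mu]_x (B x * cas (dot x xi) * \int[mu]_z (f z * phi (x - z)))).
  apply: eq_Rintegral => x _; rewrite -/(conv phi f x) mulrAC; congr (_ * _).
  rewrite /conv -(RintegralZl _ measurableT (conv_L1 x tp)).
  by apply: eq_Rintegral => z _; rewrite mulrA (mulrC (B x)) cMr.
rewrite F /hartley1 mulrC -(RintegralZr _ measurableT (integrable_hartley1 xi f_L1)).
apply: eq_Rintegral => z _; rewrite -mulrA.
have [f0|fz] := eqVneq (f z) 0; first by rewrite f0 !mul0r.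
congr (_ * _).
have md : measurable_fun [set: E2] (fun x : E2 => dot x xi) := measurable_dotr xi.
have is_ : L1 (fun x => phi x * sin (dot x xi)).
  apply: (bounded_integrableM (c := 1) lp) => [|x]; last exact: sin_max.
  exact: (measurableT_comp (continuous_measurable_fun (@continuous_sin R)) md).
have ic : L1 (fun x => phi x * cos (dot x xi)).
  apply: (bounded_integrableM (c := 1) lp) => [|x]; last exact: cos_max.
  exact: (measurableT_comp (continuous_measurable_fun (@continuous_cos R)) md).
have is1 := integrableZl measurableT (cas (- dot z xi)) is_.
have ic1 := integrableZl measurableT (cas (dot z xi)) ic.
have lsh : L1 (fun x => phi x * cas (dot (x + z) xi)).
  apply: (bounded_integrableM (c := 2) lp) => [|x]; last exact: cas_le2.
  apply: (measurableT_comp (f := @cas R)); first exact: measurable_cas.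
  by under eq_fun do rewrite dotDl; exact: measurable_funD.
transitivity (\int[mu]_x (phi (x - z) * cas (dot (x - z + z) xi))).
  apply: eq_Rintegral => x _; rewrite subrK.
  have h : phi (x - z) = B x * phi (x - z) by apply: (mulfI fz); rewrite mulrA cMr.
  by rewrite /= [in RHS]h; ring.
rewrite (@Rintegral_shift R (fun x => phi x * cas (dot (x + z) xi)) (- z) lsh).
(* Addition formula: cas(s + t) = cas t cos s + cas(-t) sin s. *)
transitivity (\int[mu]_x (cas (dot z xi) * (phi x * cos (dot x xi)) + cas (- dot z xi) * (phi x * sin (dot x xi)))).
  apply: eq_Rintegral => x _; rewrite dotDl /cas cosD sinD cosN sinN; ring.
have [s0 c0] := hartley1_even_cos xi lp ev.
rewrite (RintegralD measurableT ic1 is1) (RintegralZl _ measurableT ic) (RintegralZl _ measurableT is_).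
by rewrite s0 c0 mulr0 addr0.
Qed.

End Convolution.

(** * A concrete smooth bump with compact support *)

Section Bump.
Context {R : realType}.
Implicit Types (p q : {poly R}) (m n : nat) (t x y z c k : R).

(** The classical bump exp(-1/(1 - t^2)) times a polynomial over a power of 1 - t^2. The polynomial
    [p] and the exponent [m] make the family stable under differentiation, so smoothness needs one
    derivative computation only. *)
Definition bump p m t : R :=
  if `|t| < 1 then p.[t] * (1 - t ^+ 2)^-1 ^+ m * expR (- (1 - t ^+ 2)^-1) else 0.

(** Numerator of the derivative over the common denominator (1 - t^2)^(m + 2). *)
Definition dbump p m : {poly R} :=
  p^`() * (1 - 'X^2) ^+ 2 + (2 * m%:R) *: (p * 'X * (1 - 'X^2)) - 2 *: (p * 'X).

Lemma sqr_lt1 t : `|t| < 1 -> t ^+ 2 < 1.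
Proof. by move=> t1; rewrite -(real_normK (num_real t)) expr_lt1. Qed.

Lemma open_unit t : `|t| < 1 -> \forall s \near t, `|s| < 1.
Proof.
move=> t1; have : nbhs t [set s | `|s| < 1].
  apply: open_nbhs_nbhs; split => //.
  exact: (open_comp (fun y _ => @norm_continuous _ _ y) (@open_lt _ 1)).
exact.
Qed.

Lemma is_derive_bump_in p m t : `|t| < 1 ->
  is_derive t 1 (bump p m) (bump (dbump p m) m.+2 t).
Proof.
move=> t1; have t2 := sqr_lt1 t1.
have nz : 1 - t ^+ 2 != 0 by rewrite subr_eq0 gt_eqF.
pose Y s : R := (1 - s ^+ 2)^-1.
have dY : is_derive t 1 Y (2 * t * Y t ^+ 2).
  have d2 : is_derive t 1 (fun s : R => 1 - s * s) (0 - (1 * t + t * 1)).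
    by apply: is_derive_sub; apply: is_derive_mul.
  have := @is_deriveV R (fun s => 1 - s * s) t _ 1 _ d2; rewrite /= -expr2 => /(_ nz).
  rewrite /Y; under eq_fun do rewrite -expr2.
  suff -> : 2 * t * (1 - t ^+ 2)^-1 ^+ 2 = (- (1 - t ^+ 2) ^- 2) *: (0 - (1 * t + t * 1)) by [].
  rewrite /GRing.scale/=; by field.
have dYm : is_derive t 1 (fun s => Y s ^+ m) (m%:R * Y t ^+ m.-1 * (2 * t * Y t ^+ 2)).
  by have := is_deriveX m dY; rewrite exprfctE.
have dE : is_derive t 1 (fun s => expR (- Y s)) (expR (- Y t) * - (2 * t * Y t ^+ 2)).
  by apply: (is_derive_comp (f := expR) (g := fun s => - Y s)); apply: is_derive_opp.
have dp := is_derive_poly p t.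
have D := is_derive_mul (is_derive_mul dp dYm) dE.
apply: (@near_eq_is_derive _ _ _ (fun s => p.[s] * Y s ^+ m * expR (- Y s))).
  by near=> s; rewrite /bump ifT//; near: s; exact: open_unit.
suff -> : bump (dbump p m) m.+2 t = (p^`().[t] * Y t ^+ m + p.[t] * (m%:R * Y t ^+ m.-1 * (2 * t * Y t ^+ 2))) *
   expR (- Y t) + p.[t] * Y t ^+ m * (expR (- Y t) * - (2 * t * Y t ^+ 2)) by [].
rewrite /bump t1 /dbump -/(Y t).
have eY : m%:R * Y t ^+ m.-1 * (2 * t * Y t ^+ 2) = m%:R * (2 * t * (Y t ^+ m * Y t)).
  move: (Y t) => w; clear; case: m => [|n /=]; first by rewrite !mul0r.
  by rewrite (exprS w n); ring.
have Y0 : Y t != 0 by rewrite /Y invr_eq0.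
have YK : 1 - t ^+ 2 = (Y t)^-1 by rewrite /Y invrK.
have -> : (p^`() * (1 - 'X^2) ^+ 2 + (2 * m%:R) *: (p * 'X * (1 - 'X^2)) - 2 *: (p * 'X)).[t] =
    p^`().[t] * (1 - t ^+ 2) ^+ 2 + 2 * m%:R * (p.[t] * t * (1 - t ^+ 2)) - 2 * (p.[t] * t).
  by rewrite !hornerE; ring.
rewrite eY YK -(addn2 m) exprD.
move: (Y t) Y0 => w w0; move: (w ^+ m) (p^`().[t]) p.[t] (expR (- w)) => a b d e.
by field.
Unshelve. all: by end_near. Qed.

(** With w = 1 - s^2, the term of order m + 2 of the exponential series gives w^-m exp(-1/w) <= (m +
    2)! w^2, and w <= 2 |s - t| since [t] is not inside the unit interval. So the function is flat
    at and beyond the edge, where it has derivative 0. *)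
Lemma bump_quad p m t : 1 <= `|t| -> exists K, forall s, `|bump p m s| <= K * (s - t) ^+ 2.
Proof.
move=> t1.
have [P HP] : exists P, forall s, `|s| < 1 -> `|p.[s]| <= P.
  have := compact_bounded (continuous_compact (continuous_subspaceT (continuous_derive (is_derive_poly p)))
     (@segment_compact R (-1) 1)).
  move=> [C [_ HC]]; exists (C + 1) => s s1; apply: (HC (C + 1)); first by rewrite ltrDl.
  by exists s => //=; rewrite in_itv/= -ler_norml ltW.
exists (P * (m.+2)`!%:R * 4) => s; rewrite /bump; case: ifPn => s1; last first.
  have P0 : 0 <= P by apply: (le_trans (normr_ge0 p.[0])); apply: HP; rewrite normr0.
  by rewrite normr0 mulr_ge0 ?sqr_ge0// mulr_ge0// mulr_ge0.
have s2 := sqr_lt1 s1; set w := 1 - s ^+ 2.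
have w0 : 0 < w by rewrite /w subr_gt0.
have e1 : w^-1 ^+ m * expR (- w^-1) <= (m.+2)`!%:R * w ^+ 2.
  have := @expR_ge1Dxn R w^-1 m.+1; rewrite invr_ge0 ltW// => /(_ isT) h.
  have {}h : w^-1 ^+ m.+2 <= (m.+2)`!%:R * expR (w^-1).
    by rewrite mulrC -ler_pdivrMr ?ltr0n ?fact_gt0//; apply: le_trans h; rewrite lerDr.
  rewrite expRN ler_pdivrMr ?expR_gt0//.
  have -> : w^-1 ^+ m = w^-1 ^+ m.+2 * w ^+ 2.
    by rewrite -addn2 exprD -mulrA -exprMn mulVf ?gt_eqF// expr1n mulr1.
  by rewrite [leRHS]mulrAC; apply: ler_wpM2r => //; exact: sqr_ge0.
have e2 : w ^+ 2 <= 4 * (s - t) ^+ 2.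
  have h1 : w <= 2 * `|s - t|.
    have h2 : 1 - `|s| <= `|s - t|.
      by have := ler_normB s (s - t); rewrite opprB addrC subrK; lra.
    rewrite /w -(real_normK (num_real s)); move: h2 s1 (normr_ge0 s) (normr_ge0 (s - t)).
    by move: `|s| `|s - t| => a b; nra.
  have h4 := normr_ge0 (s - t); rewrite -(real_normK (num_real (s - t))).
  by move: h1 h4 (w0); move: `|s - t| => a; move: (w) => b; clear; nra.
rewrite -mulrA normrM -!mulrA; apply: ler_pM => //; first exact: HP.
rewrite ger0_norm; last by rewrite mulr_ge0 ?expR_ge0// exprn_ge0// invr_ge0 ltW.
by apply: (le_trans e1); rewrite ler_wpM2l.
Qed.

Lemma is_derive_bump p m t : is_derive t 1 (bump p m) (bump (dbump p m) m.+2 t).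
Proof.
have [t1|t1] := ltP `|t| 1; first exact: is_derive_bump_in.
have z0 q n : bump q n t = 0 by rewrite /bump ltNge t1.
have [K HK] := bump_quad p m t1.
have H h : `|bump p m (t + h *: 1) - bump p m t - h * 0| <= K * h ^+ 2.
  by rewrite z0 mulr0 !subr0; have := HK (t + h *: 1); rewrite [t + _]addrC addrK -[h *: 1]/(h * 1) mulr1.
by have [d v] := derive_of_taylor H; rewrite z0; apply: DeriveDef.
Qed.

Variable k : R.
Hypothesis k1 : 1 <= k.

(** The dilation by [k] shrinks the support to sup-norm at most 1/k; the chain-rule factor is
    absorbed in the polynomial, so this family is stable under partial derivatives too. *)
Definition tens p m q n (x : R * R) : R := bump p m (k * x.1) * bump q n (k * x.2).

Lemma is_derive_bump_scale p m t :
  is_derive t 1 (fun s => bump p m (k * s)) (bump (k *: dbump p m) m.+2 (k * t)).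
Proof.
have -> : bump (k *: dbump p m) m.+2 (k * t) = bump (dbump p m) m.+2 (k * t) * k.
  by rewrite /bump; case: ifP => _; rewrite ?hornerZ ?mul0r//; ring.
apply: (is_derive_comp (f := bump p m) (g := fun s => k * s)).
  exact: is_derive_bump.
exact: is_derive_linear.
Qed.

Lemma tens_derive p m q n b (x : R * R) : derivable (tens p m q n) x (axis b) /\
  'D_(axis b) (tens p m q n) x =
  if b then tens p m (k *: dbump q n) n.+2 x else tens (k *: dbump p m) m.+2 q n x.
Proof.
case: b.
- have U : is_derive x.2 1 (fun s => bump p m (k * x.1) * bump q n (k * s)) (tens p m (k *: dbump q n) n.+2 x).
    by apply: is_derive_constM; exact: is_derive_bump_scale.
  have E : (fun h : R => h^-1 *: (tens p m q n (h *: axis true + x) - tens p m q n x)) =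
      (fun h => h^-1 *: (bump p m (k * x.1) * bump q n (k * (h *: 1 + x.2)) - bump p m (k * x.1) * bump q n (k * x.2))).
    by apply/funext => h; congr (_ *: (_ - _)); rewrite /tens /= /GRing.scale/= mulr0 add0r.
  by case: U => dU vU; split; [move: dU; rewrite /derivable E|move: vU; rewrite /derive E].
- have U : is_derive x.1 1 (fun s => bump p m (k * s) * bump q n (k * x.2)) (tens (k *: dbump p m) m.+2 q n x).
    rewrite (_ : (fun s => _) = (fun s => bump q n (k * x.2) * bump p m (k * s))).
      by rewrite /tens [X in is_derive _ _ _ X]mulrC; apply: is_derive_constM; exact: is_derive_bump_scale.
    by apply/funext => s; rewrite mulrC.
  have E : (fun h : R => h^-1 *: (tens p m q n (h *: axis false + x) - tens p m q n x)) =
      (fun h => h^-1 *: (bump p m (k * (h *: 1 + x.1)) * bump q n (k * x.2) - bump p m (k * x.1) * bump q n (k * x.2))).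
    by apply/funext => h; congr (_ *: (_ - _)); rewrite /tens /= /GRing.scale/= mulr0 add0r.
  by case: U => dU vU; split; [move: dU; rewrite /derivable E|move: vU; rewrite /derive E].
Qed.

Lemma tens_continuous p m q n : continuous (tens p m q n).
Proof.
have cb p' m' : continuous (bump p' m') := continuous_derive (is_derive_bump p' m').
have c1 : continuous (fun x : R * R => bump p m (k * x.1)).
  move=> x; apply: (continuous_comp (f := fun x : R * R => k * x.1) (g := bump p m)); last exact: cb.
  by apply: cvgM; [exact: cvg_cst|exact: cvg_fst].
have c2 : continuous (fun x : R * R => bump q n (k * x.2)).
  move=> x; apply: (continuous_comp (f := fun x : R * R => k * x.2) (g := bump q n)); last exact: cb.
  by apply: cvgM; [exact: cvg_cst|exact: cvg_snd].
by move=> x; apply: cvgM; [exact: c1|exact: c2].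
Qed.

Lemma dseq_tens s p m q n : exists p' m' q' n', dseq s (tens p m q n) = tens p' m' q' n'.
Proof.
elim: s => [|b s [p1 [m1 [q1 [n1 IH]]]]] /=; first by exists p, m, q, n.
rewrite IH -/(dd b); case: b.
- exists p1, m1, (k *: dbump q1 n1), n1.+2; apply/funext => x; rewrite ddE.
  by have [_ ->] := tens_derive p1 m1 q1 n1 true x.
- exists (k *: dbump p1 m1), m1.+2, q1, n1; apply/funext => x; rewrite ddE.
  by have [_ ->] := tens_derive p1 m1 q1 n1 false x.
Qed.

Lemma tens_support p m q n (x : R * R) : 1 <= k * `|x| -> tens p m q n x = 0.
Proof.
have k0 : 0 < k := lt_le_trans ltr01 k1.
have H t : 1 <= k * `|t| -> forall p m, bump p m (k * t) = 0.
  by move=> h p' m'; rewrite /bump normrM (gtr0_norm k0) ltNge h.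
rewrite prod_normE /tens maxr_pMr; last exact: ltW.
by rewrite le_max => /orP[] h; rewrite (H _ h) ?mul0r ?mulr0.
Qed.

Lemma tens1_even (x : R * R) : tens 1 0 1 0 (- x) = tens 1 0 1 0 x.
Proof. by rewrite /tens /bump /= !mulrN !normrN !sqrrN !hornerE. Qed.

Lemma bump1_ge0 (t : R) : 0 <= bump 1 0 t.
Proof. by rewrite /bump; case: ifP => // _; rewrite (hornerC 1) expr0 !mul1r expR_ge0. Qed.

Lemma bump1_half (t : R) : `|t| <= 2^-1 -> expR (- 2) <= bump 1 0 t.
Proof.
move=> t2; have t1 : `|t| < 1 by apply: (le_lt_trans t2); rewrite invf_lt1// ltr1n.
rewrite /bump t1 (hornerC 1) expr0 !mul1r ler_expR lerN2.
have h : 2^-1 <= 1 - t ^+ 2.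
  by rewrite -(real_normK (num_real t)); move: t2 (normr_ge0 t); move: `|t| => a; nra.
by rewrite -[leRHS]invrK lef_pV2// posrE ?invr_gt0// (lt_le_trans _ h).
Qed.

Lemma test_tens p m q n : test_function (tens p m q n).
Proof.
split.
  move=> s; have [p' [m' [q' [n' ->]]]] := dseq_tens s p m q n.
  split; first exact: tens_continuous.
  - by move=> x; have [] := tens_derive p' m' q' n' false x.
  - by move=> x; have [] := tens_derive p' m' q' n' true x.
exists 1 => x x1; apply: tens_support; by rewrite mulr_ege1// ltW.
Qed.

End Bump.

Section BumpTransform.
Context {R : realType}.
Local Notation leb := (@lebesgue_measure R).
Local Notation E2 := (measurableTypeR R * measurableTypeR R)%type.
Local Notation mu := (@leb2 R).
Local Notation L1 f := (mu.-integrable setT (EFin \o f)).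

Lemma Rintegral_box (r : R) : 0 < r -> 0 < \int[mu]_x (box (- r) r (- r) r x).
Proof.
move=> r0; rewrite (Rintegral_prod2 (integrable_indic_itv _ _ _ _) (integrable_indic_itv _ _ _ _)).
suff -> : \int[leb]_t \1_[set` `](- r), r]] t = 2 * r :> R by rewrite mulr_gt0// mulr_gt0.
have m : leb [set` `](- r), r]] = (2 * r)%:E.
  rewrite lebesgue_measure_itv/= lte_fin ifT; last by lra.
  by rewrite -EFinD opprK mulr2n mulrDl mul1r.
by rewrite /Rintegral integral_indic// setIT [X in fine X](_ : _ = leb [set` `](- r), r]])// m.
Qed.

Lemma cas_ge (t : R) : 1 - 2 * `|t| <= cas t.
Proof.
have := @mean_value_le R (@cas R) (fun t => cas (- t)) 0 t 2 (@is_derive_cas R) (fun s _ => cas_le2 (- s)).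
rewrite subr0 [cas 0]/cas cos0 sin0 addr0 ler_norml; lra.
Qed.

(** A narrow bump has a transform close to its integral at low frequency. With k = 8 M + 1, points
    of the support satisfy |dot x xi| <= 2 M / k <= 1/4, so [cas] is at least 1/2 there. The lower
    bound of the integral comes from the box of half-side 1/(2k), where each factor is at least
    exp(-2). *)
Lemma exists_bump (M : R) : 0 <= M -> exists2 phi : R * R -> R,
  test_function phi /\ (forall x : R * R, phi (- x) = phi x) &
  exists2 c : R, 0 < c & forall xi, dot xi xi <= M ^+ 2 -> c <= hartley1 phi xi.
Proof.
move=> M0; pose k := 8 * M + 1.
have k1 : 1 <= k by rewrite /k; lra.
have k0 : 0 < k := lt_le_trans ltr01 k1.
pose phi := tens k 1 0 1 0.
have tp : test_function phi by exact: test_tens.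
have lp := test_L1 tp.
exists phi; first by split => // x; exact: tens1_even.
have phi0 x : 0 <= phi x by rewrite mulr_ge0// bump1_ge0.
pose r := (2 * k)^-1.
have r0 : 0 < r by rewrite invr_gt0 mulr_gt0.
have lb := box_L1 (- r) r (- r) r.
exists (2^-1 * (expR (- 2) ^+ 2 * \int[mu]_x (box (- r) r (- r) r x))).
  by rewrite mulr_gt0 ?invr_gt0// mulr_gt0 ?exprn_gt0 ?expR_gt0 ?Rintegral_box.
move=> xi xiM; apply: (@le_trans _ _ (2^-1 * \int[mu]_x phi x)).
  rewrite ler_wpM2l ?invr_ge0// -(RintegralZl _ measurableT lb).
  apply: (le_Rintegral measurableT (integrableZl measurableT _ lb) lp) => x _ /=.
  have [/andP[h1 h2]|h] := boolP ((`|x.1| <= r) && (`|x.2| <= r)).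
    apply: (@le_trans _ _ (expR (- 2) ^+ 2 * 1)).
      rewrite ler_wpM2l ?sqr_ge0// /box !indicE; by do 2 case: (_ \in _); rewrite ?mulr0 ?mul0r ?mulr1.
    have K t : `|t| <= r -> `|k * t| <= 2^-1.
      by rewrite normrM (gtr0_norm k0) /r invfM => h; rewrite mulrC -ler_pdivlMr.
    by rewrite mulr1 expr2; apply: ler_pM; rewrite ?expR_ge0// bump1_half// K.
  have -> : box (- r) r (- r) r x = 0; last by rewrite mulr0.
  rewrite /box !indicE; move: h; rewrite negb_and -!ltNge => /orP[] h.
    rewrite memNset ?mul0r//= in_itv/= => /andP[a b]; move: h; rewrite ltNge ler_norml b ltW//.
  rewrite (@memNset _ [set` `](- r), r]] x.2) ?mulr0//= in_itv/= => /andP[a b]; move: h; rewrite ltNge ler_norml b ltW//.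
rewrite /hartley1 -(RintegralZl _ measurableT lp).
apply: (le_Rintegral measurableT (integrableZl measurableT _ lp) (integrable_hartley1 xi lp)) => x _ /=.
have [kx|kx] := leP 1 (k * `|x|); first by rewrite [phi x]tens_support// mulr0 mul0r.
rewrite mulrC ler_wpM2l//; apply: le_trans (cas_ge _).
have xb : `|x| <= k^-1 by rewrite -[leRHS]mul1r ler_pdivlMr// mulrC ltW.
have [x1 x2] : `|x.1| <= k^-1 /\ `|x.2| <= k^-1.
  by split; apply: le_trans xb; rewrite prod_normE le_max lexx ?orbT.
have [y1 y2] : `|xi.1| <= M /\ `|xi.2| <= M.
  move: xiM; rewrite /dot => h; split; rewrite ler_norml; apply/andP; split; nra.
have H : `|dot x xi| <= k^-1 * M + k^-1 * M.
  by apply: (le_trans (ler_normD _ _)); rewrite !normrM; apply: lerD; apply: ler_pM.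
have kM : k^-1 * M <= 8^-1.
  by rewrite mulrC ler_pdivrMr// /k; lra.
lra.
Qed.

End BumpTransform.

(** * The kernels *)

Section Oscillator.
Context {R : realType}.
Implicit Types (a d s t : R).

Definition hroot d : R := Num.sqrt `|d| / 2.

(* [sn d t] and [cn d t] are sinh (r t) / r and cosh (r t) for r = sqrt d / 2,
   in real form for each sign of [d]. *)
Definition sn d t : R :=
  let s := hroot d in
  if d < 0 then sin (s * t) / s
  else if d == 0 then t else (expR (s * t) - expR (- (s * t))) / (2 * s).

Definition cn d t : R :=
  let s := hroot d in
  if d < 0 then cos (s * t)
  else if d == 0 then 1 else (expR (s * t) + expR (- (s * t))) / 2.

Lemma hroot_ge0 d : 0 <= hroot d.
Proof. by rewrite divr_ge0// sqrtr_ge0. Qed.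

Lemma hroot_neq0 d : d != 0 -> hroot d != 0.
Proof. by move=> d0; rewrite mulf_neq0// sqrtr_eq0 -ltNge normr_gt0. Qed.

Lemma hroot_sqr d : hroot d ^+ 2 = `|d| / 4.
Proof. rewrite /hroot exprMn sqr_sqrtr// exprVn; congr (_ / _); ring. Qed.

Lemma is_derive_scale (f : R -> R) s t a : is_derive (s * t) 1 f a ->
  is_derive t 1 (fun t => f (s * t)) (a * s).
Proof.
move=> df; apply: (is_derive_comp (f := f) (g := fun t => s * t)) => //.
exact: is_derive_linear.
Qed.

Lemma is_derive_expN s t : is_derive t 1 (fun t => expR (- (s * t))) (- (s * expR (- (s * t)))).
Proof.
have -> : (fun t => expR (- (s * t))) = (fun t => expR (- s * t)) by apply/funext => u; rewrite mulNr.
have := @is_derive_scale expR (- s) t _ (is_derive_expR _).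
by rewrite mulrN mulrC mulNr.
Qed.

Lemma is_derive_sn d t : is_derive t 1 (sn d) (cn d t).
Proof.
rewrite /sn /cn; set s := hroot d.
have [d0|d0] := ltP d 0.
  have s0 : s != 0 by apply: hroot_neq0; rewrite lt_eqF.
  have -> : (fun t => sin (s * t) / s) = (fun t => s^-1 * sin (s * t)).
    by apply/funext => u; rewrite mulrC.
  have := is_derive_constM s^-1 (@is_derive_scale sin s t _ (is_derive_sin _)).
  by rewrite mulrC mulfK.
have [d1|d1] := eqVneq d 0; first exact: is_derive_id.
have s0 : s != 0 by exact: hroot_neq0.
have -> : (fun t => (expR (s * t) - expR (- (s * t))) / (2 * s)) =
    (fun t => (2 * s)^-1 * (expR (s * t) - expR (- (s * t)))).
  by apply/funext => u; rewrite mulrC.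
have := is_derive_constM (2 * s)^-1 (is_derive_sub (@is_derive_scale expR s t _ (is_derive_expR _)) (is_derive_expN s t)).
suff -> : (2 * s)^-1 * (expR (s * t) * s - - (s * expR (- (s * t)))) = (expR (s * t) + expR (- (s * t))) / 2 by [].
by field.
Qed.

Lemma is_derive_cn d t : is_derive t 1 (cn d) (d / 4 * sn d t).
Proof.
rewrite /sn /cn; set s := hroot d; have s2 : s ^+ 2 = `|d| / 4 := hroot_sqr d.
have [d0|d0] := ltP d 0.
  have s0 : s != 0 by apply: hroot_neq0; rewrite lt_eqF.
  have := @is_derive_scale cos s t _ (is_derive_cos _).
  suff -> : d / 4 * (sin (s * t) / s) = - sin (s * t) * s by [].
  have -> : d / 4 = - s ^+ 2 by rewrite s2 ltr0_norm//; lra.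
  by field.
have [d1|d1] := eqVneq d 0; first by rewrite d1 mul0r mul0r; exact: is_derive_const.
have s0 : s != 0 by exact: hroot_neq0.
have -> : (fun t => (expR (s * t) + expR (- (s * t))) / 2) =
    (fun t => 2^-1 * (expR (s * t) + expR (- (s * t)))).
  by apply/funext => u; rewrite mulrC.
have := is_derive_constM 2^-1 (is_derive_add (@is_derive_scale expR s t _ (is_derive_expR _)) (is_derive_expN s t)).
suff -> : 2^-1 * (expR (s * t) * s + - (s * expR (- (s * t)))) = d / 4 * ((expR (s * t) - expR (- (s * t))) / (2 * s)) by [].
have -> : d / 4 = s ^+ 2 by rewrite s2 ger0_norm.
by field.
Qed.

Lemma sn0 d : sn d 0 = 0.
Proof. by rewrite /sn mulr0 oppr0 sin0 subrr !mul0r; case: ifP => //; case: eqP. Qed.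

Lemma cn0 d : cn d 0 = 1.
Proof.
rewrite /cn mulr0 oppr0 cos0 expR0; case: ifP => // _; case: eqP => // _; by field.
Qed.

Definition osc a d t : R := expR (- (a / 2 * t)) * sn d t.
Definition osc' a d t : R := expR (- (a / 2 * t)) * (cn d t - a / 2 * sn d t).

Lemma is_derive_osc a d t : is_derive t 1 (osc a d) (osc' a d t).
Proof.
have := is_derive_mul (is_derive_expN (a / 2) t) (is_derive_sn d t).
suff -> : osc' a d t = - (a / 2 * expR (- (a / 2 * t))) * sn d t + expR (- (a / 2 * t)) * cn d t by [].
rewrite /osc'; ring.
Qed.

Lemma is_derive_osc' a b d t : d = a ^+ 2 - 4 * b ->
  is_derive t 1 (osc' a d) (- (a * osc' a d t + b * osc a d t)).
Proof.
move=> E; have := is_derive_mul (is_derive_expN (a / 2) t)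
  (is_derive_sub (is_derive_cn d t) (is_derive_constM (a / 2) (is_derive_sn d t))).
suff -> : - (a * osc' a d t + b * osc a d t) =
  - (a / 2 * expR (- (a / 2 * t))) * (cn d t - a / 2 * sn d t) +
  expR (- (a / 2 * t)) * (d / 4 * sn d t - a / 2 * cn d t) by [].
rewrite /osc' /osc E; by field.
Qed.

Lemma osc0 a d : osc a d 0 = 0.
Proof. by rewrite /osc sn0 mulr0. Qed.

Lemma osc'0 a d : osc' a d 0 = 1.
Proof. by rewrite /osc' sn0 cn0 !mulr0 oppr0 expR0 addr0 mulr1. Qed.

(** One Fourier mode of the first-order system for velocity and temperature. The damping terms only
    help, and the coupling contributes 2 (m - 1) u v <= u^2 + v^2 because 0 <= m <= 1; hence exp(-t)
    (u^2 + v^2) is nonincreasing. *)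
Lemma energy_le (u v : R -> R) (al be m : R) : 0 <= al -> 0 <= be -> 0 <= m <= 1 ->
  (forall t, is_derive t 1 u (- be * u t + m * v t)) ->
  (forall t, is_derive t 1 v (- al * v t - u t)) ->
  forall t, 0 <= t -> u t ^+ 2 + v t ^+ 2 <= expR t * (u 0 ^+ 2 + v 0 ^+ 2).
Proof.
move=> al0 be0 /andP[m0 m1] du dv t t0.
pose E s := expR (- (1 * s)) * (u s * u s + v s * v s).
pose E' s := - (1 * expR (- (1 * s))) * (u s * u s + v s * v s) + expR (- (1 * s)) *
  (((- be * u s + m * v s) * u s + u s * (- be * u s + m * v s)) +
   ((- al * v s - u s) * v s + v s * (- al * v s - u s))).
have dE s : is_derive s 1 E (E' s).
  apply: is_derive_mul; first exact: is_derive_expN.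
  by apply: is_derive_add; apply: is_derive_mul.
have [c _ H] := MVT_segment t0 (fun x _ => dE x) (continuous_subspaceT (continuous_derive dE)).
have E'0 : E' c <= 0.
  rewrite /E' mul1r mulNr -mulrN -mulrDr pmulr_rle0 ?expR_gt0//.
  have h1 := mulr_ge0 be0 (sqr_ge0 (u c)); have h2 := mulr_ge0 al0 (sqr_ge0 (v c)).
  have h3 : (1 - m) * (u c + v c) ^+ 2 + m * (u c ^+ 2 + v c ^+ 2) >= 0.
    by apply: addr_ge0; apply: mulr_ge0; rewrite ?subr_ge0 ?sqr_ge0// addr_ge0 ?sqr_ge0.
  by move: h1 h2 h3; move: (u c) (v c) => x y; lra.
have : E t <= E 0 by rewrite -subr_le0 H subr0 mulr_le0_ge0.
rewrite /E !mulr0 oppr0 expR0 !mul1r -!expr2 expRN => h.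
by rewrite -ler_pdivrMl ?expR_gt0.
Qed.

End Oscillator.

(** * Bounds, measurability and parity of the symbols *)

Section Kernels.
Context {R : realType}.
Local Notation E2 := (measurableTypeR R * measurableTypeR R)%type.
Variables nu eta : R.
Hypotheses (nu_gt0 : 0 < nu) (eta_gt0 : 0 < eta).
Implicit Types (xi : R * R) (t : R).

Local Notation a := (trace_coef nu eta).
Local Notation b := (det_coef nu eta).
Local Notation d := (discr nu eta).

Definition al xi : R := eta * xi.1 ^+ 2.
Definition be xi : R := nu * xi.2 ^+ 2.
Definition riesz xi : R := xi.1 ^+ 2 / dot xi xi.
Definition riesz12 xi : R := xi.1 * xi.2 / dot xi xi.
Definition rho xi : R := 1 + a xi.

Definition green xi t := osc (a xi) (d xi) t.
Definition green' xi t := osc' (a xi) (d xi) t.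

Lemma al_ge0 xi : 0 <= al xi. Proof. by rewrite mulr_ge0 ?sqr_ge0// ltW. Qed.
Lemma be_ge0 xi : 0 <= be xi. Proof. by rewrite mulr_ge0 ?sqr_ge0// ltW. Qed.

Lemma dotxx xi : dot xi xi = xi.1 ^+ 2 + xi.2 ^+ 2.
Proof. by rewrite /dot !expr2. Qed.

Lemma dotxx_ge0 xi : 0 <= dot xi xi.
Proof. by rewrite dotxx addr_ge0 ?sqr_ge0. Qed.

Lemma riesz_bound xi : 0 <= riesz xi <= 1.
Proof.
have h := dotxx_ge0 xi; rewrite /riesz divr_ge0 ?sqr_ge0//=.
have [->|h0] := eqVneq (dot xi xi) 0; first by rewrite invr0 mulr0.
by rewrite ler_pdivrMr ?lt_neqAle ?h ?andbT 1?eq_sym// mul1r dotxx lerDl sqr_ge0.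
Qed.

Lemma riesz12_bound xi : `|riesz12 xi| <= 1.
Proof.
have h := dotxx_ge0 xi; rewrite /riesz12 normrM normfV (ger0_norm h).
have [->|h0] := eqVneq (dot xi xi) 0; first by rewrite invr0 mulr0.
rewrite ler_pdivrMr ?lt_neqAle ?h ?andbT 1?eq_sym// mul1r dotxx ler_norml.
have h1 := sqr_ge0 (xi.1 - xi.2); have h2 := sqr_ge0 (xi.1 + xi.2).
by move: h1 h2; move: xi.1 xi.2 => x y h1 h2; apply/andP; split; nra.
Qed.

Lemma det_coefE xi : b xi = al xi * be xi + riesz xi.
Proof. rewrite /det_coef /al /be /riesz; ring. Qed.

Lemma trace_coefE xi : a xi = al xi + be xi.
Proof. by []. Qed.

Lemma is_derive_green xi t : is_derive t 1 (green xi) (green' xi t).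
Proof. exact: is_derive_osc. Qed.

Lemma is_derive_green' xi t : is_derive t 1 (green' xi) (- (a xi * green' xi t + b xi * green xi t)).
Proof. exact: is_derive_osc'. Qed.

Lemma abs_le_exp (x y t : R) : 0 <= t -> x ^+ 2 + y ^+ 2 <= expR t * 1 ->
  `|x| <= expR t /\ `|y| <= expR t.
Proof.
move=> t0; rewrite mulr1 => h.
have e1 : 1 <= expR t by rewrite -expR0 ler_expR.
have e2 : expR t <= expR t ^+ 2 by rewrite expr2 ler_peMl// expR_ge0.
have h1 := sqr_ge0 x; have h2 := sqr_ge0 y.
by split; rewrite -[leRHS]ger0_norm ?expR_ge0// -ler_sqr ?nnegrE// !real_normK ?num_real//; lra.
Qed.

(** The mode of (u_2, theta) with initial data (1, 0) is (K_1, K_4), to which the energy estimate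
    applies with [riesz] as coupling. *)
Lemma kernel_bound1 xi t : 0 <= t ->
  `|green' xi t + al xi * green xi t| <= expR t /\ `|green xi t| <= expR t.
Proof.
move=> t0; have := @energy_le R (fun t => green' xi t + al xi * green xi t) (fun t => - green xi t)
  (al xi) (be xi) (riesz xi) (al_ge0 xi) (be_ge0 xi) (riesz_bound xi) _ _ t t0.
rewrite /green /green' osc0 osc'0 -/(green xi t) -/(green' xi t) mulr0 oppr0 addr0 expr1n expr0n addr0 => H.
rewrite -(normrN (green xi t)); apply: abs_le_exp => //; apply: H => s.
- have := is_derive_add (is_derive_green' xi s) (is_derive_constM (al xi) (is_derive_green xi s)).
  suff -> : - be xi * (green' xi s + al xi * green xi s) + riesz xi * - green xi s =
    - (a xi * green' xi s + b xi * green xi s) + al xi * green' xi s by [].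
  rewrite det_coefE trace_coefE; ring.
- have := is_derive_opp (is_derive_green xi s).
  suff -> : - al xi * - green xi s - (green' xi s + al xi * green xi s) = - green' xi s by [].
  ring.
Qed.

(** The mode with initial data (0, 1), that is (K_3, K_5). *)
Lemma kernel_bound2 xi t : 0 <= t ->
  `|riesz xi * green xi t| <= expR t /\ `|green' xi t + be xi * green xi t| <= expR t.
Proof.
move=> t0; have := @energy_le R (fun t => riesz xi * green xi t) (fun t => green' xi t + be xi * green xi t)
  (al xi) (be xi) (riesz xi) (al_ge0 xi) (be_ge0 xi) (riesz_bound xi) _ _ t t0.
rewrite /green /green' osc0 osc'0 -/(green xi t) -/(green' xi t) !mulr0 addr0 expr1n expr0n add0r => H.
apply: abs_le_exp => //; apply: H => s.
- have := is_derive_constM (riesz xi) (is_derive_green xi s).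
  suff -> : - be xi * (riesz xi * green xi s) + riesz xi * (green' xi s + be xi * green xi s) = riesz xi * green' xi s by [].
  ring.
- have := is_derive_add (is_derive_green' xi s) (is_derive_constM (be xi) (is_derive_green xi s)).
  suff -> : - al xi * (green' xi s + be xi * green xi s) - riesz xi * green xi s =
    - (a xi * green' xi s + b xi * green xi s) + be xi * green' xi s by [].
  rewrite det_coefE trace_coefE; ring.
Qed.

Lemma measurable_inv_ge0 (f : E2 -> R) : measurable_fun setT f -> (forall x, 0 <= f x) ->
  measurable_fun setT (fun x => (f x)^-1).
Proof.
move=> mf f0; have -> : (fun x => (f x)^-1) = (fun x => f x `^ (-1)).
  by apply/funext => x; rewrite powR_inv1.
exact: (measurableT_comp (measurable_powR (-1)) mf).
Qed.

Lemma measurable_coord1 : measurable_fun [set: E2] (fun x : E2 => x.1 : R).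
Proof. exact: measurable_fst. Qed.

Lemma measurable_coord2 : measurable_fun [set: E2] (fun x : E2 => x.2 : R).
Proof. exact: measurable_snd. Qed.

Lemma measurable_dotxx_inv : measurable_fun [set: E2] (fun xi : E2 => (dot xi xi)^-1).
Proof.
apply: measurable_inv_ge0; last exact: dotxx_ge0.
by apply: measurable_funD; apply: measurable_funM; (exact: measurable_coord1 || exact: measurable_coord2).
Qed.

Lemma measurable_al : measurable_fun [set: E2] al.
Proof. by apply: measurable_funM => //; apply: measurable_funX; exact: measurable_coord1. Qed.

Lemma measurable_be : measurable_fun [set: E2] be.
Proof. by apply: measurable_funM => //; apply: measurable_funX; exact: measurable_coord2. Qed.

Lemma measurable_riesz : measurable_fun [set: E2] riesz.
Proof.
apply: measurable_funM; last exact: measurable_dotxx_inv.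
by apply: measurable_funX; exact: measurable_coord1.
Qed.

Lemma measurable_riesz12 : measurable_fun [set: E2] riesz12.
Proof.
apply: measurable_funM; last exact: measurable_dotxx_inv.
by apply: measurable_funM; [exact: measurable_coord1|exact: measurable_coord2].
Qed.

Lemma measurable_a : measurable_fun [set: E2] a.
Proof. by apply: measurable_funD; [exact: measurable_al|exact: measurable_be]. Qed.

Lemma measurable_b : measurable_fun [set: E2] b.
Proof.
rewrite (_ : b = fun xi => al xi * be xi + riesz xi); last by apply/funext => xi; exact: det_coefE.
apply: measurable_funD; last exact: measurable_riesz.
by apply: measurable_funM; [exact: measurable_al|exact: measurable_be].
Qed.

Lemma measurable_d : measurable_fun [set: E2] d.
Proof.
apply: measurable_funB; first by apply: measurable_funX; exact: measurable_a.
by apply: measurable_funM => //; exact: measurable_b.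
Qed.

Lemma measurable_hroot : measurable_fun [set: E2] (fun xi : E2 => hroot (d xi)).
Proof.
apply: measurable_funM => //.
apply: (measurableT_comp (f := @Num.sqrt R)).
  by apply: continuous_measurable_fun; exact: sqrt_continuous.
by apply: measurableT_comp => //; exact: measurable_d.
Qed.

Lemma measurable_hroot_scale t : measurable_fun [set: E2] (fun xi : E2 => hroot (d xi) * t).
Proof. by apply: measurable_funM => //; exact: measurable_hroot. Qed.

Lemma measurable_expR_comp (f : E2 -> R) : measurable_fun setT f ->
  measurable_fun setT (fun x => expR (f x)).
Proof. by move=> mf; exact: (measurableT_comp (@measurable_expR R) mf). Qed.

Lemma measurable_sn t : measurable_fun [set: E2] (fun xi : E2 => sn (d xi) t).
Proof.
have md := measurable_d; have mr := measurable_hroot_scale t.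
rewrite /sn; apply: measurable_fun_ifT; first by apply: measurable_fun_ltr.
  apply: measurable_funM.
    exact: (measurableT_comp (continuous_measurable_fun (@continuous_sin R)) mr).
  by apply: measurable_inv_ge0; [exact: measurable_hroot|move=> x; exact: hroot_ge0].
apply: measurable_fun_ifT => //; first by apply: measurable_fun_eqr.
apply: measurable_funM.
  by apply: measurable_funB; apply: measurable_expR_comp => //; exact: measurableT_comp.
apply: measurable_inv_ge0; last by move=> x; rewrite mulr_ge0// hroot_ge0.
by apply: measurable_funM => //; exact: measurable_hroot.
Qed.

Lemma measurable_cn t : measurable_fun [set: E2] (fun xi : E2 => cn (d xi) t).
Proof.
have md := measurable_d; have mr := measurable_hroot_scale t.
rewrite /cn; apply: measurable_fun_ifT; first by apply: measurable_fun_ltr.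
  exact: (measurableT_comp (continuous_measurable_fun (@continuous_cos R)) mr).
apply: measurable_fun_ifT => //; first by apply: measurable_fun_eqr.
apply: measurable_funM => //.
by apply: measurable_funD; apply: measurable_expR_comp => //; exact: measurableT_comp.
Qed.

Lemma measurable_decay t : measurable_fun [set: E2] (fun xi : E2 => expR (- (a xi / 2 * t))).
Proof.
apply: measurable_expR_comp; apply: measurableT_comp => //.
by apply: measurable_funM => //; apply: measurable_funM => //; exact: measurable_a.
Qed.

Lemma measurable_green t : measurable_fun [set: E2] (green^~ t).
Proof. by apply: measurable_funM; [exact: measurable_decay|exact: measurable_sn]. Qed.

Lemma measurable_green' t : measurable_fun [set: E2] (green'^~ t).
Proof.
apply: measurable_funM; first exact: measurable_decay.
apply: measurable_funB; first exact: measurable_cn.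
apply: measurable_funM; last exact: measurable_sn.
by apply: measurable_funM => //; exact: measurable_a.
Qed.

Lemma dotNN xi : dot (- xi) (- xi) = dot xi xi.
Proof. by rewrite !dotxx /= !sqrrN. Qed.

Lemma al_even xi : al (- xi) = al xi. Proof. by rewrite /al /= sqrrN. Qed.
Lemma be_even xi : be (- xi) = be xi. Proof. by rewrite /be /= sqrrN. Qed.
Lemma riesz_even xi : riesz (- xi) = riesz xi.
Proof. by rewrite /riesz dotNN /= sqrrN. Qed.
Lemma riesz12_even xi : riesz12 (- xi) = riesz12 xi.
Proof. by rewrite /riesz12 dotNN /= mulrNN. Qed.
Lemma a_even xi : a (- xi) = a xi.
Proof. by rewrite !trace_coefE al_even be_even. Qed.
Lemma d_even xi : d (- xi) = d xi.
Proof. by rewrite /discr !det_coefE a_even al_even be_even riesz_even. Qed.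
Lemma green_even xi t : green (- xi) t = green xi t.
Proof. by rewrite /green a_even d_even. Qed.
Lemma green'_even xi t : green' (- xi) t = green' xi t.
Proof. by rewrite /green' a_even d_even. Qed.

(** What the existence proof asks of a symbol. Linear growth of [k'] in [rho] is enough: the
    differential equation then bounds the second and third time derivatives by multiples of rho^2
    and rho^3, uniformly up to the factor exp(t). *)
Definition kernel (k k' : R -> R * R -> R) : Prop :=
  [/\ forall xi t, is_derive t 1 (k^~ xi) (k' t xi) /\
        is_derive t 1 (k'^~ xi) (- (a xi * k' t xi + b xi * k t xi)),
      forall t, measurable_fun [set: E2] (k t) /\ measurable_fun [set: E2] (k' t),
      forall t xi, k t (- xi) = k t xi &
      forall t xi, 0 <= t -> `|k t xi| <= expR t /\ `|k' t xi| <= rho xi * expR t].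

Section Combination.
Variables A B : R * R -> R.
Hypotheses (mA : measurable_fun [set: E2] A) (mB : measurable_fun [set: E2] B).
Hypotheses (eA : forall xi, A (- xi) = A xi) (eB : forall xi, B (- xi) = B xi).

(** All five symbols have this shape with [A] equal to 0 or 1. In [comb'] the second derivative of
    [green] has been replaced using the differential equation. *)
Definition comb t xi : R := A xi * green' xi t + B xi * green xi t.
Definition comb' t xi : R := A xi * - (a xi * green' xi t + b xi * green xi t) + B xi * green' xi t.

Lemma kernel_comb : (forall t xi, 0 <= t -> `|comb t xi| <= expR t /\ `|comb' t xi| <= rho xi * expR t) ->
  kernel comb comb'.
Proof.
move=> bd; split.
- move=> xi t; split.
    apply: is_derive_add; apply: is_derive_constM; [exact: is_derive_green'|exact: is_derive_green].
  have D := is_derive_opp (is_derive_add (is_derive_constM (a xi) (is_derive_green' xi t))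
    (is_derive_constM (b xi) (is_derive_green xi t))).
  have := is_derive_add (is_derive_constM (A xi) D) (is_derive_constM (B xi) (is_derive_green' xi t)).
  suff -> : - (a xi * comb' t xi + b xi * comb t xi) =
    A xi * - (a xi * - (a xi * green' xi t + b xi * green xi t) + b xi * green' xi t) +
    B xi * - (a xi * green' xi t + b xi * green xi t) by [].
  rewrite /comb /comb'; ring.
- have mg := measurable_green; have mg' := measurable_green'; have ma := measurable_a; have mb := measurable_b.
  move=> t; split; apply: measurable_funD; apply: measurable_funM => //.
  apply: measurableT_comp => //; apply: measurable_funD; exact: measurable_funM.
- by move=> t xi; rewrite /comb eA eB green_even green'_even.
- exact: bd.
Qed.

End Combination.

Lemma green'_bound xi t : 0 <= t -> `|green' xi t| <= (1 + al xi) * expR t.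
Proof.
move=> t0; have [h1 h2] := kernel_bound1 xi t0.
rewrite -(addrK (al xi * green xi t) (green' xi t)); apply: (le_trans (ler_normB _ _)).
by rewrite mulrDl mul1r lerD// normrM (ger0_norm (al_ge0 xi)) ler_wpM2l// al_ge0.
Qed.

(** Covers K_2, K_3 and K_4, with [c] equal to [- riesz12], [riesz] and -1. *)
Lemma kernel_green (c : R * R -> R) : measurable_fun [set: E2] c -> (forall xi, c (- xi) = c xi) ->
  (forall xi, `|c xi| <= 1) -> kernel (comb (fun=> 0) c) (comb' (fun=> 0) c).
Proof.
move=> mc ec c1; apply: kernel_comb => // t xi t0.
have [_ h2] := kernel_bound1 xi t0; have h3 := green'_bound xi t0.
rewrite /comb /comb' !mul0r !add0r (normrM (c xi) (green xi t)) (normrM (c xi) (green' xi t)); split.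
  by rewrite -[leRHS]mul1r ler_pM.
rewrite -[leRHS]mul1r ler_pM//; apply: (le_trans h3); rewrite ler_wpM2r ?expR_ge0//.
by rewrite /rho trace_coefE lerD2l lerDl be_ge0.
Qed.

(** The case of K_1. Bounding [comb'] term by term would cost rho^2; regrouping it as -(be K_1 +
    riesz green), which is one line of the first-order system, keeps the growth linear in [rho]. *)
Lemma kernel_al : kernel (comb (fun=> 1) al) (comb' (fun=> 1) al).
Proof.
apply: kernel_comb => //; [exact: measurable_al|exact: al_even|] => t xi t0.
have [h1 h2] := kernel_bound1 xi t0; rewrite /comb mul1r; split => //.
have -> : comb' (fun=> 1) al t xi = - (be xi * (green' xi t + al xi * green xi t) + riesz xi * green xi t).
  by rewrite /comb' det_coefE trace_coefE; ring.
have /andP[m0 m1] := riesz_bound xi; have b0 := be_ge0 xi; have a0 := al_ge0 xi.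
rewrite normrN; apply: (le_trans (ler_normD _ _)); rewrite (normrM (be xi)) (normrM (riesz xi)) (ger0_norm m0) (ger0_norm b0).
apply: (@le_trans _ _ (be xi * expR t + 1 * expR t)); first by apply: lerD; apply: ler_pM.
rewrite -mulrDl ler_wpM2r ?expR_ge0// /rho trace_coefE; lra.
Qed.

(** The case of K_5, regrouped in the same way with [al] as factor. *)
Lemma kernel_be : kernel (comb (fun=> 1) be) (comb' (fun=> 1) be).
Proof.
apply: kernel_comb => //; [exact: measurable_be|exact: be_even|] => t xi t0.
have [h1 h2] := kernel_bound2 xi t0; rewrite /comb mul1r; split => //.
have -> : comb' (fun=> 1) be t xi = - (al xi * (green' xi t + be xi * green xi t) + riesz xi * green xi t).
  by rewrite /comb' det_coefE trace_coefE; ring.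
have b0 := be_ge0 xi; have a0 := al_ge0 xi.
rewrite normrN; apply: (le_trans (ler_normD _ _)); rewrite (normrM (al xi)) (ger0_norm a0).
apply: (@le_trans _ _ (al xi * expR t + 1 * expR t)); first by rewrite mul1r lerD// ler_wpM2l.
rewrite -mulrDl ler_wpM2r ?expR_ge0// /rho trace_coefE; lra.
Qed.

End Kernels.

(** * The complex formulas for G_1 and G_2 reduced to real kernels *)

Section ComplexKernels.
Context {R : realType}.
Local Open Scope complex_scope.
Variables nu eta : R.
Implicit Types (xi : R * R) (t : R) (z : R[i]).

Lemma expC_real (x : R) : expC x%:C = (expR x)%:C.
Proof. by rewrite /expC /= cos0 sin0 mulr1 mulr0. Qed.

Lemma halfC : (2^-1 : R[i]) = (2^-1 : R)%:C.
Proof. by rewrite fmorphV rmorph_nat. Qed.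

Lemma expC_scale (x y t : R) :
  expC (Complex x y * t%:C) = Complex (expR (x * t) * cos (y * t)) (expR (x * t) * sin (y * t)).
Proof. by rewrite /expC; simpc. Qed.

Section Roots.
Variables a d : R.
Let s := hroot d.

Definition root1 z : R[i] := - (2^-1 * a%:C) - 2^-1 * z.
Definition root2 z : R[i] := - (2^-1 * a%:C) + 2^-1 * z.
Definition divdiff1 z t : R[i] := if root1 z == root2 z then t%:C * expC (root1 z * t%:C)
  else (expC (root1 z * t%:C) - expC (root2 z * t%:C)) / (root1 z - root2 z).
Definition divdiff2 z t : R[i] :=
  if root1 z == root2 z then expC (root1 z * t%:C) - root1 z * t%:C * expC (root1 z * t%:C)
  else (root1 z * expC (root2 z * t%:C) - root2 z * expC (root1 z * t%:C)) / (root1 z - root2 z).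

Lemma root1N z : root1 (- z) = root2 z.
Proof. by rewrite /root1 /root2 mulrN opprK. Qed.

Lemma root2N z : root2 (- z) = root1 z.
Proof. by rewrite -root1N opprK. Qed.

Lemma divdiff1N z t : divdiff1 (- z) t = divdiff1 z t.
Proof.
rewrite /divdiff1 root1N root2N eq_sym; case: eqP => [->//|_].
by rewrite -[in LHS]opprB -[X in _ / X]opprB invrN mulrNN.
Qed.

Lemma divdiff2N z t : divdiff2 (- z) t = divdiff2 z t.
Proof.
rewrite /divdiff2 root1N root2N eq_sym; case: eqP => [->//|_].
by rewrite -[in LHS]opprB -[X in _ / X]opprB invrN mulrNN.
Qed.

(* A square root of [d] that need not be the principal one: G1 and G2 are
   symmetric in the two roots. *)
Definition sqroot : R[i] := if d < 0 then Complex 0 (2 * s) else (2 * s)%:C.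

Lemma sqroot_sqr : sqroot ^+ 2 = d%:C.
Proof.
have h : (2 * s) ^+ 2 = `|d| by rewrite exprMn hroot_sqr; field.
rewrite /sqroot; case: ltP => d0; rewrite expr2; simpc; rewrite -?expr2 h.
  by rewrite ltr0_norm// opprK.
by rewrite ger0_norm.
Qed.

Lemma root12_sqroot : root1 sqroot = (if d < 0 then Complex (- (a / 2)) (- s) else (- (a / 2) - s)%:C) /\
  root2 sqroot = (if d < 0 then Complex (- (a / 2)) s else (- (a / 2) + s)%:C).
Proof.
rewrite /root1 /root2 /sqroot halfC; case: ifP => _; simpc.
  split; congr Complex; by field.
split; congr Complex; by field.
Qed.

(** For [d] nonzero, multiplying by the nonzero difference of the roots leaves identities between
    real and imaginary parts. For [d = 0], [hroot] vanishes and the confluent branch is taken on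
    both sides. *)
Lemma divdiff_sqroot t : divdiff1 sqroot t = (osc a d t)%:C /\ divdiff2 sqroot t = (osc' a d t + a * osc a d t)%:C.
Proof.
have [e1 e2] := root12_sqroot; rewrite /divdiff1 /divdiff2 e1 e2 /osc /osc' /sn /cn -/s.
have [d0|d0] := ltP d 0.
  have s0 : s != 0 by apply: hroot_neq0; rewrite lt_eqF.
  have ne : Complex (- (a / 2)) (- s) != Complex (- (a / 2)) s.
    by rewrite eq_complex /= eqxx/= eqNr.
  have nz : Complex (- (a / 2)) (- s) - Complex (- (a / 2)) s != 0 by rewrite subr_eq0.
  rewrite (negbTE ne) !expC_scale !mulNr cosN sinN.
  split; apply: (mulIf nz); rewrite divfK//; simpc.
    by congr Complex; field.
  by congr Complex; field.
have [d1|d1] := eqVneq d 0.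
  have s0 : s = 0 by rewrite /s /hroot d1 normr0 sqrtr0 mul0r.
  have E : expC ((- (a / 2))%:C * t%:C) = (expR (- (a / 2 * t)))%:C.
    by rewrite -rmorphM expC_real mulNr.
  rewrite s0 subr0 addr0 eqxx E -!rmorphM -rmorphB.
  by split; congr (_%:C); field.
have s0 : s != 0 by exact: hroot_neq0.
have ne : (- (a / 2) - s)%:C != (- (a / 2) + s)%:C.
  by rewrite eq_complex /= eqxx andbT (inj_eq (addrI _)) eqNr.
have nz : (- (a / 2) - s)%:C - (- (a / 2) + s)%:C != 0 by rewrite subr_eq0.
rewrite (negbTE ne).
have E x : expC ((- (a / 2) + x)%:C * t%:C) = (expR (- (a / 2 * t)) * expR (x * t))%:C.
  by rewrite -rmorphM expC_real -expRD mulrDl mulNr.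
have E1 : expC ((- (a / 2) - s)%:C * t%:C) = (expR (- (a / 2 * t)) * expR (- (s * t)))%:C.
  by rewrite E mulNr.
rewrite E1 E.
split; apply: (mulIf nz); rewrite divfK//; by simpc; congr Complex; field.
Qed.

End Roots.

Local Notation a := (trace_coef nu eta).
Local Notation d := (discr nu eta).

(** Two square roots of one number differ at most by sign, so the convention behind [sqrtC] never
    has to be unfolded. *)
Lemma sqrtC_sqroot xi : sqrtC (d xi)%:C = sqroot (d xi) \/ sqrtC (d xi)%:C = - sqroot (d xi).
Proof.
have : sqrtC (d xi)%:C ^+ 2 == sqroot (d xi) ^+ 2 by rewrite sqrtCK sqroot_sqr.
by rewrite eqf_sqr => /orP[] /eqP; [left|right].
Qed.

Lemma G1E xi t : G1 nu eta xi t = (green nu eta xi t)%:C.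
Proof.
have [h _] := divdiff_sqroot (a xi) (d xi) t.
transitivity (divdiff1 (a xi) (sqrtC (d xi)%:C) t) => //.
by have [->|->] := sqrtC_sqroot xi; rewrite ?divdiff1N.
Qed.

(** G_2 is the solution with value 1 and slope 0 at time 0, and g' + a g has these data because g''
    + a g' = - b g vanishes at 0. *)
Lemma G2E xi t : G2 nu eta xi t = (green' nu eta xi t + a xi * green nu eta xi t)%:C.
Proof.
have [_ h] := divdiff_sqroot (a xi) (d xi) t.
transitivity (divdiff2 (a xi) (sqrtC (d xi)%:C) t) => //.
by have [->|->] := sqrtC_sqroot xi; rewrite ?divdiff2N.
Qed.

Lemma K1E t : K1 nu eta t = fun xi => (comb nu eta (fun=> 1) (al eta) t xi)%:C.
Proof.
apply/funext => xi; rewrite /K1 G1E G2E -rmorphM -rmorphB /comb trace_coefE /be.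
by congr (_%:C); ring.
Qed.

Lemma K2E t : K2 nu eta t = fun xi => (comb nu eta (fun=> 0) (fun xi => - riesz12 xi) t xi)%:C.
Proof.
apply/funext => xi; rewrite /K2 G1E -rmorphN -rmorphM /comb.
by congr (_%:C); rewrite /riesz12; ring.
Qed.

Lemma K3E t : K3 nu eta t = fun xi => (comb nu eta (fun=> 0) riesz t xi)%:C.
Proof.
apply/funext => xi; rewrite /K3 G1E -rmorphM /comb.
by congr (_%:C); rewrite /riesz; ring.
Qed.

Lemma K4E t : K4 nu eta t = fun xi => (comb nu eta (fun=> 0) (fun=> -1) t xi)%:C.
Proof.
apply/funext => xi; rewrite /K4 G1E -rmorphN /comb.
by congr (_%:C); ring.
Qed.

Lemma K5E t : K5 nu eta t = fun xi => (comb nu eta (fun=> 1) (be nu) t xi)%:C.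
Proof.
apply/funext => xi; rewrite /K5 G1E G2E -rmorphM -rmorphB /comb trace_coefE /al.
by congr (_%:C); ring.
Qed.

End ComplexKernels.

(** * Existence *)

Section WeakForm.
Context {R : realType}.
Local Notation E2 := (measurableTypeR R * measurableTypeR R)%type.
Local Notation mu := (@leb2 R).
Local Notation L1 f := (mu.-integrable setT (EFin \o f)).
Local Notation Ltwo := (Lfun mu 2%:E).
Variables nu eta : R.
Hypotheses (nu_gt0 : 0 < nu) (eta_gt0 : 0 < eta).
Implicit Types (xi : R * R) (t : R) (phi f : R * R -> R).

Local Notation a := (trace_coef nu eta).
Local Notation b := (det_coef nu eta).
Local Notation rho := (rho nu eta).

Definition diffusion phi x : R := eta * d1 (d1 phi) x + nu * d2 (d2 phi) x.
(** The operator 1 - [diffusion], with symbol [rho]; iterated, it converts smoothness of [phi] into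
    decay of its transform. The explicit coefficients fit [test_comb]. *)
Definition resolvent phi x : R := 1 * phi x + -1 * diffusion phi x.
Definition bilap phi : R * R -> R := d1 (d1 (d2 (d2 phi))).

Lemma test_hartley1_L2 phi : test_function phi -> hartley1 phi \in Ltwo.
Proof. by move=> tp; have [] := hartley1_L2 (test_L1 tp) (test_L2 tp). Qed.

Lemma pairingE f phi : f \in Ltwo -> test_function phi ->
  pairing f phi = ((2 * pi) ^+ 2)^-1 * ip mu (hartley f) (hartley1 phi).
Proof.
move=> lf tp; have lp := test_L2 tp.
have pp : (2 * pi) ^+ 2 != 0 :> R by rewrite expf_neq0// mulf_neq0// gt_eqF// pi_gt0.
apply: (mulfI pp); rewrite mulVKf// -[LHS](plancherel lf lp) ipC [RHS]ipC.
apply: (plane_eq_ae_ip (hartley_measurable lp) _ (hartley_measurable lf) (hartley_L1 (test_L1 tp) lp)).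
exact: (plane_measurable (test_hartley1_L2 tp)).
Qed.

Lemma hartley1_dd2 c phi xi : test_function phi ->
  hartley1 (dd c (dd c phi)) xi = - coord c xi ^+ 2 * hartley1 phi xi.
Proof.
move=> tp; rewrite (hartley1_dd c xi (test_dd c tp)) (hartley1_dd c (- xi) tp) opprK.
by rewrite /coord; case: c => /=; ring.
Qed.

Lemma test_diffusion phi : test_function phi -> test_function (diffusion phi).
Proof.
move=> tp; apply: test_comb.
  exact: (test_dd false (test_dd false tp)).
exact: (test_dd true (test_dd true tp)).
Qed.

Lemma test_resolvent phi : test_function phi -> test_function (resolvent phi).
Proof. by move=> tp; apply: test_comb => //; exact: test_diffusion. Qed.

Lemma test_bilap phi : test_function phi -> test_function (bilap phi).
Proof.
move=> tp; exact: (test_dd false (test_dd false (test_dd true (test_dd true tp)))).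
Qed.

Lemma hartley1_comb (p q : R) phi psi xi : test_function phi -> test_function psi ->
  hartley1 (fun x => p * phi x + q * psi x) xi = p * hartley1 phi xi + q * hartley1 psi xi.
Proof.
move=> tp tq; have lp := test_L1 tp; have lq := test_L1 tq.
rewrite (hartley1_add xi (integrableZl measurableT p lp) (integrableZl measurableT q lq)).
by rewrite (hartley1_scale p xi lp) (hartley1_scale q xi lq).
Qed.

Lemma hartley1_diffusion phi xi : test_function phi ->
  hartley1 (diffusion phi) xi = - a xi * hartley1 phi xi.
Proof.
move=> tp; have t1 := test_dd false (test_dd false tp); have t2 := test_dd true (test_dd true tp).
apply: (etrans (hartley1_comb eta nu xi t1 t2)).
apply: (etrans (f_equal2 (fun p q => eta * p + nu * q) (hartley1_dd2 false xi tp) (hartley1_dd2 true xi tp))).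
rewrite /trace_coef /coord; ring.
Qed.

Lemma hartley1_resolvent phi xi : test_function phi ->
  hartley1 (resolvent phi) xi = rho xi * hartley1 phi xi.
Proof.
move=> tp; apply: (etrans (hartley1_comb 1 (-1) xi tp (test_diffusion tp))).
rewrite (hartley1_diffusion xi tp) /rho; ring.
Qed.

Lemma hartley1_bilap phi xi : test_function phi ->
  hartley1 (bilap phi) xi = xi.1 ^+ 2 * xi.2 ^+ 2 * hartley1 phi xi.
Proof.
move=> tp; have t2 := test_dd true (test_dd true tp).
apply: (etrans (hartley1_dd2 false xi t2)).
apply: (etrans (f_equal (fun p => - coord false xi ^+ 2 * p) (hartley1_dd2 true xi tp))).
rewrite /coord; ring.
Qed.

(** The exponent 3 is the growth of the third time derivative of a kernel, which is the remainder in
    the second-order Taylor estimate for [k']. *)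
Lemma rho3_L2 phi : test_function phi -> (fun xi => rho xi ^+ 3 * hartley1 phi xi) \in Ltwo.
Proof.
move=> tp; have t1 := test_resolvent tp; have t2 := test_resolvent t1; have t3 := test_resolvent t2.
rewrite (_ : (fun xi => _) = hartley1 (resolvent (resolvent (resolvent phi)))).
  exact: test_hartley1_L2.
apply/funext => xi.
rewrite (hartley1_resolvent xi t2) (hartley1_resolvent xi t1) (hartley1_resolvent xi tp); ring.
Qed.

Lemma rho_ge1 xi : 1 <= rho xi.
Proof. by rewrite /rho lerDl trace_coefE addr_ge0 ?al_ge0 ?be_ge0. Qed.

Lemma trace_le_rho xi : 0 <= a xi <= rho xi.
Proof.
by rewrite /rho lerDr ler01 andbT trace_coefE addr_ge0 ?al_ge0 ?be_ge0.
Qed.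

Lemma det_le_rho xi : 0 <= b xi <= rho xi ^+ 2.
Proof.
rewrite det_coefE /rho trace_coefE.
have /andP[m0 m1] := riesz_bound xi; have h1 := al_ge0 eta_gt0 xi; have h2 := be_ge0 nu_gt0 xi.
move: m0 m1 h1 h2; move: (riesz xi) (al eta xi) (be nu xi) => m x y m0 m1 h1 h2.
by have h3 := mulr_ge0 h1 h2; apply/andP; split; nra.
Qed.

Lemma Ltwo_poly_bound phi (k : R * R -> R) (c : R) : test_function phi ->
  measurable_fun [set: E2] k -> (forall xi, `|k xi| <= c * rho xi ^+ 3) ->
  (fun xi => k xi * hartley1 phi xi) \in Ltwo.
Proof.
move=> tp mk kb; apply: (@Ltwo_le _ E2 R mu _ (fun xi => c * (rho xi ^+ 3 * hartley1 phi xi))).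
- apply: measurable_funM => //; exact: (plane_measurable (test_hartley1_L2 tp)).
- exact: (plane_scale _ (rho3_L2 tp)).
- move=> xi; rewrite mulrA (normrM (k xi)) (normrM (c * rho xi ^+ 3)) ler_wpM2r//.
  by apply: (le_trans (kb xi)); exact: ler_norm.
Qed.

End WeakForm.

(** * Derivatives from quadratic remainders on [0, T] *)

Section Quotients.
Context {R : realType}.
Implicit Types (P : R -> R) (t D K T : R).

(** Stated for any filter so as to give both the two-sided derivative at positive times and the
    one-sided derivative at 0. *)
Lemma cvg_quotient (G : set_system R) {FG : Filter G} (Q : R -> R) D K :
  (forall e : R, 0 < e -> \forall h \near G, [/\ h != 0, `|h| < e & `|Q h - h * D| <= K * h ^+ 2]) ->
  h^-1 * Q h @[h --> G] --> D.
Proof.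
move=> H; apply/cvgrPdist_le => e e0.
have K0 : 0 < `|K| + 1 by rewrite ltr_wpDl.
apply: filterS (H _ (divr_gt0 e0 K0)) => h [h0 hd hQ].
have -> : D - h^-1 * Q h = - (h^-1 * (Q h - h * D)) by rewrite mulrBr mulKf// opprB.
rewrite normrN normrM normfV mulrC ler_pdivrMr ?normr_gt0//.
apply: (le_trans hQ); rewrite -(real_normK (num_real h)) expr2 mulrA ler_wpM2r//.
apply: (@le_trans _ _ ((`|K| + 1) * `|h|)).
  by rewrite ler_wpM2r// (le_trans (ler_norm K))// lerDl.
by rewrite mulrC -ler_pdivlMr// ltW.
Qed.

Lemma is_derive_of_taylor_on P t D K T : 0 < t < T ->
  (forall s, 0 <= s <= T -> `|P s - P t - (s - t) * D| <= K * (s - t) ^+ 2) ->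
  is_derive t 1 P D.
Proof.
move=> /andP[t0 tT] H.
have c : h^-1 *: (P (h *: 1 + t) - P t) @[h --> (0 : R)^'] --> D.
  apply: (@cvg_quotient _ _ (fun h => P (h *: 1 + t) - P t) D K) => e e0.
  have m0 : 0 < Num.min e (Num.min t (T - t)) by rewrite !lt_min e0 t0 subr_gt0.
  near=> h; have hm : `|h| < Num.min e (Num.min t (T - t)) by near: h; exact: dnbhs0_lt.
  move: hm; rewrite !lt_min => /and3P[he ht hT]; split => //.
    by near: h; exact: nbhs_dnbhs_neq.
  have := H (h + t); rewrite addrK -[h *: 1]/(h * 1) mulr1; apply.
  by move: ht hT; rewrite !ltr_norml => /andP[? ?] /andP[? ?]; lra.
apply: DeriveDef; first by apply/cvg_ex; exists D.
exact: (cvg_lim _ c).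
Unshelve. all: by end_near. Qed.

Lemma right_derive_of_taylor_on P D K T : 0 < T ->
  (forall s, 0 <= s <= T -> `|P s - P 0 - s * D| <= K * s ^+ 2) ->
  h^-1 * (P h - P 0) @[h --> 0^'+] --> D.
Proof.
move=> T0 H; apply: (@cvg_quotient _ _ (fun h => P h - P 0) D K) => e e0.
have m0 : 0 < Num.min e T by rewrite lt_min e0.
near=> h; have h0 : 0 < h by near: h; exact: nbhs_right_gt.
have hm : h < Num.min e T by near: h; exact: nbhs_right_lt.
move: hm; rewrite lt_min => /andP[he hT]; split; rewrite ?gt_eqF ?(gtr0_norm h0)//.
by apply: H; rewrite !ltW.
Unshelve. all: by end_near. Qed.

End Quotients.

(** * Time regularity of one mode paired with a test function *)

Section Existence.
Context {R : realType}.
Local Notation E2 := (measurableTypeR R * measurableTypeR R)%type.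
Local Notation mu := (@leb2 R).
Local Notation L1 f := (mu.-integrable setT (EFin \o f)).
Local Notation Ltwo := (Lfun mu 2%:E).
Variables nu eta : R.
Hypotheses (nu_gt0 : 0 < nu) (eta_gt0 : 0 < eta).
Implicit Types (xi : R * R) (s t T : R) (phi f F : R * R -> R) (X Y Z : R -> R * R -> R).

Local Notation a := (trace_coef nu eta).
Local Notation b := (det_coef nu eta).
Local Notation rho := (rho nu eta).
Local Notation kernel := (kernel nu eta).

Definition mode_pairing F X phi t : R := ip mu F (fun xi => X t xi * hartley1 phi xi).

Definition rho_bounded X := exists c : R, forall t xi, 0 <= t -> `|X t xi| <= c * expR t * rho xi ^+ 3.

Lemma rho_bounded_L2 X phi t : test_function phi -> rho_bounded X ->
  measurable_fun [set: E2] (X t) -> 0 <= t -> (fun xi => X t xi * hartley1 phi xi) \in Ltwo.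
Proof.
move=> tp [c cX] mX t0; apply: (@Ltwo_poly_bound R nu eta phi (X t) (c * expR t)) => //.
by move=> xi; exact: cX.
Qed.

(** Differentiation under the integral by Taylor's formula at each frequency: the remainder is at
    most a constant times rho^3 (s - t)^2, and Cauchy-Schwarz against [F] keeps it quadratic in
    [s - t]. *)
Lemma weak_taylor F X Y Z phi T : F \in Ltwo -> test_function phi ->
  (forall t, measurable_fun [set: E2] (X t)) -> (forall t, measurable_fun [set: E2] (Y t)) ->
  (forall xi t, is_derive t 1 (X^~ xi) (Y t xi)) -> (forall xi t, is_derive t 1 (Y^~ xi) (Z t xi)) ->
  rho_bounded X -> rho_bounded Y -> rho_bounded Z ->
  exists K, forall s t, 0 <= s <= T -> 0 <= t <= T ->
    `|mode_pairing F X phi s - mode_pairing F X phi t - (s - t) * mode_pairing F Y phi t| <= K * (s - t) ^+ 2.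
Proof.
move=> lF tp mX mY XY YZ bX bY [c cZ].
have lr := rho3_L2 nu eta tp.
have LX t : 0 <= t -> (fun xi => X t xi * hartley1 phi xi) \in Ltwo by exact: rho_bounded_L2.
have LY t : 0 <= t -> (fun xi => Y t xi * hartley1 phi xi) \in Ltwo by exact: rho_bounded_L2.
exists (l2 mu F * (`|c| * expR T * l2 mu (fun xi => rho xi ^+ 3 * hartley1 phi xi))) => s t.
move=> /andP[s0 sT] /andP[t0 tT]; have ls := LX s s0; have lt := LX t t0; have ly := LY t t0.
have lsy := plane_scale (s - t) ly.
rewrite /mode_pairing -(plane_ipZr (s - t) lF ly) -(plane_ipBr ls lt lF) -(plane_ipBr (plane_sub ls lt) lsy lF).
apply: (le_trans (plane_CS lF (plane_sub (plane_sub ls lt) lsy))).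
rewrite -mulrA ler_wpM2l ?l2_ge0// mulrAC.
set C := `|c| * expR T * (s - t) ^+ 2.
have C0 : 0 <= C by rewrite mulr_ge0 ?sqr_ge0// mulr_ge0// expR_ge0.
rewrite -(ger0_norm C0) -(@l2Z _ E2 R mu _ _ lr).
apply: (@l2_le _ E2 R mu).
- exact: (plane_measurable (plane_sub (plane_sub ls lt) lsy)).
- exact: (plane_scale _ lr).
move=> xi.
have -> : X s xi * hartley1 phi xi - X t xi * hartley1 phi xi - (s - t) * (Y t xi * hartley1 phi xi) =
    (X s xi - X t xi - (s - t) * Y t xi) * hartley1 phi xi by ring.
rewrite mulrA (normrM _ (hartley1 phi xi)) (normrM (C * _)) ler_wpM2r//.
apply: le_trans (ler_norm _).
have -> : C * rho xi ^+ 3 = `|c| * expR T * rho xi ^+ 3 * (s - t) ^+ 2 by rewrite /C; ring.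
have r0 : 0 <= rho xi ^+ 3 by rewrite exprn_ge0// (le_trans ler01)// rho_ge1.
apply: (taylor2 (XY xi) (YZ xi)) => x; rewrite ge_min le_max => /andP[h1 h2].
have x0 : 0 <= x by case/orP: h1 => h; [exact: le_trans h|exact: le_trans h].
have xT : x <= T by case/orP: h2 => h; [exact: (le_trans h)|exact: (le_trans h)].
apply: (le_trans (cZ x xi x0)); rewrite ler_wpM2r//.
apply: ler_pM; rewrite ?expR_ge0 ?ler_expR//; last exact: ler_norm.
(* The sign of [c] is recovered from its own bound at time 0 and frequency 0. *)
by have := le_trans (normr_ge0 _) (cZ 0 0 (lexx _)); rewrite expR0 mulr1 pmulr_lge0// exprn_gt0// (lt_le_trans ltr01)// rho_ge1.
Qed.

Section Kernel.
Variables k k' : R -> R * R -> R.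
Hypothesis kk : kernel k k'.

Definition kernel2 t xi : R := - (a xi * k' t xi + b xi * k t xi).
Definition kernel3 t xi : R := - (a xi * kernel2 t xi + b xi * k' t xi).

Let dk xi t : is_derive t 1 (k^~ xi) (k' t xi). Proof. by case: kk => [/(_ xi t)[]]. Qed.
Let dk' xi t : is_derive t 1 (k'^~ xi) (kernel2 t xi). Proof. by case: kk => [/(_ xi t)[]]. Qed.

Lemma is_derive_dot2 xi t : is_derive t 1 (kernel2^~ xi) (kernel3 t xi).
Proof.
have := is_derive_opp (is_derive_add (is_derive_constM (a xi) (dk' xi t))
    (is_derive_constM (b xi) (dk xi t))).
exact.
Qed.

Lemma kernel_measurable t : measurable_fun [set: E2] (k t).
Proof. by case: kk => [_ /(_ t)[]]. Qed.

Lemma kernel'_measurable t : measurable_fun [set: E2] (k' t).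
Proof. by case: kk => [_ /(_ t)[]]. Qed.

Lemma dot2_measurable t : measurable_fun [set: E2] (kernel2 t).
Proof.
have ma := measurable_a nu eta; have mb := measurable_b nu eta.
have m1 := kernel_measurable t; have m2 := kernel'_measurable t.
by apply: measurableT_comp => //; apply: measurable_funD; exact: measurable_funM.
Qed.

Lemma dot_bounds xi t : 0 <= t -> [/\ `|k t xi| <= rho xi ^+ 3 * expR t,
  `|k' t xi| <= rho xi ^+ 3 * expR t, `|kernel2 t xi| <= 2 * rho xi ^+ 3 * expR t &
  `|kernel3 t xi| <= 3 * rho xi ^+ 3 * expR t].
Proof.
move=> t0; have [h1 h2] : `|k t xi| <= expR t /\ `|k' t xi| <= rho xi * expR t.
  by case: kk => _ _ _ /(_ t xi t0).
have r1 := rho_ge1 nu_gt0 eta_gt0 xi; have e0 := expR_ge0 t.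
have /andP[a0 ar] := trace_le_rho nu_gt0 eta_gt0 xi.
have /andP[b0 br] := det_le_rho nu_gt0 eta_gt0 xi.
have r12 : rho xi <= rho xi ^+ 2 by rewrite expr2 ler_peMl// (le_trans ler01).
have r23 : rho xi ^+ 2 <= rho xi ^+ 3 by rewrite [in leRHS]exprS ler_peMl// sqr_ge0.
have h3 : `|kernel2 t xi| <= 2 * rho xi ^+ 2 * expR t.
  rewrite normrN; apply: (le_trans (ler_normD _ _)).
  rewrite (normrM (a xi)) (normrM (b xi)) (ger0_norm a0) (ger0_norm b0).
  apply: (@le_trans _ _ (rho xi * (rho xi * expR t) + rho xi ^+ 2 * expR t)).
    by apply: lerD; apply: ler_pM.
  by rewrite le_eqVlt; apply/orP; left; apply/eqP; ring.
have h4 : `|kernel3 t xi| <= 3 * rho xi ^+ 3 * expR t.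
  rewrite normrN; apply: (le_trans (ler_normD _ _)).
  rewrite (normrM (a xi)) (normrM (b xi)) (ger0_norm a0) (ger0_norm b0).
  apply: (@le_trans _ _ (rho xi * (2 * rho xi ^+ 2 * expR t) + rho xi ^+ 2 * (rho xi * expR t))).
    by apply: lerD; apply: ler_pM.
  by rewrite le_eqVlt; apply/orP; left; apply/eqP; ring.
split => //.
- apply: (le_trans h1); rewrite ler_peMl//; exact: le_trans (le_trans r12 r23).
- by apply: (le_trans h2); rewrite ler_wpM2r// (le_trans r12).
- by apply: (le_trans h3); rewrite ler_wpM2r// ler_wpM2l.
Qed.

Lemma rho_bounded_k : rho_bounded k.
Proof. by exists 1 => t xi t0; have [h _ _ _] := dot_bounds xi t0; rewrite mul1r mulrC. Qed.

Lemma rho_bounded_k' : rho_bounded k'.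
Proof. by exists 1 => t xi t0; have [_ h _ _] := dot_bounds xi t0; rewrite mul1r mulrC. Qed.

Lemma rho_bounded_dot2 : rho_bounded kernel2.
Proof. by exists 2 => t xi t0; have [_ _ h _] := dot_bounds xi t0; rewrite mulrAC. Qed.

Lemma rho_bounded_dot3 : rho_bounded kernel3.
Proof. by exists 3 => t xi t0; have [_ _ _ h] := dot_bounds xi t0; rewrite mulrAC. Qed.

Variables (F phi : R * R -> R).
Hypotheses (lF : F \in Ltwo) (tp : test_function phi).

Lemma is_derive_mode_pairing t : 0 < t -> is_derive t 1 (mode_pairing F k phi) (mode_pairing F k' phi t).
Proof.
move=> t0; have [K HK] := @weak_taylor F k k' kernel2 phi (t + 1) lF tp kernel_measurable
  kernel'_measurable dk dk' rho_bounded_k rho_bounded_k' rho_bounded_dot2.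
apply: (@is_derive_of_taylor_on _ _ _ _ K (t + 1)); first by rewrite t0 ltrDl ltr01.
by move=> s hs; apply: HK => //; rewrite ltW//= lerDl.
Qed.

Lemma is_derive_mode_pairing' t : 0 < t -> is_derive t 1 (mode_pairing F k' phi) (mode_pairing F kernel2 phi t).
Proof.
move=> t0; have [K HK] := @weak_taylor F k' kernel2 kernel3 phi (t + 1) lF tp kernel'_measurable
  dot2_measurable dk' is_derive_dot2 rho_bounded_k' rho_bounded_dot2 rho_bounded_dot3.
apply: (@is_derive_of_taylor_on _ _ _ _ K (t + 1)); first by rewrite t0 ltrDl ltr01.
by move=> s hs; apply: HK => //; rewrite ltW//= lerDl.
Qed.

Lemma right_derive_mode_pairing : h^-1 * (mode_pairing F k phi h - mode_pairing F k phi 0) @[h --> 0^'+] --> mode_pairing F k' phi 0.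
Proof.
have [K HK] := @weak_taylor F k k' kernel2 phi 1 lF tp kernel_measurable
  kernel'_measurable dk dk' rho_bounded_k rho_bounded_k' rho_bounded_dot2.
apply: (@right_derive_of_taylor_on _ _ _ K 1) => // s hs.
by have := HK s 0 hs; rewrite !subr0 lexx ler01 => /(_ isT).
Qed.

Lemma kernel_mul_L2 t : 0 <= t -> (fun xi => k t xi * F xi) \in Ltwo.
Proof.
move=> t0; apply: (@Ltwo_bounded_mul _ E2 R mu _ (expR t)) => //; first exact: kernel_measurable.
by move=> xi; case: kk => _ _ _ /(_ t xi t0)[].
Qed.

(** Frequency splitting: outside a large disk [F] is small and the kernels are bounded by exp(T);
    inside, the time derivative of the kernel is bounded and the mean value theorem applies. The 4
    in the tail compensates the bound 2 exp(T) on the difference and leaves [e / 2]. *)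
Lemma kernel_continuous t (e : R) : 0 <= t -> 0 < e -> exists2 dl : R, 0 < dl &
  forall s, 0 <= s -> `|s - t| < dl -> l2 mu (fun xi => k s xi * F xi - k t xi * F xi) <= e.
Proof.
move=> t0 e0; pose T := t + 1.
have T0 := expR_gt0 T.
have [N HN] := cvg_trunc lF (divr_gt0 e0 (mulr_gt0 (ltr0n R 4) T0)).
(* An upper bound of [rho] on the disk of radius [N]. *)
pose q := 1 + (eta + nu) * N%:R ^+ 2.
have q0 : 0 < q by rewrite ltr_wpDr// mulr_ge0 ?sqr_ge0// addr_ge0// ltW.
have lt := trunc_L2 N lF.
have D0 : 0 < 2 * (q * expR T) * (1 + l2 mu F) by rewrite !mulr_gt0// ltr_wpDr// l2_ge0.
exists (Num.min 1 (e / (2 * (q * expR T) * (1 + l2 mu F)))).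
  by rewrite lt_min ltr01 divr_gt0.
move=> s s0; rewrite lt_min => /andP[st1 st2].
have tT : t <= T by rewrite lerDl.
have sT : s <= T by move: st1; rewrite ltr_norml /T => /andP[_]; lra.
have kb u xi : 0 <= u -> `|k u xi| <= expR u /\ `|k' u xi| <= rho xi * expR u.
  by move=> u0; case: kk => _ _ _ /(_ u xi u0).
have mk : measurable_fun [set: E2] (fun xi => k s xi - k t xi).
  by apply: measurable_funB; exact: kernel_measurable.
have b2 xi : `|k s xi - k t xi| <= 2 * expR T.
  apply: (le_trans (ler_normB _ _)); rewrite mulr2n mulrDl mul1r.
  by apply: lerD; [apply: (le_trans (kb s xi s0).1)|apply: (le_trans (kb t xi t0).1)]; rewrite ler_expR.
have lr : (fun xi => F xi - trunc N F xi) \in Ltwo by exact: plane_sub.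
have l1 := @Ltwo_bounded_mul _ E2 R mu _ _ _ mk b2 lr.
have l1' := @Ltwo_bounded_mul _ E2 R mu _ _ _ mk b2 lt.
have -> : (fun xi => k s xi * F xi - k t xi * F xi) =
    (fun xi => (k s xi - k t xi) * (F xi - trunc N F xi) + (k s xi - k t xi) * trunc N F xi).
  by apply/funext => xi; ring.
apply: (le_trans (plane_triangle l1 l1')); rewrite (splitr e); apply: lerD.
- apply: (@le_trans _ _ (l2 mu (fun xi => 2 * expR T * (F xi - trunc N F xi)))).
    apply: (@l2_le _ E2 R mu); first exact: (plane_measurable l1).
      exact: (plane_scale _ lr).
    by move=> xi; rewrite !normrM ler_wpM2r// -normrM (le_trans (b2 xi))// ler_norm.
  rewrite l2Z// gtr0_norm ?mulr_gt0// l2_distC -ler_pdivlMl ?mulr_gt0//.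
  apply: (le_trans (HN N (leqnn _))); rewrite le_eqVlt; apply/orP; left; apply/eqP.
  by field; rewrite gt_eqF.
- apply: (@le_trans _ _ (l2 mu (fun xi => q * expR T * `|s - t| * F xi))).
    apply: (@l2_le _ E2 R mu); first exact: (plane_measurable l1').
      exact: (plane_scale _ lF).
    move=> xi; rewrite /trunc mulrA (normrM _ (\1__ _)) indicE.
    have [/set_mem xN|_] := boolP (xi \in disk N); last by rewrite normr0 mulr0.
    rewrite normr1 mulr1 (normrM _ (F xi)) (normrM (_ * _) (F xi)) ler_wpM2r//.
    apply: le_trans (ler_norm _); apply: (mean_value_le (dk xi)) => x.
    rewrite ge_min le_max => /andP[h1 h2].
    have x0 : 0 <= x by case/orP: h1 => h; exact: le_trans h.
    have xT : x <= T by case/orP: h2 => h; exact: (le_trans h).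
    apply: (le_trans (kb x xi x0).2); apply: ler_pM; rewrite ?expR_ge0 ?ler_expR//.
      by rewrite (le_trans ler01)// rho_ge1.
    rewrite /rho /q lerD2l /trace_coef; move: xN; rewrite /disk /= dotxx => h.
    have h3 := sqr_ge0 xi.1; have h4 := sqr_ge0 xi.2; have n0 := ltW nu_gt0; have n1 := ltW eta_gt0.
    have i1 : eta * xi.1 ^+ 2 <= eta * N%:R ^+ 2 by rewrite ler_wpM2l//; lra.
    have i2 : nu * xi.2 ^+ 2 <= nu * N%:R ^+ 2 by rewrite ler_wpM2l//; lra.
    by rewrite mulrDl lerD.
  rewrite l2Z// ger0_norm ?mulr_ge0 ?(ltW q0) ?expR_ge0//.
  have h0 : 0 <= l2 mu F by exact: l2_ge0.
  have : `|s - t| * (2 * (q * expR T) * (1 + l2 mu F)) <= e by rewrite -ler_pdivlMr// ltW.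
  have qT : 0 < q * expR T by rewrite mulr_gt0.
  move: (normr_ge0 (s - t)) qT h0; move: `|s - t| (q * expR T) (l2 mu F) => x y z x0 y0 z0 h.
  have : 0 <= x * y by rewrite mulr_ge0// ltW.
  lra.
Qed.

End Kernel.

End Existence.

(** * A family with the prescribed transform solves the weak problem *)

Section Solution.
Context {R : realType}.
Local Notation E2 := (measurableTypeR R * measurableTypeR R)%type.
Local Notation mu := (@leb2 R).
Local Notation L1 f := (mu.-integrable setT (EFin \o f)).
Local Notation Ltwo := (Lfun mu 2%:E).
Variables nu eta : R.
Hypotheses (nu_gt0 : 0 < nu) (eta_gt0 : 0 < eta).
Implicit Types (xi : R * R) (s t T : R) (phi psi f F : R * R -> R).

Local Notation a := (trace_coef nu eta).
Local Notation b := (det_coef nu eta).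
Local Notation rho := (rho nu eta).
Local Notation kernel := (kernel nu eta).

Lemma d11_Lap_invP f : f \in Ltwo -> d11_Lap_inv f \in Ltwo /\
  {ae mu, forall xi, hartley (d11_Lap_inv f) xi = riesz xi * hartley f xi}.
Proof.
apply: (@multiplierP R riesz 1); [exact: measurable_riesz| |exact: riesz_even].
by move=> xi; have /andP[m0 m1] := riesz_bound xi; rewrite ger0_norm.
Qed.

Lemma d12_Lap_invP f : f \in Ltwo -> d12_Lap_inv f \in Ltwo /\
  {ae mu, forall xi, hartley (d12_Lap_inv f) xi = riesz12 xi * hartley f xi}.
Proof.
by apply: (@multiplierP R riesz12 1); [exact: measurable_riesz12|exact: riesz12_bound|exact: riesz12_even].
Qed.

Lemma pairing_ae f (h : R * R -> R) phi : f \in Ltwo -> h \in Ltwo -> test_function phi ->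
  {ae mu, forall xi, hartley f xi = h xi} ->
  pairing f phi = ((2 * pi) ^+ 2)^-1 * ip mu h (hartley1 phi).
Proof.
move=> lf lh tp fh; rewrite (pairingE lf tp); congr (_ * _).
apply: (plane_eq_ae_ip (hartley_measurable lf) _ _ fh); first exact: (plane_measurable lh).
exact: (plane_measurable (test_hartley1_L2 tp)).
Qed.

Lemma is_derive1 (P Q : R -> R) : (forall t, 0 < t -> is_derive t 1 P (Q t)) ->
  forall t, 0 < t -> \forall s \near t, Q s = derive1 P s.
Proof.
move=> H t t0; near=> s; have s0 : 0 < s by near: s; exact: lt_nbhsr.
by have D := H s s0; rewrite derive1E derive_val.
Unshelve. all: by end_near. Qed.

Variables k1 k1' k2 k2' : R -> R * R -> R.
Hypotheses (kk1 : kernel k1 k1') (kk2 : kernel k2 k2').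
Variables (f1 f2 : R * R -> R).
Hypotheses (lf1 : f1 \in Ltwo) (lf2 : f2 \in Ltwo).
Variables (v : R -> R * R -> R) (v0 : R * R -> R) (v1 : (R * R -> R) -> R).
Hypothesis lv : forall t, 0 <= t -> v t \in Ltwo.
Hypothesis vE : forall t, 0 <= t ->
  {ae mu, forall xi, hartley (v t) xi = k1 t xi * hartley f1 xi + k2 t xi * hartley f2 xi}.
Hypothesis lv0 : v0 \in Ltwo.
Hypothesis v0E : {ae mu, forall xi, hartley v0 xi = k1 0 xi * hartley f1 xi + k2 0 xi * hartley f2 xi}.
Let c : R := ((2 * pi) ^+ 2)^-1.
Hypothesis v1E : forall phi, test_function phi ->
  v1 phi = c * (mode_pairing (hartley f1) k1' phi 0 + mode_pairing (hartley f2) k2' phi 0).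

Local Notation F1 := (hartley f1).
Local Notation F2 := (hartley f2).
Let lF1 : F1 \in Ltwo. Proof. exact: hartley_L2. Qed.
Let lF2 : F2 \in Ltwo. Proof. exact: hartley_L2. Qed.

Definition Vhat t xi : R := k1 t xi * F1 xi + k2 t xi * F2 xi.

Lemma Vhat_L2 t : 0 <= t -> Vhat t \in Ltwo.
Proof.
by move=> t0; exact: (plane_add (kernel_mul_L2 kk1 lF1 t0) (kernel_mul_L2 kk2 lF2 t0)).
Qed.

Lemma ip_mul_kernel k k' F (m phi : R * R -> R) t : kernel k k' -> F \in Ltwo ->
  ip mu (fun xi => m xi * (k t xi * F xi)) (hartley1 phi) =
  ip mu F (fun xi => m xi * k t xi * hartley1 phi xi).
Proof. by move=> kk lF; apply: eq_Rintegral => xi _; ring. Qed.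

(** Used with [m] constantly 1 for the solution itself and with [m = riesz] for the nonlocal
    term. *)
Lemma pairing_mul (m : R * R -> R) f phi t : 0 <= t -> test_function phi ->
  measurable_fun [set: E2] m -> (forall xi, `|m xi| <= 1) -> f \in Ltwo ->
  {ae mu, forall xi, hartley f xi = m xi * Vhat t xi} ->
  pairing f phi = c * (ip mu F1 (fun xi => m xi * k1 t xi * hartley1 phi xi) +
                       ip mu F2 (fun xi => m xi * k2 t xi * hartley1 phi xi)).
Proof.
move=> t0 tp mm m1 lf fE.
have l1 := @Ltwo_bounded_mul _ E2 R mu _ _ _ mm m1 (kernel_mul_L2 kk1 lF1 t0).
have l2' := @Ltwo_bounded_mul _ E2 R mu _ _ _ mm m1 (kernel_mul_L2 kk2 lF2 t0).
have lp := test_hartley1_L2 tp.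
have fE' : {ae mu, forall xi, hartley f xi = m xi * (k1 t xi * F1 xi) + m xi * (k2 t xi * F2 xi)}.
  by apply: (ae_impl fE) => xi ->; rewrite -mulrDr.
rewrite (pairing_ae lf (plane_add l1 l2') tp fE') -/c; congr (_ * _).
rewrite (plane_ipDl l1 l2' lp); congr (_ + _); exact: (ip_mul_kernel _ _ _ kk1) || exact: (ip_mul_kernel _ _ _ kk2).
Qed.

Lemma pairing_v t phi : 0 <= t -> test_function phi ->
  pairing (v t) phi = c * (mode_pairing F1 k1 phi t + mode_pairing F2 k2 phi t).
Proof.
move=> t0 tp; rewrite (@pairing_mul (fun=> 1) (v t) phi t t0 tp) ?normr1//.
- by congr (_ * (_ + _)); apply: eq_Rintegral => xi _; rewrite mul1r.
- exact: lv.
- by apply: (ae_impl (vE t0)) => xi ->; rewrite mul1r.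
Qed.

Lemma is_derive_pairing_v phi t : test_function phi -> 0 < t ->
  is_derive t 1 (fun t => pairing (v t) phi) (c * (mode_pairing F1 k1' phi t + mode_pairing F2 k2' phi t)).
Proof.
move=> tp t0; apply: (@near_eq_is_derive _ _ _ (fun t => c * (mode_pairing F1 k1 phi t + mode_pairing F2 k2 phi t))).
  by near=> s; rewrite pairing_v// ltW//; near: s; exact: lt_nbhsr.
apply: is_derive_constM; apply: is_derive_add.
- exact: (is_derive_mode_pairing nu_gt0 eta_gt0 kk1 lF1 tp t0).
- exact: (is_derive_mode_pairing nu_gt0 eta_gt0 kk2 lF2 tp t0).
Unshelve. all: by end_near. Qed.

Lemma is_derive_pairing_v' phi t : test_function phi -> 0 < t ->
  is_derive t 1 (derive1 (fun t => pairing (v t) phi))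
    (c * (mode_pairing F1 (kernel2 nu eta k1 k1') phi t + mode_pairing F2 (kernel2 nu eta k2 k2') phi t)).
Proof.
move=> tp t0.
apply: (@near_eq_is_derive _ _ _ (fun t => c * (mode_pairing F1 k1' phi t + mode_pairing F2 k2' phi t))).
  by apply: is_derive1 => // s s0; exact: is_derive_pairing_v.
apply: is_derive_constM; apply: is_derive_add.
- exact: (is_derive_mode_pairing' nu_gt0 eta_gt0 kk1 lF1 tp t0).
- exact: (is_derive_mode_pairing' nu_gt0 eta_gt0 kk2 lF2 tp t0).
Qed.

Lemma derive1_pairing_v phi t : test_function phi -> 0 < t ->
  derive1 (fun t => pairing (v t) phi) t = c * (mode_pairing F1 k1' phi t + mode_pairing F2 k2' phi t).
Proof. by move=> tp t0; rewrite derive1E; have D := is_derive_pairing_v tp t0; exact: derive_val. Qed.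

Lemma ip4_eq0 F (g1 g2 g3 g4 : R * R -> R) : F \in Ltwo -> g1 \in Ltwo -> g2 \in Ltwo -> g3 \in Ltwo ->
  g4 \in Ltwo -> (forall xi, g1 xi - g2 xi + nu * eta * g3 xi + g4 xi = 0) ->
  ip mu F g1 - ip mu F g2 + nu * eta * ip mu F g3 + ip mu F g4 = 0.
Proof.
move=> lF l1 l2' l3 l4 H; have l3' := plane_scale (nu * eta) l3.
rewrite -(plane_ipZr (nu * eta) lF l3) -(plane_ipBr l1 l2' lF) -(plane_ipDr (plane_sub l1 l2') l3' lF).
rewrite -(plane_ipDr (plane_add (plane_sub l1 l2') l3') l4 lF) /ip.
rewrite (_ : (fun xi => _) = (fun=> 0)) ?Rintegral_cst ?mul0r//.
by apply/funext => xi; rewrite H mulr0.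
Qed.

(** Once the derivatives of [phi] have become symbols, the four integrands cancel at each frequency
    by the differential equation of the kernel. *)
Lemma kernel_equation k k' F phi t : kernel k k' -> F \in Ltwo -> test_function phi -> 0 <= t ->
  mode_pairing F (kernel2 nu eta k k') phi t - mode_pairing F k' (diffusion nu eta phi) t + nu * eta * mode_pairing F k (bilap phi) t
   + ip mu F (fun xi => riesz xi * k t xi * hartley1 phi xi) = 0.
Proof.
move=> kk lF tp t0; apply: ip4_eq0 => //.
- exact: (rho_bounded_L2 tp (rho_bounded_dot2 nu_gt0 eta_gt0 kk) (dot2_measurable kk t) t0).
- exact: (rho_bounded_L2 (test_diffusion nu eta tp) (rho_bounded_k' nu_gt0 eta_gt0 kk) (kernel'_measurable kk t) t0).
- exact: (rho_bounded_L2 (test_bilap tp) (rho_bounded_k nu_gt0 eta_gt0 kk) (kernel_measurable kk t) t0).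
- have mr := @measurable_riesz R.
  have h := rho_bounded_L2 tp (rho_bounded_k nu_gt0 eta_gt0 kk) (kernel_measurable kk t) t0.
  have r1 xi : `|riesz xi : R| <= 1 by have /andP[m0 m1] := riesz_bound xi; rewrite ger0_norm.
  have := @Ltwo_bounded_mul _ E2 R mu _ _ _ mr r1 h.
  by under eq_fun do rewrite mulrA.
- move=> xi; rewrite (hartley1_diffusion nu eta xi tp) (hartley1_bilap xi tp) /kernel2 /det_coef /riesz.
  ring.
Qed.

Lemma solves_continuous : L2_continuous v.
Proof.
move=> t t0.
have lvB s : 0 <= s -> (fun x => v s x - v t x) \in Ltwo.
  by move=> s0; exact: (plane_sub (lv s0) (lv t0)).
have E s : 0 <= s -> ('N[mu]_2%:E[EFin \o (v s \- v t)%R] = (l2 mu (fun x => v s x - v t x))%:E)%E.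
  by move=> s0; rewrite (@Lnorm_l2 _ E2 R mu _ (lvB s s0)).
have pp : 0 < (2 * pi : R) by rewrite mulr_gt0// pi_gt0.
(* Plancherel moves the continuity question to the frequency side. *)
have iso s : 0 <= s -> 2 * pi * l2 mu (fun x => v s x - v t x) = l2 mu (fun xi => Vhat s xi - Vhat t xi).
  move=> s0; have lB := lvB s s0.
  have -> : l2 mu (fun xi => Vhat s xi - Vhat t xi) = l2 mu (hartley (fun x => v s x - v t x)).
    apply: (@eq_ae_l2 _ E2 R mu).
    - exact: (plane_measurable (plane_sub (Vhat_L2 s0) (Vhat_L2 t0))).
    - exact: hartley_measurable.
    - apply: (ae_impl3 (hartley_sub (lv s0) (lv t0)) (vE s0) (vE t0)) => xi -> -> ->.
      by [].
  rewrite /l2 (plancherel lB lB) sqrtrM ?sqr_ge0// sqrtr_sqr gtr0_norm//.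
have key (e : R) : 0 < e -> exists2 dl : R, 0 < dl & forall s, 0 <= s -> `|s - t| < dl ->
    l2 mu (fun x => v s x - v t x) <= e.
  move=> e0; have e1 : 0 < 2 * pi * e / 2 by rewrite divr_gt0// mulr_gt0.
  have [d1 d10 H1] := kernel_continuous nu_gt0 eta_gt0 kk1 lF1 t0 e1.
  have [d2 d20 H2] := kernel_continuous nu_gt0 eta_gt0 kk2 lF2 t0 e1.
  exists (Num.min d1 d2); first by rewrite lt_min d10.
  move=> s s0; rewrite lt_min => /andP[h1 h2].
  rewrite -(ler_pM2l pp) (iso s s0) (splitr (2 * pi * e)).
  have -> : (fun xi => Vhat s xi - Vhat t xi) = (fun xi =>
      (k1 s xi * F1 xi - k1 t xi * F1 xi) + (k2 s xi * F2 xi - k2 t xi * F2 xi)).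
    by apply/funext => xi; rewrite /Vhat; ring.
  have l1 := plane_sub (kernel_mul_L2 kk1 lF1 s0) (kernel_mul_L2 kk1 lF1 t0).
  have l2' := plane_sub (kernel_mul_L2 kk2 lF2 s0) (kernel_mul_L2 kk2 lF2 t0).
  by apply: (le_trans (plane_triangle l1 l2')); apply: lerD; [exact: H1|exact: H2].
have near_ge (P : R -> Prop) (dl : R) : 0 < dl -> (forall s, 0 <= s -> `|s - t| < dl -> P s) ->
    \forall s \near within `[0, +oo[ (nbhs t), P s.
  move=> dl0 HP; have nb := nbhsx_ballx t dl dl0.
  apply: (filterS _ nb) => s; rewrite /ball/= => ts s0; apply: HP; last by rewrite distrC.
  by move: s0; rewrite in_itv/= andbT.
apply: (@cvg_trans _ ((l2 mu (fun x => v s x - v t x))%:E @[s --> within `[0, +oo[ (nbhs t)])).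
  apply: near_eq_cvg; apply: (near_ge _ 1) => // s s0 _; exact/esym/E.
apply: cvg_EFin; first by near=> s.
apply/cvgrPdist_le => e e0; have [dl dl0 H] := key e e0.
apply: (near_ge _ dl dl0) => s s0 sd /=.
by rewrite sub0r normrN ger0_norm ?l2_ge0// H.
Unshelve. all: by end_near. Qed.

Theorem solves_kernel : solves nu eta v0 v1 v.
Proof.
split; first exact: solves_continuous.
- apply: (hartley_inj (lv (lexx _)) lv0).
  by apply: (ae_impl2 (vE (lexx _)) v0E) => xi -> ->.
- move=> phi tp; rewrite v1E//.
  have cv : c * (h^-1 * (mode_pairing F1 k1 phi h - mode_pairing F1 k1 phi 0) + h^-1 * (mode_pairing F2 k2 phi h - mode_pairing F2 k2 phi 0)) @[h --> 0^'+]
      --> c * (mode_pairing F1 k1' phi 0 + mode_pairing F2 k2' phi 0).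
    apply: cvgM; first exact: cvg_cst.
    apply: cvgD; [exact: (right_derive_mode_pairing nu_gt0 eta_gt0 kk1 lF1 tp)|exact: (right_derive_mode_pairing nu_gt0 eta_gt0 kk2 lF2 tp)].
  apply: cvg_trans cv; apply: near_eq_cvg; near=> h.
  have h0 : 0 <= h by apply/ltW; near: h; exact: nbhs_right_gt.
  by rewrite (pairing_v h0 tp) (pairing_v (lexx 0) tp); ring.
- move=> phi tp F A B t t0; have t0' := ltW t0.
  have D1 := is_derive_pairing_v tp t0; have D2 := is_derive_pairing_v' tp t0.
  split; first exact: ex_derive.
    exact: ex_derive.
  have -> : derive1 (derive1 (F phi)) t =
      c * (mode_pairing F1 (kernel2 nu eta k1 k1') phi t + mode_pairing F2 (kernel2 nu eta k2 k2') phi t).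
    by rewrite derive1E; exact: derive_val.
  have -> : derive1 (F A) t = c * (mode_pairing F1 k1' (diffusion nu eta phi) t + mode_pairing F2 k2' (diffusion nu eta phi) t).
    exact: (derive1_pairing_v (test_diffusion nu eta tp) t0).
  have -> : F B t = c * (mode_pairing F1 k1 (bilap phi) t + mode_pairing F2 k2 (bilap phi) t).
    exact: (pairing_v t0' (test_bilap tp)).
  have [ld dE] := d11_Lap_invP (lv t0').
  have r1 xi : `|riesz xi : R| <= 1 by have /andP[m0 m1] := riesz_bound xi; rewrite ger0_norm.
  have dE' : {ae mu, forall xi, hartley (d11_Lap_inv (v t)) xi = riesz xi * Vhat t xi}.
    by apply: (ae_impl2 dE (vE t0')) => xi -> ->.
  rewrite (pairing_mul t0' tp (@measurable_riesz R) r1 ld dE').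
  have e1 := kernel_equation kk1 lF1 tp t0'; have e2 := kernel_equation kk2 lF2 tp t0'.
  move: e1 e2; move: (mode_pairing F1 _ _ _) (mode_pairing F1 _ _ _) (mode_pairing F1 _ _ _) (ip mu F1 _) => p3 p2 p1 p4.
  move: (mode_pairing F2 _ _ _) (mode_pairing F2 _ _ _) (mode_pairing F2 _ _ _) (ip mu F2 _) => q3 q2 q1 q4 e1 e2.
  transitivity (c * ((p1 - p2 + nu * eta * p3 + p4) + (q1 - q2 + nu * eta * q3 + q4))); first by ring.
  by rewrite e1 e2 addr0 mulr0.
Unshelve. all: by end_near. Qed.

End Solution.

(** * Uniqueness *)

Section DifferentialInequality.
Context {R : realType}.
Implicit Types (P Q u v : R -> R) (s t T e : R).

Lemma is_derive_derive1 u t : derivable u t 1 -> is_derive t 1 u (derive1 u t).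
Proof. by move=> du; rewrite derive1E; exact: DeriveDef. Qed.

(** The mean value theorem for [v - c u] with [c] equal to 1 and to -1. *)
Lemma derive_abs_le u (u' : R -> R) v (v' : R -> R) s t : s < t ->
  {within `[s, t], continuous u} -> continuous v ->
  (forall x, s < x < t -> is_derive x 1 u (u' x)) ->
  (forall x : R, is_derive x 1 v (v' x)) ->
  (forall x, s < x < t -> `|u' x| <= v' x) -> `|u t - u s| <= v t - v s.
Proof.
move=> st cu cv du dv uv.
have key (c : R) : `|c| = 1 -> c * u t - c * u s <= v t - v s.
  move=> c1; have [x| |x xst] := @MVT R (fun x => v x - c * u x) (fun x => v' x - c * u' x) s t st.
  - rewrite in_itv/= => xst; apply: is_derive_sub.
    by apply: is_derive_constM; exact: du.
  - move=> x; apply: cvgB; first exact: (continuous_subspaceT cv).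
    by apply: cvgM; [exact: cvg_cst|exact: cu].
  - move=> h; have : 0 <= (v' x - c * u' x) * (t - s).
      rewrite mulr_ge0 ?subr_ge0 ?(ltW st)//; apply: (le_trans (ler_norm _)).
      by rewrite normrM c1 mul1r uv.
    rewrite -h; lra.
rewrite ler_norml; have := key 1 (normr1 _); have := key (-1); rewrite normrN1 => /(_ erefl).
lra.
Qed.

Variables (P Q be : R -> R) (k pa pb T : R).
Hypotheses (k0 : 0 < k) (pa0 : 0 <= pa) (pb0 : 0 <= pb).
Hypothesis dP : forall t, 0 < t -> derivable P t 1.
Hypothesis dq : forall t, 0 < t -> is_derive t 1 (fun s => derive1 P s - Q s) (- be t).
Hypothesis P0 : P 0 = 0.
Hypothesis Pr : h^-1 * (P h - P 0) @[h --> (0 : R)^'+] --> (0 : R).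
Hypothesis Q0 : Q h @[h --> (0 : R)^'+] --> (0 : R).
Hypothesis Qb : forall s, 0 < s <= T -> `|Q s| <= pa * expR (k * s).
Hypothesis bb : forall s, 0 < s <= T -> `|be s| <= pb * expR (k * s).

Let dexp (p x : R) : is_derive x 1 (fun x => p / k * expR (k * x)) (p * expR (k * x)).
Proof.
have := is_derive_constM (p / k) (@is_derive_scale R expR k x _ (is_derive_expR _)).
suff -> : p / k * (expR (k * x) * k) = p * expR (k * x) by [].
by field; rewrite gt_eqF.
Qed.

(** Continuity at 0 is a consequence of the one-sided difference quotient: [P h] is [h] times the
    quotient plus [P 0]. *)
Let cP t : 0 < t -> {within `[0, t], continuous P}.
Proof.
move=> t0; apply/continuous_within_itvP => //; split.
- move=> x; rewrite in_itv/= => /andP[x0 _].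
  by apply: differentiable_continuous; apply/derivable1_diffP; exact: dP.
- have c1 : h * (h^-1 * (P h - P 0)) + P 0 @[h --> (0 : R)^'+] --> (0 : R) * 0 + P 0.
    apply: cvgD; last exact: cvg_cst.
    by apply: cvgM => //; exact: cvg_within.
  rewrite mul0r add0r in c1; apply: cvg_trans c1; apply: near_eq_cvg; near=> h.
  by rewrite mulVKf ?subrK// gt_eqF//; near: h; exact: nbhs_right_gt.
- apply: cvg_at_left_filter.
  by apply: differentiable_continuous; apply/derivable1_diffP; exact: dP.
Unshelve. all: by end_near. Qed.

(** The initial condition concerns difference quotients, and [derive1 P] is not known to have a
    limit at 0. The mean value theorem supplies arbitrarily small [s] at which the derivative equals
    a quotient, and one such point suffices as a starting point for integration. *)
Let q_small e : 0 < e -> forall t, 0 < t -> exists2 s, 0 < s < t & `|derive1 P s - Q s| <= e.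
Proof.
move=> e0 t t0; have e20 : 0 < e / 2 by rewrite divr_gt0.
have [d1 /= d10 H1] : exists2 dl : R, 0 < dl & forall h, 0 < h < dl -> `|Q h| <= e / 2.
  move/cvgrPdist_le : Q0 => /(_ _ e20)[dl /= dl0 H]; exists dl => // h /andP[h0 hd].
  have := H h; rewrite /= !sub0r !normrN (gtr0_norm h0) => /(_ hd h0); exact.
have [d2 /= d20 H2] : exists2 dl : R, 0 < dl & forall h, 0 < h < dl -> `|h^-1 * (P h - P 0)| <= e / 2.
  move/cvgrPdist_le : Pr => /(_ _ e20)[dl /= dl0 H]; exists dl => // h /andP[h0 hd].
  have := H h; rewrite /= !sub0r !normrN (gtr0_norm h0) => /(_ hd h0); exact.
pose h := Num.min (Num.min d1 d2) t / 2.
have m0 : 0 < Num.min (Num.min d1 d2) t by rewrite !lt_min d10 d20.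
have h0 : 0 < h by rewrite divr_gt0.
have hm : h < Num.min (Num.min d1 d2) t by rewrite /h; lra.
move: hm; rewrite !lt_min => /andP[/andP[h1 h2] h3].
have [x|x] := @MVT R P (derive1 P) 0 h h0 _ (cP h0).
  by rewrite in_itv/= => /andP[x0 _]; exact: is_derive_derive1 (dP x0).
rewrite in_itv/= => /andP[x0 xh]; rewrite subr0 => E; exists x; first by rewrite x0 (lt_trans xh).
have Px : derive1 P x = h^-1 * (P h - P 0) by rewrite E mulrC mulfK// gt_eqF.
apply: (le_trans (ler_normB _ _)); rewrite (splitr e); apply: lerD.
  by rewrite Px; apply: H2; rewrite h0.
by apply: H1; rewrite x0 (lt_trans xh).
Qed.

(** First integration, of [- be] from a point supplied by [q_small]; the exponential weight yields
    the factor 1/k. *)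
Let q_bound t : 0 < t <= T -> `|derive1 P t - Q t| <= pb / k * expR (k * t).
Proof.
move=> /andP[t0 tT]; apply/ler_addgt0Pl => e e0.
have [s /andP[s0 st] qs] := q_small e0 t0.
have pk : 0 <= pb / k by rewrite divr_ge0// ltW.
have cq : {within `[s, t], continuous (fun s => derive1 P s - Q s)}.
  apply: derivable_within_continuous => x; rewrite in_itv/= => /andP[sx _].
  by have D := dq (lt_le_trans s0 sx); exact: ex_derive.
have := @derive_abs_le _ (fun t => - be t) _ _ s t st cq (continuous_derive (dexp pb)) _ (dexp pb).
move=> H; have {H} : `|(derive1 P t - Q t) - (derive1 P s - Q s)| <=
    pb / k * expR (k * t) - pb / k * expR (k * s).
  apply: H => x /andP[sx xt]; first by apply: dq; exact: lt_trans sx.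
  by rewrite normrN; apply: bb; rewrite (lt_trans s0 sx) (le_trans (ltW xt)).
have := mulr_ge0 pk (expR_ge0 (k * s)).
have := ler_normD ((derive1 P t - Q t) - (derive1 P s - Q s)) (derive1 P s - Q s).
rewrite subrK; lra.
Qed.

(** Second integration: [Q] is integrated once and [be] twice, hence the powers of [k]. Keeping
    [derive1 P - Q] together avoids differentiating [Q]. *)
Lemma ode_bound t : 0 <= t <= T -> `|P t| <= (pa / k + pb / k ^+ 2) * expR (k * t).
Proof.
move=> /andP[]; rewrite le_eqVlt => /orP[/eqP <- _|t0 tT].
  rewrite P0 normr0 mulr_ge0 ?expR_ge0//.
  by apply: addr_ge0; apply: divr_ge0 => //; rewrite ?exprn_ge0 ?(ltW k0).
pose C := pa + pb / k.
have C0 : 0 <= C by rewrite addr_ge0// divr_ge0// ltW.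
have := @derive_abs_le P (derive1 P) _ _ 0 t t0 (cP t0) (continuous_derive (dexp C)) _ (dexp C).
rewrite P0 subr0 mulr0 expR0 => H.
apply: (@le_trans _ _ (C / k * expR (k * t) - C / k * 1)).
  apply: H => x /andP[x0 xt]; first by exact: is_derive_derive1 (dP x0).
  have xT : 0 < x <= T by rewrite x0 (le_trans (ltW xt)).
  rewrite -(subrK (Q x) (derive1 P x)); apply: (le_trans (ler_normD _ _)).
  by rewrite /C mulrDl addrC; apply: lerD; [exact: Qb|exact: q_bound].
have -> : pa / k + pb / k ^+ 2 = C / k by rewrite /C; field; rewrite gt_eqF.
by rewrite lerBlDr lerDl mulr1 divr_ge0// ltW.
Qed.

End DifferentialInequality.

(** * Vanishing of the difference of two solutions *)

Section Uniqueness.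
Context {R : realType}.
Local Notation E2 := (measurableTypeR R * measurableTypeR R)%type.
Local Notation mu := (@leb2 R).
Local Notation L1 f := (mu.-integrable setT (EFin \o f)).
Local Notation Ltwo := (Lfun mu 2%:E).
Variables nu eta : R.
Hypotheses (nu_gt0 : 0 < nu) (eta_gt0 : 0 < eta).
Implicit Types (xi : R * R) (s t T e : R) (phi f g k : R * R -> R) (m n : nat).

Local Notation a := (trace_coef nu eta).
Local Notation b := (det_coef nu eta).

Let c : R := ((2 * pi) ^+ 2)^-1.
Let c_gt0 : 0 < c. Proof. by rewrite invr_gt0 exprn_gt0// mulr_gt0// pi_gt0. Qed.

Lemma hartley1_bounded phi : test_function phi ->
  exists C, forall xi, `|hartley1 phi xi| <= C.
Proof. by move=> tp; exists (\int[mu]_x (2 * `|phi x|)) => xi; exact: hartley1_le (test_L1 tp). Qed.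

(** Although [a] and [b] are unbounded, their products with the transform of [phi] are combinations
    of transforms of derivatives of [phi] and of a term with the bounded factor [riesz]. *)
Lemma symbols_bounded phi : test_function phi -> exists C, forall xi,
  [/\ `|hartley1 phi xi| <= C, `|a xi * hartley1 phi xi| <= C & `|b xi * hartley1 phi xi| <= C].
Proof.
move=> tp; have [C1 H1] := hartley1_bounded tp.
have [C2 H2] := hartley1_bounded (test_diffusion nu eta tp).
have [C3 H3] := hartley1_bounded (test_bilap tp).
have C0 (phi' : R * R -> R) (C : R) : (forall xi, `|hartley1 phi' xi| <= C) -> 0 <= C.
  by move=> H; exact: le_trans (normr_ge0 _) (H 0).
have h1 := C0 _ _ H1; have h2 := C0 _ _ H2; have h3 := C0 _ _ H3.
have ne : 0 <= nu * eta by rewrite mulr_ge0// ltW.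
have h4 := mulr_ge0 ne h3.
exists (C1 + C2 + nu * eta * C3) => xi; have i1 := H1 xi; have i2 := H2 xi; have i3 := H3 xi.
move: i2 i3; rewrite (hartley1_diffusion nu eta xi tp) (hartley1_bilap xi tp) mulNr normrN => i2 i3.
split; [by lra|by lra|].
have -> : b xi * hartley1 phi xi = nu * eta * (xi.1 ^+ 2 * xi.2 ^+ 2 * hartley1 phi xi) + riesz xi * hartley1 phi xi.
  by rewrite /det_coef /riesz; ring.
apply: (le_trans (ler_normD _ _)); rewrite (normrM (nu * eta)) (ger0_norm ne) (normrM (riesz xi)).
have /andP[m0 m1] := riesz_bound xi; rewrite (ger0_norm m0).
have j1 : riesz xi * `|hartley1 phi xi| <= 1 * C1 by apply: ler_pM.
have j2 : nu * eta * `|xi.1 ^+ 2 * xi.2 ^+ 2 * hartley1 phi xi| <= nu * eta * C3 by rewrite ler_wpM2l.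
lra.
Qed.

Lemma add4_eq0 (x y z u : R) : x - y + z + u = 0 -> x - y = - (z + u).
Proof. by move=> h; apply/eqP; rewrite eq_sym eqr_oppLR -subr_eq0 opprK addrC addrA h. Qed.

(** The reason for the quarter in [k / 4]: for k >= 1, (k/4)(1/k + 1/k^2) = (1 + 1/k)/4 <= 1/2. The
    variable [x] carries the approximation error. *)
Lemma ode_constant (k S n x : R) : 1 <= k -> 0 <= S -> 0 <= n -> 0 <= x ->
  (S * (k / 4 * n) + x) / k + (S * (k / 4 * n) + x) / k ^+ 2 <= S / 2 * n + 2 * x.
Proof.
move=> k1 S0 n0 x0; have k0 : 0 < k := lt_le_trans ltr01 k1.
have i0 : 0 < k^-1 by rewrite invr_gt0.
have i1 : k^-1 <= 1 by rewrite invf_le1.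
have -> : (S * (k / 4 * n) + x) / k + (S * (k / 4 * n) + x) / k ^+ 2 =
    (1 + k^-1) * (S / 4 * n) + (k^-1 + k^-1 ^+ 2) * x.
  by field; rewrite gt_eqF.
have j1 : 0 <= S / 4 * n by rewrite mulr_ge0// divr_ge0.
have j3 : k^-1 ^+ 2 <= 1 by rewrite expr_le1// ltW.
have j4 : (1 + k^-1) * (S / 4 * n) <= 2 * (S / 4 * n) by rewrite ler_wpM2r//; lra.
have j5 : (k^-1 + k^-1 ^+ 2) * x <= 2 * x by rewrite ler_wpM2r//; lra.
lra.
Qed.

Lemma disk_norm n (x : R * R) : n%:R < `|x| -> ~ disk n x.
Proof.
rewrite prod_normE lt_max /disk /= dotxx => h xn.
have h1 := sqr_ge0 x.1; have h2 := sqr_ge0 x.2; have n0 : 0 <= (n%:R : R) by [].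
case/orP: h => h.
  have : (n%:R : R) ^+ 2 < `|x.1| ^+ 2 by rewrite ltr_sqr ?nnegrE.
  by rewrite real_normK ?num_real//; lra.
have : (n%:R : R) ^+ 2 < `|x.2| ^+ 2 by rewrite ltr_sqr ?nnegrE.
by rewrite real_normK ?num_real//; lra.
Qed.

(* Division of [g] by the transform of a bump turns the truncations of the
   preimage, convolved with the bump, into test functions approximating [g]
   even after multiplication by the unbounded symbols [a] and [b]. *)
Lemma approximation m g : g \in Ltwo -> (forall xi, ~ disk m xi -> g xi = 0) ->
  exists phi : nat -> R * R -> R, (forall n, test_function (phi n)) /\
    forall e, 0 < e -> exists n,
     [/\ l2 mu (fun xi => hartley1 (phi n) xi - g xi) <= e,
         l2 mu (fun xi => a xi * (hartley1 (phi n) xi - g xi)) <= e &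
         l2 mu (fun xi => b xi * (hartley1 (phi n) xi - g xi)) <= e].
Proof.
move=> lg gm; have [p [tp ev] [p0 p00 pm]] := @exists_bump R m%:R (ler0n _ _).
pose psi := hartley1 p.
have mpsi : measurable_fun [set: E2] psi by exact: measurable_hartley1 (test_L1 tp).
(* Equal to [psi] on the disk carrying [g], and bounded below everywhere, so that its inverse is a
   bounded measurable multiplier. *)
pose q xi := Num.max (psi xi) p0.
have q0 xi : p0 <= q xi by rewrite /q le_max lexx orbT.
have q00 xi : 0 < q xi := lt_le_trans p00 (q0 xi).
have mq : measurable_fun [set: E2] (fun xi => (q xi)^-1).
  apply: measurable_inv_ge0; last by move=> xi; exact: ltW.
  by apply: measurable_maxr.
have qb xi : `|(q xi)^-1| <= p0^-1.
  by rewrite ger0_norm ?invr_ge0 ?(ltW (q00 xi))// lef_pV2// posrE.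
have lG : (fun xi => (q xi)^-1 * g xi) \in Ltwo := @Ltwo_bounded_mul _ E2 R mu _ _ _ mq qb lg.
have psiG xi : psi xi * ((q xi)^-1 * g xi) = g xi.
  have [xm|/gm ->] := pselect (disk m xi); last by rewrite !mulr0.
  by rewrite /q max_l ?mulVKf ?pm// gt_eqF// (lt_le_trans p00)// pm.
pose f x := c * hartley (fun xi => (q xi)^-1 * g xi) x.
have lf : f \in Ltwo by apply: plane_scale; exact: hartley_L2.
have pp : (2 * pi) ^+ 2 != 0 :> R by rewrite expf_neq0// mulf_neq0// gt_eqF// pi_gt0.
have Hf : {ae mu, forall xi, hartley f xi = (q xi)^-1 * g xi}.
  apply: (ae_impl2 (hartley_scale c (hartley_L2 lG)) (hartleyK lG)) => xi -> ->.
  by rewrite /c mulKf.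
have tr n x : n%:R < `|x| -> trunc n f x = 0.
  by move=> /disk_norm h; rewrite /trunc indicE memNset// mulr0.
exists (fun n => conv p (trunc n f)); split.
  by move=> n; apply: (conv_test (trunc_L1 n lf) (r := n%:R)) => // x; exact: tr.
move=> e e0; have [lhf cf] := hartleyP lf.
have [C HC] := symbols_bounded tp.
have C0 : 0 <= C by have [h _ _] := HC 0; exact: le_trans (normr_ge0 _) h.
have C1 : 0 < C + 1 by rewrite ltr_wpDl.
have [N HN] := cf _ (divr_gt0 e0 C1); exists N; have {}HN := HN N (leqnn _).
have lN := hartley1_trunc_L2 N lf.
have lD := plane_sub lN lhf.
(* The error is [psi] times the error of the truncated transform of [f]; the factor [psi] absorbs
   the unbounded symbol [k]. *)
have key k : measurable_fun [set: E2] k -> (forall xi, `|k xi * psi xi| <= C) ->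
    l2 mu (fun xi => k xi * (hartley1 (conv p (trunc N f)) xi - g xi)) <= e.
  move=> mk kC; have mkp : measurable_fun [set: E2] (fun xi => k xi * psi xi) by apply: measurable_funM.
  have lkD := @Ltwo_bounded_mul _ E2 R mu _ _ _ mkp kC lD.
  have E : {ae mu, forall xi, k xi * (hartley1 (conv p (trunc N f)) xi - g xi) =
      k xi * psi xi * (hartley1 (trunc N f) xi - hartley f xi)}.
    apply: (ae_impl Hf) => xi ->.
    rewrite (hartley1_conv (trunc_L1 N lf) (tr N) xi tp ev) -/psi -{1}(psiG xi); ring.
  rewrite (@eq_ae_l2 _ E2 R mu _ _ _ _ E).
  - apply: (@le_trans _ _ (l2 mu (fun xi => C * (hartley1 (trunc N f) xi - hartley f xi)))).
      apply: (@l2_le _ E2 R mu); first exact: (plane_measurable lkD).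
        exact: (plane_scale _ lD).
      by move=> xi; rewrite (normrM (k xi * psi xi)) (normrM C) ler_wpM2r// (le_trans (kC xi))// ler_norm.
    rewrite l2Z// ger0_norm//; apply: (@le_trans _ _ (C * (e / (C + 1)))); first by rewrite ler_wpM2l.
    by rewrite mulrCA ler_piMr ?(ltW e0)// ler_pdivrMr// mul1r lerDl.
  - apply: measurable_funM => //; apply: measurable_funB.
      apply: measurable_hartley1; apply: test_L1.
      by apply: (conv_test (trunc_L1 N lf) (r := N%:R)) => // x; exact: tr.
    exact: (plane_measurable lg).
  - exact: (plane_measurable lkD).
split.
- rewrite (_ : (fun xi => _) = (fun xi => 1 * (hartley1 (conv p (trunc N f)) xi - g xi))).
    by apply: (key (fun=> 1)) => // xi; rewrite mul1r; have [] := HC xi.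
  by apply/funext => xi; rewrite mul1r.
- by apply: key; [exact: measurable_a|move=> xi; have [] := HC xi].
- by apply: key; [exact: measurable_b|move=> xi; have [] := HC xi].
Qed.

Variable w : R -> R * R -> R.
Hypothesis lw : forall t, 0 <= t -> w t \in Ltwo.
Hypothesis w_bounded : forall T, exists W, forall t, 0 <= t <= T -> l2 mu (w t) <= W.
Hypothesis w0 : forall phi, test_function phi -> pairing (w 0) phi = 0.
Hypothesis w0' : forall phi, test_function phi ->
  h^-1 * (pairing (w h) phi - pairing (w 0) phi) @[h --> 0^'+] --> (0 : R).
Hypothesis w_eq : forall phi, test_function phi ->
  let F psi := fun t => pairing (w t) psi in
  forall t : R, 0 < t ->
  [/\ derivable (F phi) t 1, derivable (derive1 (F phi)) t 1 &
    derive1 (derive1 (F phi)) t - derive1 (F (diffusion nu eta phi)) t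
      + nu * eta * F (bilap phi) t + pairing (d11_Lap_inv (w t)) phi = 0].

Local Notation V t := (hartley (w t)).
Let lV t : 0 <= t -> V t \in Ltwo. Proof. by move=> t0; exact: hartley_L2 (lw t0). Qed.

Let N m t : R := l2 mu (trunc m (V t)).

(** The local fourth-order term and the nonlocal term together have the symbol [b]. *)
Lemma pairing_potential phi t : test_function phi -> 0 <= t ->
  nu * eta * pairing (w t) (bilap phi) + pairing (d11_Lap_inv (w t)) phi =
  c * ip mu (V t) (fun xi => b xi * hartley1 phi xi).
Proof.
move=> tp t0; have tb := test_bilap tp; have [ld dE] := d11_Lap_invP (lw t0).
have r1 xi : `|riesz xi : R| <= 1 by have /andP[m0 m1] := riesz_bound xi; rewrite ger0_norm.
have lr := @Ltwo_bounded_mul _ E2 R mu _ _ _ (@measurable_riesz R) r1 (lV t0).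
have lp := test_hartley1_L2 tp; have lb := test_hartley1_L2 tb.
rewrite (pairing_ae ld lr tp dE) (pairingE (lw t0) tb) -/c.
have lrp := @Ltwo_bounded_mul _ E2 R mu _ _ _ (@measurable_riesz R) r1 lp.
have -> : ip mu (fun xi => riesz xi * V t xi) (hartley1 phi) = ip mu (V t) (fun xi => riesz xi * hartley1 phi xi).
  by apply: eq_Rintegral => xi _; ring.
have E : (fun xi => b xi * hartley1 phi xi) = (fun xi => nu * eta * hartley1 (bilap phi) xi + riesz xi * hartley1 phi xi).
  by apply/funext => xi; rewrite (hartley1_bilap xi tp) /det_coef /riesz; ring.
have lb' := plane_scale (nu * eta) lb.
rewrite E (plane_ipDr lb' lrp (lV t0)) (plane_ipZr _ (lV t0) lb); ring.
Qed.

Lemma trace_mul_L2 phi : test_function phi -> (fun xi => a xi * hartley1 phi xi) \in Ltwo.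
Proof.
move=> tp; rewrite (_ : (fun xi => _) = (fun xi => - hartley1 (diffusion nu eta phi) xi)).
  exact: (plane_opp (test_hartley1_L2 (test_diffusion nu eta tp))).
by apply/funext => xi; rewrite (hartley1_diffusion nu eta xi tp) mulNr opprK.
Qed.

Lemma pairing_diffusion phi t : test_function phi -> 0 <= t ->
  pairing (w t) (diffusion nu eta phi) = - c * ip mu (V t) (fun xi => a xi * hartley1 phi xi).
Proof.
move=> tp t0; have td := test_diffusion nu eta tp; rewrite (pairingE (lw t0) td) -/c mulNr -mulrN.
rewrite -(mulN1r (ip _ _ _)).
have lA := trace_mul_L2 tp.
rewrite -(plane_ipZr (-1) (lV t0) lA); congr (_ * _); apply: eq_Rintegral => xi _.
by rewrite (hartley1_diffusion nu eta xi tp); ring.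
Qed.

Lemma halving m T (k S : R) : 0 < k -> 0 <= S ->
  (forall xi, disk m xi -> a xi <= k / 4 /\ b xi <= k / 4) -> 1 <= k ->
  (forall t, 0 <= t <= T -> N m t <= S * expR (k * t)) ->
  forall t, 0 <= t <= T -> N m t <= S / 2 * expR (k * t).
Proof.
move=> k0 S0 kab k1 NS t tT; have /andP[t0 _] := tT.
have [W0 HW0] := w_bounded T.
pose W := 2 * pi * W0.
have HW s : 0 <= s <= T -> l2 mu (V s) <= W.
  move=> sT; have /andP[s0 _] := sT; apply: (le_trans (hartley_le (lw s0))).
  by rewrite ler_wpM2l ?mulr_ge0 ?pi_ge0// HW0.
have W00 : 0 <= W by apply: le_trans (HW t tT); exact: l2_ge0.
(* The target is frozen at time [t], while the equation is used at all earlier times [s]; at [s = t]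
   the pairing with the approximant is close to the square of [N m t]. *)
pose g := trunc m (V t).
have lg : g \in Ltwo by exact: trunc_L2 (lV t0).
have gm xi : ~ disk m xi -> g xi = 0 by move=> h; rewrite /g /trunc indicE memNset// mulr0.
have [phi [tphi Hphi]] := approximation lg gm.
have Ng : N m t = l2 mu g by [].
have lsym (q : R * R -> R) : measurable_fun [set: E2] q -> (forall xi, 0 <= q xi) ->
    (forall xi, disk m xi -> q xi <= k / 4) ->
    (fun xi => q xi * g xi) \in Ltwo /\ forall s, 0 <= s <= T ->
    `|ip mu (V s) (fun xi => q xi * g xi)| <= S * expR (k * s) * (k / 4 * l2 mu g).
  move=> mq q0 qk.
  have qg xi : `|q xi * g xi| <= `|k / 4 * g xi|.
    have [xm|/gm ->] := pselect (disk m xi); last by rewrite !mulr0.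
    by rewrite (normrM (q xi)) (normrM (k / 4)) ler_wpM2r// !ger0_norm ?q0 ?qk// divr_ge0// ltW.
  have mqg : measurable_fun [set: E2] (fun xi => q xi * g xi).
    by apply: measurable_funM => //; exact: (plane_measurable lg).
  have lk := plane_scale (k / 4) lg.
  have lq : (fun xi => q xi * g xi) \in Ltwo by exact: (@Ltwo_le _ E2 R mu _ _ mqg lk qg).
  split => // s sT; have /andP[s0 _] := sT.
  (* Since [g] lives on the disk, only the part of [V s] on the same disk is seen, so the estimate
     closes on [N m]. *)
  have -> : ip mu (V s) (fun xi => q xi * g xi) = ip mu (trunc m (V s)) (fun xi => q xi * g xi).
    apply: eq_Rintegral => xi _; rewrite /g /trunc indicE.
    by case: (_ \in _); rewrite ?mulr1// !mulr0.
  apply: (le_trans (plane_CS (trunc_L2 m (lV s0)) lq)); apply: ler_pM; rewrite ?l2_ge0//; first exact: NS.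
  have := @l2_le _ E2 R mu _ _ mqg lk qg; rewrite l2Z// ger0_norm//; by rewrite divr_ge0// ltW.
have [lag Hag] := lsym a (measurable_a nu eta) (fun xi => (andP (trace_le_rho nu_gt0 eta_gt0 xi)).1) (fun xi h => (kab xi h).1).
have [lbg Hbg] := lsym b (measurable_b nu eta) (fun xi => (andP (det_le_rho nu_gt0 eta_gt0 xi)).1) (fun xi h => (kab xi h).2).
have main e : 0 < e -> N m t ^+ 2 <= S / 2 * expR (k * t) * N m t + e * (W * (2 * expR (k * t) + 1)).
  move=> e0; have [n [E1 Ea Eb]] := Hphi e e0.
  have tp := tphi n; set p := phi n in tp E1 Ea Eb.
  have lp := test_hartley1_L2 tp.
  have lap := trace_mul_L2 tp.
  have lbp : (fun xi => b xi * hartley1 p xi) \in Ltwo.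
    apply: (@Ltwo_poly_bound R nu eta p b 1 tp (measurable_b nu eta)) => xi.
    have /andP[b0 br] := det_le_rho nu_gt0 eta_gt0 xi; have r1 := rho_ge1 nu_gt0 eta_gt0 xi.
    by rewrite ger0_norm// mul1r (le_trans br)// [leRHS]exprS ler_peMl// sqr_ge0.
  have step (q : R * R -> R) s : 0 <= s <= T -> (fun xi => q xi * hartley1 p xi) \in Ltwo ->
      (fun xi => q xi * g xi) \in Ltwo -> l2 mu (fun xi => q xi * (hartley1 p xi - g xi)) <= e ->
      `|ip mu (V s) (fun xi => q xi * hartley1 p xi)| <= `|ip mu (V s) (fun xi => q xi * g xi)| + W * e.
    move=> sT l1 l2' Eq; have /andP[s0 _] := sT.
    rewrite -(subrK (ip mu (V s) (fun xi => q xi * g xi)) (ip mu (V s) (fun xi => q xi * hartley1 p xi))).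
    rewrite -(plane_ipBr l1 l2' (lV s0)) addrC; apply: (le_trans (ler_normD _ _)); rewrite lerD2l.
    apply: (le_trans (plane_CS (lV s0) (plane_sub l1 l2'))); apply: ler_pM; rewrite ?l2_ge0//; first exact: HW.
    by under [X in l2 _ X <= _]eq_fun do rewrite -mulrBr.
  (* The hypothesis on [N m] plus the error of replacing [g] by a transform; the error fits under
     the exponential weight because the weight is at least 1. *)
  pose A := S * (k / 4 * l2 mu g) + W * e.
  have A0 : 0 <= A.
    by rewrite addr_ge0// mulr_ge0 ?(ltW e0)// mulr_ge0 ?l2_ge0// divr_ge0// ltW.
  have bnd (q : R * R -> R) s : 0 <= s <= T -> (fun xi => q xi * hartley1 p xi) \in Ltwo ->
      (fun xi => q xi * g xi) \in Ltwo -> l2 mu (fun xi => q xi * (hartley1 p xi - g xi)) <= e ->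
      `|ip mu (V s) (fun xi => q xi * g xi)| <= S * expR (k * s) * (k / 4 * l2 mu g) ->
      c * `|ip mu (V s) (fun xi => q xi * hartley1 p xi)| <= c * A * expR (k * s).
    move=> sT l1 l2' Eq H; have /andP[s0 _] := sT; rewrite -mulrA ler_wpM2l ?(ltW c_gt0)//.
    apply: (le_trans (step q s sT l1 l2' Eq)).
    have e1 : 1 <= expR (k * s) by rewrite -expR0 ler_expR mulr_ge0// ltW.
    have We : W * e <= W * e * expR (k * s) by rewrite ler_peMr// mulr_ge0// ltW.
    apply: (le_trans (lerD H We)).
    by rewrite le_eqVlt; apply/orP; left; apply/eqP; rewrite /A; ring.
  (* With these the weak equation says that [derive1 P - Q] has derivative [- be]. *)
  pose P s := pairing (w s) p; pose Q s := pairing (w s) (diffusion nu eta p).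
  pose be s := nu * eta * pairing (w s) (bilap p) + pairing (d11_Lap_inv (w s)) p.
  have td := test_diffusion nu eta tp.
  have cA0 : 0 <= c * A by rewrite mulr_ge0// ltW.
  have Pt : `|P t| <= (c * A / k + c * A / k ^+ 2) * expR (k * t).
    apply: (@ode_bound R P Q be k (c * A) (c * A) T k0 cA0 cA0) => //.
    - by move=> s s0; have [] := w_eq tp s0.
    - move=> s s0; have [D1 D2 E] := w_eq tp s0; have [D3 _ _] := w_eq td s0.
      have -> : - be s = derive1 (derive1 P) s - derive1 Q s by rewrite -(add4_eq0 E).
      exact: (is_derive_sub (is_derive_derive1 D2) (is_derive_derive1 D3)).
    - exact: w0.
    - exact: w0'.
    - have c1 : h * (h^-1 * (Q h - Q 0)) @[h --> (0 : R)^'+] --> (0 : R) * 0.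
        by apply: cvgM; [exact: cvg_within|exact: w0'].
      rewrite mulr0 in c1; apply: cvg_trans c1; apply: near_eq_cvg; near=> h.
      rewrite mulVKf ?[Q 0]w0 ?subr0// gt_eqF//; near: h; exact: nbhs_right_gt.
    - move=> s /andP[s0 sT]; have sT' : 0 <= s <= T by rewrite ltW.
      rewrite /Q (pairing_diffusion tp (ltW s0)) normrM normrN (gtr0_norm c_gt0).
      exact: (bnd a s sT' lap lag Ea (Hag s sT')).
    - move=> s /andP[s0 sT]; have sT' : 0 <= s <= T by rewrite ltW.
      rewrite /be (pairing_potential tp (ltW s0)) normrM (gtr0_norm c_gt0).
      exact: (bnd b s sT' lbp lbg Eb (Hbg s sT')).
  have Pc : P t = c * ip mu (V t) (hartley1 p) by rewrite /P (pairingE (lw t0) tp).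
  have ipt : `|ip mu (V t) (hartley1 p)| <= (A / k + A / k ^+ 2) * expR (k * t).
    rewrite -(ler_pM2l c_gt0) -{1}(gtr0_norm c_gt0) -normrM -Pc; apply: (le_trans Pt).
    by rewrite le_eqVlt; apply/orP; left; apply/eqP; field; rewrite gt_eqF.
  have N2 : N m t ^+ 2 = ip mu (V t) g.
    rewrite Ng l2_sqr; apply: eq_Rintegral => xi _; rewrite /g /trunc indicE.
    by case: (_ \in _); rewrite ?mulr1// !mulr0.
  have NP : N m t ^+ 2 <= `|ip mu (V t) (hartley1 p)| + W * e.
    rewrite N2 -(subrK (ip mu (V t) (hartley1 p)) (ip mu (V t) g)) -(plane_ipBr lg lp (lV t0)) addrC.
    apply: lerD; first exact: ler_norm.
    apply: (le_trans (ler_norm _)); apply: (le_trans (plane_CS (lV t0) (plane_sub lg lp))).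
    by apply: ler_pM; rewrite ?l2_ge0//; [exact: HW|rewrite l2_distC].
  apply: (le_trans NP).
  have Ak : A / k + A / k ^+ 2 <= S / 2 * l2 mu g + 2 * (W * e).
    by apply: ode_constant => //; rewrite ?l2_ge0// mulr_ge0// ltW.
  have Ek := ler_wpM2r (expR_ge0 (k * t)) Ak.
  apply: (le_trans (lerD (le_trans ipt Ek) (lexx (W * e)))).
  by rewrite Ng le_eqVlt; apply/orP; left; apply/eqP; ring.
have N0 : 0 <= N m t by exact: l2_ge0.
have B0 : 0 <= S / 2 * expR (k * t) by rewrite mulr_ge0 ?expR_ge0// divr_ge0.
(* The approximation error goes to 0; a nonzero factor [N m t] is then cancelled. *)
have main' : N m t ^+ 2 <= S / 2 * expR (k * t) * N m t.
  apply/ler_addgt0Pl => e e0.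
  have D0 : 0 < W * (2 * expR (k * t) + 1) + 1.
    by rewrite ltr_wpDl// mulr_ge0// addr_ge0// mulr_ge0// expR_ge0.
  have := main _ (divr_gt0 e0 D0); rewrite addrC => /le_trans; apply; rewrite lerD2r.
  rewrite mulrAC ler_pdivrMr// ler_wpM2l ?(ltW e0)// lerDl//.
have [->//|Nn] := eqVneq (N m t) 0.
have Np : 0 < N m t by rewrite lt_neqAle eq_sym Nn.
by move: main'; rewrite expr2 ler_pM2r.
Unshelve. all: by end_near. Qed.

Lemma uniqueness t : 0 <= t -> {ae mu, forall x, w t x = 0}.
Proof.
move=> t0; have tt : 0 <= t <= t by rewrite t0 lexx.
have N0 m : N m t = 0.
  pose M : R := m%:R ^+ 2.
  have M0 : 0 <= M by exact: sqr_ge0.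
  pose al1 := eta * M; pose be1 := nu * M.
  have a0 : 0 <= al1 by rewrite mulr_ge0// ltW.
  have b0 : 0 <= be1 by rewrite mulr_ge0// ltW.
  (* On the disk [a <= al1 + be1] and [b <= al1 * be1 + 1], so both are at most [k / 4]. *)
  pose k := 4 * (al1 + be1 + al1 * be1 + 1).
  have ab0 := mulr_ge0 a0 b0.
  have k1 : 1 <= k by rewrite /k; lra.
  have k0 : 0 < k := lt_le_trans ltr01 k1.
  have kab xi : disk m xi -> a xi <= k / 4 /\ b xi <= k / 4.
    rewrite /disk /= dotxx => xm.
    have h1 := sqr_ge0 xi.1; have h2 := sqr_ge0 xi.2.
    have i1 : al eta xi <= al1 by rewrite ler_wpM2l ?(ltW eta_gt0)// /M; lra.
    have i2 : be nu xi <= be1 by rewrite ler_wpM2l ?(ltW nu_gt0)// /M; lra.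
    have -> : k / 4 = al1 + be1 + al1 * be1 + 1 by rewrite /k mulrC mulKf.
    have i3 : al eta xi * be nu xi <= al1 * be1.
      by apply: ler_pM; rewrite ?al_ge0 ?be_ge0.
    have /andP[m0 m1] := riesz_bound xi; rewrite det_coefE trace_coefE; split; lra.
  have [W0 HW0] := w_bounded t; pose W := 2 * pi * W0.
  have NW s : 0 <= s <= t -> N m s <= W * expR (k * s).
    move=> st; have /andP[s0 _] := st.
    apply: (@le_trans _ _ (W * 1)).
      rewrite mulr1; apply: (@le_trans _ _ (l2 mu (V s))).
        apply: (@l2_le _ E2 R mu); [exact: trunc_measurable (lV s0)|exact: lV|by move=> x; exact: trunc_le].
      apply: (le_trans (hartley_le (lw s0))).
      by rewrite ler_wpM2l ?mulr_ge0 ?pi_ge0// HW0.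
    have W00 : 0 <= W by rewrite mulr_ge0 ?mulr_ge0 ?pi_ge0//; exact: le_trans (l2_ge0 _ _) (HW0 s st).
    by rewrite ler_wpM2l// -expR0 ler_expR mulr_ge0// ltW.
  have W00 : 0 <= W by rewrite mulr_ge0 ?mulr_ge0 ?pi_ge0//; exact: le_trans (l2_ge0 _ _) (HW0 t tt).
  have Hn n s : 0 <= s <= t -> N m s <= W / 2 ^+ n * expR (k * s).
    elim: n s => [|n IH] s st; first by rewrite expr0 divr1 NW.
    rewrite exprSr invfM mulrA; apply: (halving k0 _ kab k1 IH st).
    by rewrite divr_ge0// exprn_ge0.
  apply/eqP; rewrite eq_le l2_ge0 andbT; apply/ler_addgt0Pl => e e0; rewrite addr0.
  (* Large enough because n <= 2^n. *)
  pose n := Num.bound (W * expR (k * t) / e).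
  apply: (le_trans (Hn n t tt)); rewrite mulrAC ler_pdivrMr ?exprn_gt0// (mulrC e) -ler_pdivrMr//.
  have x0 : 0 <= W * expR (k * t) / e by rewrite divr_ge0 ?(ltW e0)// mulr_ge0// expR_ge0.
  have := archi_boundP x0; rewrite -/n => h.
  apply: (le_trans (ltW h)); rewrite -natrX ler_nat; exact: ltnW (ltn_expl _ _).
have V0 : {ae mu, forall xi, V t xi = 0}.
  apply: (plane_eq0 (lV t0)); apply/eqP; rewrite eq_le l2_ge0 andbT.
  apply: (@cvgL2_le _ E2 R mu (fun m => trunc m (V t))) => //.
  - by move=> m; exact: trunc_L2 (lV t0).
  - exact: lV.
  - exact: cvg_trunc (lV t0).
  - by move=> m; have := N0 m; rewrite /N => ->.
have l0 : (fun=> 0 : R) \in Ltwo by exact: Ltwo0.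
apply: (hartley_inj (lw t0) l0).
have h0 : {ae mu, forall xi, hartley (fun=> 0 : R) xi = 0}.
  apply: (ae_impl (hartley_scale 0 l0)) => xi; by rewrite !mul0r.
by apply: (ae_impl2 V0 h0) => xi -> ->.
Qed.

End Uniqueness.

(** * The representation *)

Lemma derive1_val (R : realType) (u : R -> R) (t p : R) : is_derive t 1 u p -> derive1 u t = p.
Proof. by move=> du; rewrite derive1E; exact: derive_val. Qed.

Lemma sub_equations (R : comPzRingType) (k x y z p x' y' z' p' : R) :
  x - y + k * z + p = 0 -> x' - y' + k * z' + p' = 0 ->
  x - x' - (y - y') + k * (z - z') + (p - p') = 0.
Proof.
move=> E E'; rewrite -[RHS](subrr 0) -{1}E -E'; ring.
Qed.

Section Representation.
Context {R : realType}.
Local Notation E2 := (measurableTypeR R * measurableTypeR R)%type.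
Local Notation mu := (@leb2 R).
Local Notation Ltwo := (Lfun mu 2%:E).
Variables nu eta : R.
Hypotheses (nu_gt0 : 0 < nu) (eta_gt0 : 0 < eta).
Implicit Types (xi : R * R) (s t T : R) (phi psi f F : R * R -> R).

Local Notation kernel := (kernel nu eta).
Let c : R := ((2 * pi) ^+ 2)^-1.

(** The norm is continuous in time by the reverse triangle inequality, hence has a maximum on
    [0, T]. This provides the starting bound of the iteration. *)
Lemma L2_continuous_bounded (v : R -> R * R -> R) T : (forall t, 0 <= t -> v t \in Ltwo) ->
  L2_continuous v -> exists W, forall t, 0 <= t <= T -> l2 mu (v t) <= W.
Proof.
move=> lv cv; have [T0|T0] := ltP T 0.
  by exists 0 => t /andP[t0 tT]; move: (le_lt_trans (le_trans t0 tT) T0); rewrite ltxx.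
have cl : {within `[0, T], continuous (fun t => l2 mu (v t))}.
  apply/subspace_continuousP => t; rewrite /= in_itv/= => /andP[t0 tT].
  apply/cvgrPdist_le => e e0.
  have := cv t t0 => /fine_cvgP[_ /cvgrPdist_le/(_ e e0)].
  rewrite !near_withinE; apply: filterS => s H; rewrite /= in_itv/= => /andP[s0 sT].
  have {H} := H _; rewrite /= in_itv/= s0 => /(_ isT).
  have lB := plane_sub (lv s s0) (lv t t0).
  rewrite (_ : fine _ = l2 mu (fun x => v s x - v t x)); last first.
    by rewrite (@Lnorm_l2 _ E2 R mu _ lB).
  rewrite sub0r normrN ger0_norm ?l2_ge0// => h; apply: le_trans h.
  have h1 : l2 mu (v s) <= l2 mu (fun x => v s x - v t x) + l2 mu (v t).
    have := plane_triangle lB (lv t t0); under [X in l2 _ X <= _]eq_fun do rewrite subrK; exact.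
  have h2 : l2 mu (v t) <= l2 mu (fun x => v s x - v t x) + l2 mu (v s).
    have := plane_triangle (plane_sub (lv t t0) (lv s s0)) (lv s s0).
    by under [X in l2 _ X <= _]eq_fun do rewrite subrK; rewrite l2_distC.
  change (`|l2 mu (v t) - l2 mu (v s)| <= l2 mu (fun x => v s x - v t x)).
  by rewrite ler_norml; apply/andP; split; lra.
have [x _ H] := EVT_max T0 cl; exists (l2 mu (v x)) => t tT.
by apply: H; rewrite in_itv.
Qed.

Lemma pairing_sub f g phi : f \in Ltwo -> g \in Ltwo -> test_function phi ->
  pairing (fun x => f x - g x) phi = pairing f phi - pairing g phi.
Proof. by move=> lf lg tp; exact: (plane_ipBl lf lg (test_L2 tp)). Qed.

(** [d11_Lap_inv] picks representatives, so it is linear only almost everywhere; injectivity of the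
    transform gives that, and pairings do not see the difference. *)
Lemma pairing_d11_sub f g phi : f \in Ltwo -> g \in Ltwo -> test_function phi ->
  pairing (d11_Lap_inv (fun x => f x - g x)) phi =
  pairing (d11_Lap_inv f) phi - pairing (d11_Lap_inv g) phi.
Proof.
move=> lf lg tp; have [l1 e1] := d11_Lap_invP lf; have [l2' e2] := d11_Lap_invP lg.
have [l3 e3] := d11_Lap_invP (plane_sub lf lg).
rewrite -(pairing_sub l1 l2' tp).
have E : {ae mu, forall x, d11_Lap_inv (fun x => f x - g x) x = d11_Lap_inv f x - d11_Lap_inv g x}.
  apply: (hartley_inj l3 (plane_sub l1 l2')).
  apply: (ae_impl3 e3 (hartley_sub l1 l2') (ae_impl3 e1 e2 (hartley_sub lf lg) (fun x p q r => conj p (conj q r)))).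
  move=> xi h3 h4 [h1 [h2 h5]].
  apply: (etrans h3); apply: (etrans (f_equal (fun z => riesz xi * z) h5)).
  by apply: (etrans (mulrBr _ _ _)); exact/esym/(etrans h4 (f_equal2 (fun p q => p - q) h1 h2)).
apply: (plane_eq_ae_ip _ _ _ E); first exact: (plane_measurable l3).
  exact: (plane_measurable (plane_sub l1 l2')).
exact: (plane_measurable (test_L2 tp)).
Qed.

Lemma solves_unique v0 v1 (v v' : R -> R * R -> R) : v0 \in Ltwo ->
  (forall t, 0 <= t -> v t \in Ltwo) -> (forall t, 0 <= t -> v' t \in Ltwo) ->
  solves nu eta v0 v1 v -> solves nu eta v0 v1 v' ->
  forall t, 0 <= t -> ae_eq2 (v t) (v' t).
Proof.
move=> lv0 lv lv' [cv iv dv ev] [cv' iv' dv' ev'] t t0.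
pose w t x := v t x - v' t x.
have lw s : 0 <= s -> w s \in Ltwo by move=> s0; exact: (plane_sub (lv s s0) (lv' s s0)).
have pw phi s : test_function phi -> 0 <= s -> pairing (w s) phi = pairing (v s) phi - pairing (v' s) phi.
  by move=> tp s0; exact: (pairing_sub (lv s s0) (lv' s s0) tp).
have nearw phi s : test_function phi -> 0 < s ->
    \forall r \near s, pairing (v r) phi - pairing (v' r) phi = pairing (w r) phi.
  by move=> tp s0; near=> r; rewrite pw// ltW//; near: r; exact: lt_nbhsr.
have dw phi s : test_function phi -> 0 < s -> is_derive s 1 (fun s => pairing (w s) phi)
    (derive1 (fun s => pairing (v s) phi) s - derive1 (fun s => pairing (v' s) phi) s).
  move=> tp s0; apply: (near_eq_is_derive (nearw phi s tp s0)).
  have [D1 _ _] := ev phi tp s s0; have [D2 _ _] := ev' phi tp s s0.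
  exact: (is_derive_sub (is_derive_derive1 D1) (is_derive_derive1 D2)).
have wb T : exists W, forall s, 0 <= s <= T -> l2 mu (w s) <= W.
  have [W HW] := L2_continuous_bounded T lv cv; have [W' HW'] := L2_continuous_bounded T lv' cv'.
  exists (W + W') => s sT; have /andP[s0 _] := sT.
  apply: (le_trans (plane_triangle (lv s s0) (plane_opp (lv' s s0)))).
  by rewrite l2N lerD ?HW ?HW'.
have wz phi : test_function phi -> pairing (w 0) phi = 0.
  move=> tp; rewrite (pw phi 0 tp (lexx _)).
  have key u : u \in Ltwo -> ae_eq2 u v0 -> pairing u phi = pairing v0 phi.
    move=> lu uE; apply: (plane_eq_ae_ip _ _ _ uE); first exact: (plane_measurable lu).
      exact: (plane_measurable lv0).
    exact: (plane_measurable (test_L2 tp)).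
  by rewrite (key _ (lv 0 (lexx _)) iv) (key _ (lv' 0 (lexx _)) iv') subrr.
have wz' phi : test_function phi ->
    h^-1 * (pairing (w h) phi - pairing (w 0) phi) @[h --> 0^'+] --> (0 : R).
  move=> tp.
  have cB : (h^-1 * (pairing (v h) phi - pairing (v 0) phi) -
      h^-1 * (pairing (v' h) phi - pairing (v' 0) phi)) @[h --> 0^'+] --> v1 phi - v1 phi.
    exact: (cvgB (dv phi tp) (dv' phi tp)).
  rewrite subrr in cB; apply: cvg_trans cB; apply: near_eq_cvg; near=> h.
  have h0 : 0 <= h by apply/ltW; near: h; exact: nbhs_right_gt.
  by rewrite (pw phi h tp h0) (pw phi 0 tp (lexx _)); ring.
have we phi : test_function phi -> forall s, 0 < s ->
    [/\ derivable (fun s => pairing (w s) phi) s 1,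
      derivable (derive1 (fun s => pairing (w s) phi)) s 1 &
      derive1 (derive1 (fun s => pairing (w s) phi)) s -
        derive1 (fun s => pairing (w s) (diffusion nu eta phi)) s +
        nu * eta * pairing (w s) (bilap phi) + pairing (d11_Lap_inv (w s)) phi = 0].
  move=> tp s s0; have [D1 D2 E] := ev phi tp s s0; have [D1' D2' E'] := ev' phi tp s s0.
  have dw2 : is_derive s 1 (derive1 (fun s => pairing (w s) phi))
      (derive1 (derive1 (fun s => pairing (v s) phi)) s - derive1 (derive1 (fun s => pairing (v' s) phi)) s).
    apply: (near_eq_is_derive (is_derive1 (fun r r0 => dw phi r tp r0) s0)).
    exact: (is_derive_sub (is_derive_derive1 D2) (is_derive_derive1 D2')).
  have dw1 := dw phi s tp s0; have dA := dw _ s (test_diffusion nu eta tp) s0.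
  split; [exact: ex_derive|exact: ex_derive|].
  rewrite (derive1_val dw2) (derive1_val dA).
  rewrite (pw _ s (test_bilap tp) (ltW s0)) (pairing_d11_sub (lv s (ltW s0)) (lv' s (ltW s0)) tp).
  exact: (sub_equations E E').
have := uniqueness nu_gt0 eta_gt0 lw wb wz wz' we t0.
by move=> H; apply: (ae_impl H) => x /eqP; rewrite subr_eq0 => /eqP.
Unshelve. all: by end_near. Qed.


Definition flow (k1 k2 : R -> R * R -> R) f1 f2 t : R * R -> R :=
  multiplier (fun xi => (k1 t xi)%:C)%C f1 \+ multiplier (fun xi => (k2 t xi)%:C)%C f2.

Lemma kernel_multiplier k k' f t : kernel k k' -> f \in Ltwo -> 0 <= t ->
  multiplier (fun xi => (k t xi)%:C)%C f \in Ltwo /\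
  {ae mu, forall xi, hartley (multiplier (fun xi => (k t xi)%:C)%C f) xi = k t xi * hartley f xi}.
Proof.
move=> kk lf t0; apply: (@multiplierP R (k t) (expR t)) => //.
- exact: kernel_measurable kk t.
- by move=> xi; case: kk => _ _ _ /(_ t xi t0)[].
- by move=> xi; case: kk => _ _ /(_ t xi).
Qed.

Lemma flowP k1 k1' k2 k2' f1 f2 t : kernel k1 k1' -> kernel k2 k2' -> f1 \in Ltwo -> f2 \in Ltwo ->
  0 <= t -> flow k1 k2 f1 f2 t \in Ltwo /\
  {ae mu, forall xi, hartley (flow k1 k2 f1 f2 t) xi =
    k1 t xi * hartley f1 xi + k2 t xi * hartley f2 xi}.
Proof.
move=> kk1 kk2 lf1 lf2 t0.
have [l1 e1] := kernel_multiplier kk1 lf1 t0; have [l2' e2] := kernel_multiplier kk2 lf2 t0.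
split; first exact: (plane_add l1 l2').
apply: (ae_impl3 (hartley_add l1 l2') e1 e2) => xi h h1 h2.
exact: (etrans h (f_equal2 (fun p q => p + q) h1 h2)).
Qed.

(** From left to right, [flow] is a solution with the same data and uniqueness identifies it with
    [u]. From right to left, [u] has the transform of [flow], and that is all the existence theorem
    asks. *)
Lemma representation k1 k1' k2 k2' f1 f2 v0 v1 (u : R -> R * R -> R) :
  kernel k1 k1' -> kernel k2 k2' -> f1 \in Ltwo -> f2 \in Ltwo -> v0 \in Ltwo ->
  (forall xi, hartley v0 xi = k1 0 xi * hartley f1 xi + k2 0 xi * hartley f2 xi) ->
  (forall phi, test_function phi ->
    v1 phi = c * (mode_pairing (hartley f1) k1' phi 0 + mode_pairing (hartley f2) k2' phi 0)) ->
  (forall t, 0 <= t -> u t \in Ltwo) ->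
  solves nu eta v0 v1 u <-> (forall t, 0 <= t -> ae_eq2 (u t) (flow k1 k2 f1 f2 t)).
Proof.
move=> kk1 kk2 lf1 lf2 lv0 v0E v1E lu.
have v0E' : {ae mu, forall xi, hartley v0 xi = k1 0 xi * hartley f1 xi + k2 0 xi * hartley f2 xi}.
  exact: aeW.
split=> [su t t0|uE].
- have lfl s : 0 <= s -> flow k1 k2 f1 f2 s \in Ltwo by move=> s0; case: (flowP kk1 kk2 lf1 lf2 s0).
  have sf : solves nu eta v0 v1 (flow k1 k2 f1 f2).
    have fE s (s0 : 0 <= s) := (flowP kk1 kk2 lf1 lf2 s0).2.
    exact: (solves_kernel nu_gt0 eta_gt0 kk1 kk2 lf1 lf2 lfl fE lv0 v0E' v1E).
  exact: (solves_unique lv0 lu lfl su sf t0).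
- apply: (solves_kernel nu_gt0 eta_gt0 kk1 kk2 lf1 lf2 lu _ lv0 v0E' v1E) => t t0.
  have [lfl eE] := flowP kk1 kk2 lf1 lf2 t0.
  by apply: (ae_impl2 (hartley_ae (lu t t0) lfl (uE t t0)) eE) => xi ->.
Qed.

Local Notation a := (trace_coef nu eta).

Lemma comb_at0 (A B : R * R -> R) xi : comb nu eta A B 0 xi = A xi.
Proof. by rewrite /comb /green /green' osc0 osc'0 mulr0 addr0 mulr1. Qed.

Lemma comb'_at0 (A B : R * R -> R) xi : comb' nu eta A B 0 xi = - (A xi * a xi) + B xi.
Proof. by rewrite /comb' /green /green' osc0 osc'0; ring. Qed.

Lemma mode_pairing_comb' F (A B : R * R -> R) phi (m : R * R -> R) : (forall xi, - (A xi * a xi) + B xi = m xi) ->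
  mode_pairing F (comb' nu eta A B) phi 0 = ip mu F (fun xi => m xi * hartley1 phi xi).
Proof. by move=> H; apply: eq_Rintegral => xi _; rewrite comb'_at0 H. Qed.

Lemma scale_pairing_multiplier (p : R) f h phi (m : R * R -> R) : f \in Ltwo -> h \in Ltwo ->
  measurable_fun [set: E2] m -> (forall xi, `|m xi| <= 1) -> test_function phi ->
  {ae mu, forall xi, hartley h xi = m xi * hartley f xi} ->
  p * pairing h phi = c * ip mu (hartley f) (fun xi => p * m xi * hartley1 phi xi).
Proof.
move=> lf lh mm m1 tp hE; have lhf := hartley_L2 lf.
have lm := @Ltwo_bounded_mul _ E2 R mu _ _ _ mm m1 lhf.
have lmp := @Ltwo_bounded_mul _ E2 R mu _ _ _ mm m1 (test_hartley1_L2 tp).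
rewrite (pairing_ae lh lm tp hE) mulrCA; congr (_ * _).
transitivity (p * ip mu (hartley f) (fun xi => m xi * hartley1 phi xi)).
  by congr (_ * _); apply: eq_Rintegral => xi _; ring.
by rewrite -(plane_ipZr p lhf lmp); apply: eq_Rintegral => xi _; ring.
Qed.

Lemma scale_pairing (p : R) f phi : f \in Ltwo -> test_function phi ->
  p * pairing f phi = c * ip mu (hartley f) (fun xi => p * hartley1 phi xi).
Proof.
move=> lf tp; rewrite (pairingE lf tp) mulrCA; congr (_ * _).
by rewrite (plane_ipZr p (hartley_L2 lf) (test_hartley1_L2 tp)).
Qed.

Lemma scale_pairing_dd2 (p : R) f phi i : f \in Ltwo -> test_function phi ->
  p * pairing f (dd i (dd i phi)) =
  c * ip mu (hartley f) (fun xi => - (p * coord i xi ^+ 2) * hartley1 phi xi).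
Proof.
move=> lf tp; have t2 := test_dd i (test_dd i tp).
apply: (etrans (scale_pairing p lf t2)); congr (_ * _).
by apply: eq_Rintegral => xi _; rewrite (hartley1_dd2 i xi tp); ring.
Qed.

End Representation.


Theorem proposition1p1 (R : realType) (nu eta : R)
    (nu_gt0 : 0 < nu) (eta_gt0 : 0 < eta)
    (u10 u20 theta0 : R * R -> R)
    (u10_L2 : L2 u10) (u20_L2 : L2 u20) (theta0_L2 : L2 theta0)
    (u1 u2 theta : R -> R * R -> R)
    (u1_L2 : forall t : R, 0 <= t -> L2 (u1 t))
    (u2_L2 : forall t : R, 0 <= t -> L2 (u2 t))
    (theta_L2 : forall t : R, 0 <= t -> L2 (theta t)) :
  solves_system nu eta u10 u20 theta0 u1 u2 theta <->
  (forall t : R, 0 <= t ->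
    [/\ ae_eq2 (u1 t) (multiplier (K1 nu eta t) u10
                       \+ multiplier (K2 nu eta t) theta0),
        ae_eq2 (u2 t) (multiplier (K1 nu eta t) u20
                       \+ multiplier (K3 nu eta t) theta0) &
        ae_eq2 (theta t) (multiplier (K4 nu eta t) u20
                          \+ multiplier (K5 nu eta t) theta0)]).
Proof.
have kal := kernel_al nu_gt0 eta_gt0; have kbe := kernel_be nu_gt0 eta_gt0.
have kg m := @kernel_green R nu eta nu_gt0 eta_gt0 m.
have r1 xi : `|riesz xi : R| <= 1 by have /andP[m0 m1] := riesz_bound xi; rewrite ger0_norm.
have k2 : kernel nu eta (comb nu eta (fun=> 0) (fun xi => - riesz12 xi))
    (comb' nu eta (fun=> 0) (fun xi => - riesz12 xi)).
  apply: kg => [|xi|xi]; rewrite ?riesz12_even ?normrN ?riesz12_bound//.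
  by apply: measurableT_comp => //; exact: measurable_riesz12.
have k3 := kg riesz (@measurable_riesz R) (@riesz_even R) r1.
have k4 : kernel nu eta (comb nu eta (fun=> 0) (fun=> -1)) (comb' nu eta (fun=> 0) (fun=> -1)).
  by apply: kg => // xi; rewrite normrN1.
have trE := trace_coefE nu eta.
have R1 : solves nu eta u10 (fun phi => nu * pairing u10 (d2 (d2 phi))
    - pairing (d12_Lap_inv theta0) phi) u1 <->
    (forall t, 0 <= t -> ae_eq2 (u1 t)
      (flow (comb nu eta (fun=> 1) (al eta)) (comb nu eta (fun=> 0) (fun xi => - riesz12 xi)) u10 theta0 t)).
  apply: (representation nu_gt0 eta_gt0 kal k2 u10_L2 theta0_L2 u10_L2 _ _ u1_L2) => [xi|phi tp]; first by rewrite !comb_at0 mul1r mul0r addr0.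
  have [ld dE] := d12_Lap_invP theta0_L2.
  (* Puts the initial derivative in the form of a sum of two scaled pairings, one for each datum. *)
  have -> : forall x y : R, x - y = x + -1 * y by move=> x y; rewrite mulN1r.
  rewrite [X in X + _](scale_pairing_dd2 nu true u10_L2 tp).
  rewrite (scale_pairing_multiplier (-1) theta0_L2 ld (@measurable_riesz12 R) (@riesz12_bound R) tp dE).
  (* At time 0 the derivative of K_1 is - a + al = - be, the symbol of nu d_22, and that of K_2 is
     [- riesz12]. *)
  rewrite -mulrDr; congr (_ * (_ + _)); apply/esym/mode_pairing_comb' => xi; rewrite ?trE /be /coord; ring.
have R2 : solves nu eta u20 (fun phi => nu * pairing u20 (d2 (d2 phi))
    + pairing (d11_Lap_inv theta0) phi) u2 <->
    (forall t, 0 <= t -> ae_eq2 (u2 t)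
      (flow (comb nu eta (fun=> 1) (al eta)) (comb nu eta (fun=> 0) riesz) u20 theta0 t)).
  apply: (representation nu_gt0 eta_gt0 kal k3 u20_L2 theta0_L2 u20_L2 _ _ u2_L2) => [xi|phi tp]; first by rewrite !comb_at0 mul1r mul0r addr0.
  have [ld dE] := d11_Lap_invP theta0_L2.
  rewrite [X in X + _](scale_pairing_dd2 nu true u20_L2 tp) -[X in _ + X]mul1r.
  rewrite (scale_pairing_multiplier 1 theta0_L2 ld (@measurable_riesz R) r1 tp dE).
  rewrite -mulrDr; congr (_ * (_ + _)); apply/esym/mode_pairing_comb' => xi; rewrite ?trE /be /coord; ring.
have R3 : solves nu eta theta0 (fun phi => eta * pairing theta0 (d1 (d1 phi))
    - pairing u20 phi) theta <->
    (forall t, 0 <= t -> ae_eq2 (theta t)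
      (flow (comb nu eta (fun=> 0) (fun=> -1)) (comb nu eta (fun=> 1) (be nu)) u20 theta0 t)).
  apply: (representation nu_gt0 eta_gt0 k4 kbe u20_L2 theta0_L2 theta0_L2 _ _ theta_L2) => [xi|phi tp]; first by rewrite !comb_at0 mul1r mul0r add0r.
  (* The summands are also exchanged, since the first datum in the formula for theta is [u20]. *)
  have -> : forall x y : R, x - y = -1 * y + x by move=> x y; rewrite mulN1r addrC.
  rewrite [X in _ + X](scale_pairing_dd2 eta false theta0_L2 tp) (scale_pairing (-1) u20_L2 tp).
  rewrite -mulrDr; congr (_ * (_ + _)); apply/esym/mode_pairing_comb' => xi; rewrite ?trE /al /coord; ring.
split=> [[/R1 E1 /R2 E2 /R3 E3] t t0|E].
  by rewrite !K1E K2E K3E K4E K5E; split; [exact: E1|exact: E2|exact: E3].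
split.
- by apply/R1 => t t0; have [h _ _] := E t t0; rewrite K1E K2E in h.
- by apply/R2 => t t0; have [_ h _] := E t t0; rewrite K1E K3E in h.
- by apply/R3 => t t0; have [_ _ h] := E t t0; rewrite K4E K5E in h.
Qed.
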